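(* Let $\mathcal{B}=\{b_1,b_2,b_3,\dots\}$ be a sequence of integers greater than $1$ such that $b_i$ and $b_j$ are relatively prime for $i\neq j$ and $\sum_i 1/b_i<\infty$. Suppose that $2\notin\mathcal{B}$ and that the counting function $\mathcal{N}^{\mathcal{B}}(N)=\#\{n\in\mathcal{Z}^{\mathcal{B}}: 1\le n\le N\}$ of the $\mathcal{B}$-integers satisfies $$\mathcal{N}^{\mathcal{B}}(N)=A\,N^{\alpha}+O\left(N^{\beta}\right)\qquad (N\to\infty)$$ for some constants $A>0$ and $0\le\beta<\alpha<1$. Then $$\operatorname{Var}^{\mathcal{B}}(N)\sim C\,N^{\alpha}\qquad (N\to\infty),$$ where $C$ is independent of $N$ and equals $$C=\frac{2^{\alpha}\pi^{\alpha-2}A}{\alpha-1}\prod_{b\in\mathcal{B}}\left(1-\frac{2}{b}+\frac{2}{b^{\alpha+1}}-\frac{1}{b^{2\alpha}}\right)\sin\left(\frac{\pi(\alpha-1)}{2}\right)\Gamma(2-\alpha)\,\zeta(2-\alpha).$$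
   Context: A positive integer is called $\mathcal{B}$-free if it is not divisible by any element of $\mathcal{B}$; $\mu^{\mathcal{B}}(n)$ equals $1$ if $n$ is $\mathcal{B}$-free and $0$ otherwise. Put $\rho^{\mathcal{B}}=\prod_{b\in\mathcal{B}}(1-1/b)$, the density of the $\mathcal{B}$-free integers. For a positive integer $N$, the variance of $\mathcal{B}$-free numbers in short intervals is $$\operatorname{Var}^{\mathcal{B}}(N)=\lim_{X\to\infty}\frac1X\sum_{1\le x\le X}\left(\sum_{x\le n<x+N}\mu^{\mathcal{B}}(n)-\rho^{\mathcal{B}}N\right)^2,$$ where $x$, $n$ run over integers (the limit exists under the stated assumptions on $\mathcal{B}$). The set $\mathcal{Z}^{\mathcal{B}}$ of $\mathcal{B}$-integers is the multiplicative semigroup generated by $\mathcal{B}$ (including $1$, the empty product). $\zeta$ is the Riemann zeta function, $\Gamma$ is the Gamma function, and $f(N)\sim g(N)$ means $f(N)/g(N)\to1$. *)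

(* Defs.v *)
From HB Require Import structures.
From mathcomp Require Import all_boot all_order all_algebra.
From mathcomp Require Import all_classical all_reals all_analysis.

Set Implicit Arguments.
Unset Strict Implicit.
Unset Printing Implicit Defensive.

Import Order.TTheory GRing.Theory Num.Theory.
Import numFieldNormedType.Exports.

Local Open Scope classical_set_scope.
Local Open Scope ring_scope.

(* The set B is given by its enumeration b : nat -> nat, so B = {b 0, b 1, ...}. *)

(* 0 is divisible by every b i, so a B-free number is automatically positive. *)
Definition B_free (b : nat -> nat) (n : nat) : Prop :=
  forall i, ~~ (b i %| n)%N.

Definition mu_B (R : realType) (b : nat -> nat) (n : nat) : R :=
  `[< B_free b n >]%:R.

Inductive B_integer (b : nat -> nat) : nat -> Prop :=
| B_integer_one : B_integer b 1
| B_integer_gen i : B_integer b (b i)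
| B_integer_mul m n :
    B_integer b m -> B_integer b n -> B_integer b (m * n)%N.

Definition B_integer_count (b : nat -> nat) (N : nat) : nat :=
  (\sum_(1 <= n < N.+1 | `[< B_integer b n >]) 1)%N.

Definition infinite_prod (R : realType) (f : nat -> R) : R :=
  lim ((\prod_(0 <= i < n) f i) @[n --> \oo]).

Definition rho_B (R : realType) (b : nat -> nat) : R :=
  infinite_prod (fun i => 1 - 1 / (b i)%:R).

Definition Var_B (R : realType) (b : nat -> nat) (N : nat) : R :=
  lim ((1 / X%:R *
        \sum_(1 <= x < X.+1)
          (\sum_(x <= n < x + N) mu_B R b n - rho_B R b * N%:R) ^+ 2)
       @[X --> \oo]).

(* Gamma s, by Euler's integral, which converges for 0 < s. *)
Definition Gamma (R : realType) (s : R) : R :=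
  \int[@lebesgue_measure R]_(t in `]0, +oo[) (t `^ (s - 1) * expR (- t)).

(* zeta s, by its Dirichlet series, which converges for 1 < s;
   riemannR s is the sequence n |-> (n.+1)^(-s). *)
Definition zeta (R : realType) (s : R) : R :=
  lim (series (riemannR s) @ \oo).

(* Main.v *)
Require Import Defs.
From HB Require Import structures.
From mathcomp Require Import all_boot all_order all_algebra.
From mathcomp Require Import all_classical all_reals all_analysis.
From mathcomp Require Import measurable_realfun.
From mathcomp Require Import ring lra.

Set Implicit Arguments.
Unset Strict Implicit.
Unset Printing Implicit Defensive.

Import Order.TTheory GRing.Theory Num.Theory.
Import numFieldNormedType.Exports.

Local Open Scope classical_set_scope.
Local Open Scope ring_scope.

(** Write versin t = 1 - cos t, and T_i f x = f (x / b_i).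

    First keep only b_0, ..., b_(m-1). The indicator of the integers free of these is
    periodic, so the variance of its sums over windows of length N is a finite mean.
    By the Chinese remainder theorem it is a sum of local correlations over the pairs
    u, v < N, and expanding the product over i < m turns it into a sum over products d of
    distinct b_i of the number of pairs with u = v modulo d. If t is the fractional part
    of N / d, this number is N^2 / d + d * t * (1 - t). The terms N^2 / d cancel against
    the squared mean, and t * (1 - t) is the sum over k >= 1 of
    versin (2 pi k t) / (pi k)^2, where t can be replaced by N / d. Hence
    ([trunc_var_fourier]) the truncated variance is
      prod_(i < m) (1 - 2 / b_i) * sum_(k >= 1) V_m (2 pi k N) / (pi k)^2,
    where V_m = prod_(i < m) (1 + b_i / (b_i - 2) * T_i) versin. As the sum of the 1 / b_i
    converges, the truncated variances converge to the variance ([Var_B_cvg]).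

    The size of V_m (x) for large x depends on the B-integers. By unique factorization,
    W (x), the sum of versin (x / n) over the B-integers n, is prod_i (1 - T_i)^-1 versin.
    So V_m is, up to an error that tends to 0 with m, the image of W under
    prod_(i < m) (1 + b_i / (b_i - 2) * T_i) (1 - T_i). Each factor multiplies x^alpha by
    1 + euler_coef i, and differs from the identity by a summable amount, because the
    b_i are themselves B-integers and so the sum of b_i^(-2 alpha) converges. This
    reduces everything to W ([euler_op_versin_asymp]).

    The counting hypothesis gives W (x) ~ A cos (pi alpha / 2) Gamma (1 - alpha) x^alpha.
    Summation by parts writes a weighted sum as the integral of the counting function
    against the derivative of the weight, which converges absolutely only for a decaying
    derivative. So versin is first replaced by the real part of
    1 - exp (- t exp (- i th)) with th < pi / 2, whose integral is a Gamma integral on a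
    rotated ray ([Rintegral_rotated_gamma]); then th tends to pi / 2, with an error that is
    a small multiple of x^alpha ([versin_sum_asymp]).

    The series over k is dominated by a multiple of N^alpha * sum_k k^(alpha - 2), which
    converges as alpha < 1. So Tannery's theorem applies twice: with m to infinity for
    fixed N, and with N to infinity after division by N^alpha. The second limit produces
    zeta (2 - alpha), and the two products over i combine to the product in C, which is
    positive. *)

(** * Improper integrals over the half-line *)

Lemma bigcup_itvcc_invS (R : realType) :
  \bigcup_n `[n.+2%:R^-1, n.+2%:R]%classic = (`]0, +oo[%classic : set R).
Proof.
apply/seteqP; split => x /=.
  by move=> [n _] /=; rewrite !in_itv/= andbT => /andP[+ _]; apply: lt_le_trans.
rewrite in_itv/= andbT => x0.
pose n := Num.truncn (Num.max x x^-1).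
have hn : Num.max x x^-1 < n.+1%:R by apply: truncnS_gt.
exists n => //=; rewrite in_itv/=.
move: hn; rewrite gt_max => /andP[h1 h2].
have n12 : n.+1%:R <= n.+2%:R :> R by rewrite ler_nat.
rewrite (ltW (lt_le_trans h1 n12)) andbT invf_ple ?posrE//.
exact: (ltW (lt_le_trans h2 n12)).
Qed.

Lemma cvg_natS2 (R : realType) : (n.+2%:R : R) @[n --> \oo] --> +oo.
Proof.
have : ((n + 2)%:R : R) @[n --> \oo] --> +oo by rewrite cvg_shiftn; exact: cvgr_idn.
by under eq_fun do rewrite addn2.
Qed.

Section improper_FTC.
Variable R : realType.
Local Notation mu := (@lebesgue_measure R).
Variables (f F : R -> R) (l0 l1 : R).
Implicit Types x : R.
Hypothesis cf : forall x : R, 0 < x -> {for x, continuous f}.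
Hypothesis dF : forall x : R, 0 < x -> is_derive x 1 F (f x).
Hypothesis F0 : F x @[x --> 0^'+] --> l0.
Hypothesis F1 : F x @[x --> +oo] --> l1.

Let cF (x : R) : 0 < x -> {for x, continuous F}.
Proof. by move=> x0; apply/differentiable_continuous/derivable1_diffP; case: (dF x0). Qed.

Lemma measurable_continuous_itv0y : measurable_fun (`]0, +oo[%classic : set R) f.
Proof.
apply: open_continuous_measurable_fun => //.
by move=> x; rewrite inE/= in_itv/= andbT; exact: cf.
Qed.

Let FTC_segment (a b : R) : 0 < a -> a < b ->
  (\int[mu]_(x in `[a, b]) (f x)%:E = (F b - F a)%:E)%E.
Proof.
move=> a0 ab; rewrite (@continuous_FTC2 _ f F) ?EFinB//.
- apply: continuous_in_subspaceT => x; rewrite inE/= in_itv/= => /andP[ax _].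
  by apply: cf; apply: lt_le_trans ax.
- split.
  + move=> x; rewrite in_itv/= => /andP[ax _].
    by have [] := dF (lt_trans a0 ax).
  + by apply: cvg_at_right_filter; exact: cF.
  + by apply: cvg_at_left_filter; apply: cF; exact: lt_trans ab.
- move=> x; rewrite in_itv/= => /andP[ax _].
  by rewrite derive1E; have [_ ->] := dF (lt_trans a0 ax).
Qed.

Let cvg_F : F n.+2%:R - F n.+2%:R^-1 @[n --> \oo] --> l1 - l0.
Proof.
apply: cvgB.
  by apply: (cvg_comp (fun n => n.+2%:R : R) F _ F1); exact: cvg_natS2.
move/cvg_at_rightP : F0; apply; split.
  by move=> n; rewrite invr_gt0.
by apply/gtr0_cvgV0; [near=> n; rewrite ltr0n|exact: cvg_natS2].
Unshelve. all: end_near. Qed.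

Let seg_sub n : `[n.+2%:R^-1, n.+2%:R] `<=` (`]0, +oo[ : set R).
Proof. by rewrite -bigcup_itvcc_invS; exact: (bigcup_sup (F := fun n => `[n.+2%:R^-1, n.+2%:R]%classic)). Qed.

Let invS_lt n : (n.+2%:R^-1 : R) < n.+2%:R.
Proof. by rewrite (lt_trans (_ : _ < 1))// ?invf_lt1// ?ltr1n// ltr0n. Qed.

(** For nonnegative integrands, monotone convergence gives the value without integrability,
    which can then be deduced from it. *)
Lemma ge0_improper_FTC : (forall x : R, 0 < x -> 0 <= f x) ->
  (\int[mu]_(x in `]0%R, +oo[) (f x)%:E = (l1 - l0)%:E)%E.
Proof.
move=> f0.
have h : (\int[mu]_(x in `[n.+2%:R^-1%R, n.+2%:R%R]) (f x)%:E)%E @[n --> \oo]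
  --> (\int[mu]_(x in `]0%R, +oo[) (f x)%:E)%E.
  rewrite -bigcup_itvcc_invS.
  apply: (@ge0_nondecreasing_set_cvg_integral _ (measurableTypeR R) R
    (fun n => `[n.+2%:R^-1, n.+2%:R]%classic) (EFin \o f) mu).
  - apply/nondecreasing_seqP => n; rewrite subsetEset.
    by apply: subset_itv; rewrite bnd_simp ?ler_nat// lef_pV2 ?posrE ?ltr0n ?ler_nat.
  - by [].
  - move=> n; apply/measurable_EFinP; apply: measurable_funS (seg_sub (n := n)) _ => //.
    exact: measurable_continuous_itv0y.
  - move=> n x /seg_sub /=; rewrite in_itv/= andbT lee_fin; exact: f0.
move: h.
under eq_fun do rewrite FTC_segment ?invr_gt0 ?ltr0n//.
move=> /cvg_lim <-//.
apply/cvg_lim => //.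
by apply: cvg_EFin; [exact: nearW|exact: cvg_F].
Qed.

Lemma improper_FTC : mu.-integrable `]0, +oo[ (EFin \o f) ->
  \int[mu]_(x in `]0, +oo[) f x = l1 - l0.
Proof.
move=> intf.
pose f_ n := (EFin \o f) \_ `[n.+2%:R^-1, n.+2%:R].
have [] := @dominated_convergence _ _ _ mu `]0, +oo[ _ f_ (EFin \o f) (abse \o (EFin \o f)).
- by [].
- move=> n; apply: (measurable_funS measurableT) => //.
  apply: (measurable_restrictT (EFin \o f) _).1 => //.
  apply: measurable_funS (seg_sub (n := n)) _ => //.
  by apply/measurable_EFinP; exact: measurable_continuous_itv0y.
- by apply/measurable_EFinP; exact: measurable_continuous_itv0y.
- apply: aeW => x; rewrite -bigcup_itvcc_invS => -[m _ xm].
  apply: cvg_near_cst; near=> n.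
  rewrite /f_ /patch mem_set//.
  have : (m <= n)%N by near: n; exact: nbhs_infty_ge.
  move=> mn; move: xm => /=; apply: subset_itv; rewrite bnd_simp ?ler_nat ?ltnS//.
  by rewrite lef_pV2 ?posrE ?ltr0n ?ler_nat ?ltnS.
- exact: integrable_abse.
- apply: aeW => x n _; rewrite /f_ /patch; case: ifP => // _.
  by rewrite abse0 abse_ge0.
move=> _ _.
rewrite /Rintegral => /=.
have E n : (\int[mu]_(x in `]0%R, +oo[) f_ n x = (F n.+2%:R - F n.+2%:R^-1)%:E)%E.
  rewrite /f_ -integral_mkcondr setIidr; last exact: seg_sub.
  by rewrite FTC_segment ?invr_gt0 ?ltr0n.
under eq_fun do rewrite E.
move=> /cvg_lim <-//.
rewrite (_ : lim _ = (l1 - l0)%:E)//.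
apply/cvg_lim => //.
by apply: cvg_EFin; [exact: nearW|exact: cvg_F].
Unshelve. all: end_near. Qed.

End improper_FTC.

(** * The Gamma integral on rotated rays *)

Section gamma_integrand.
Variable R : realType.
Local Notation mu := (@lebesgue_measure R).
Implicit Types s c t : R.

Lemma continuous_powR s t : 0 < t -> {for t, continuous (@powR R ^~ s)}.
Proof.
move=> t0; apply/differentiable_continuous/derivable1_diffP.
by have [] := is_derive1_powR s t0.
Qed.

Lemma powRS s t : 0 < t -> t `^ (s + 1) = t * t `^ s.
Proof.
move=> t0; rewrite powRD; last by rewrite (gt_eqF t0) implybT.
by rewrite powRr1 ?ltW// mulrC.
Qed.

(** This kernel is s^-1 times the derivative of the bounded function
    (t / (1 + t)) `^ s. *)
Lemma integrable_beta_kernel s : 0 < s ->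
  mu.-integrable `]0, +oo[
    (EFin \o (fun t => t `^ (s - 1) * (1 + t) `^ (- (s + 1)))).
Proof.
move=> s0.
pose f t := s * (t `^ (s - 1) * (1 + t) `^ (- (s + 1))).
pose F t := t `^ s * (1 + t) `^ (- s).
have t1 t : 0 < t -> 0 < 1 + t by move=> t0; rewrite addr_gt0.
have dp (a t : R) : 0 < t -> is_derive t 1 (fun t => (1 + t) `^ a) (a * (1 + t) `^ (a - 1)).
  move=> t0; have := @is_derive1_comp R (@powR R ^~ a) (fun t : R => 1 + t) t
    (a * (1 + t) `^ (a - 1)) 1 (is_derive1_powR a (t1 _ t0)).
  rewrite mulr1; apply.
  exact: (is_derive_eq (is_deriveD (is_derive_cst (1 : R) t 1) (is_derive_id t 1)) (add0r 1)).
have dF t : 0 < t -> is_derive t 1 F (f t).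
  move=> t0; have t1t := t1 _ t0.
  have := is_deriveM (is_derive1_powR s t0) (dp (- s) t t0).
  move=> h; apply: (is_derive_eq h).
  rewrite /f /GRing.scale /=.
  have E1 : t `^ s = t * t `^ (s - 1) by rewrite -powRS// subrK.
  have E2 : (1 + t) `^ (- s) = (1 + t) * (1 + t) `^ (- (s + 1)).
    by rewrite -powRS//; congr (_ `^ _); ring.
  rewrite E2 E1 (_ : - s - 1 = - (s + 1)); last by ring.
  ring.
have cf t : 0 < t -> {for t, continuous f}.
  move=> t0; apply: cvgM; first exact: cvg_cst.
  apply: cvgM; first exact: continuous_powR.
  have h : {for t, continuous (fun t => (1 + t) `^ (- (s + 1)))}.
    apply/differentiable_continuous/derivable1_diffP.
    by have [] := dp (- (s + 1)) t t0.
  exact: h.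
have f0 t : 0 < t -> 0 <= f t.
  by move=> t0; rewrite mulr_ge0 ?(ltW s0)// mulr_ge0// powR_ge0.
have F0 : F t @[t --> 0^'+] --> 0.
  apply: (@squeeze_cvgr _ _ _ _ (cst 0) (@powR R ^~ s)); last 2 first.
  - exact: cvg_cst.
  - exact: powR_cvg0.
  near=> t; have t0 : 0 < t by near: t; exact: nbhs_right_gt.
  rewrite /= mulr_ge0 ?powR_ge0//= -[leRHS]mulr1 ler_wpM2l ?powR_ge0//.
  by rewrite powRN invf_le1 ?powR_gt0 ?t1// -[leLHS](powRr0 (1 + t)) ler_powR ?lerDl ?ltW.
have F1 : F t @[t --> +oo] --> (1 : R).
  have h : (1 - (1 + t)^-1) `^ s @[t --> +oo] --> (1 : R) `^ s.
    apply: (cvg_comp (fun t => 1 - (1 + t)^-1) (@powR R ^~ s)); last first.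
      exact: (continuous_powR ltr01).
    have h2 : 1 - (1 + t)^-1 @[t --> +oo] --> (1 - 0 : R).
      apply: cvgB; first exact: cvg_cst.
      apply/gtr0_cvgV0; first by near=> t; apply: t1; near: t; exact: nbhs_pinfty_gt.
      by apply: cvg_addrl.
    by rewrite subr0 in h2.
  rewrite powR1 in h; move: h; apply: cvg_trans; apply: near_eq_cvg.
  near=> t; have t0 : 0 < t by near: t; exact: nbhs_pinfty_gt.
  have t1t := t1 _ t0.
  rewrite (_ : 1 - (1 + t)^-1 = t / (1 + t)); last by field; rewrite gt_eqF.
  by rewrite powRM ?invr_ge0 ?ltW// /F -powR_inv1 ?(ltW t1t)// -powRrM mulN1r.
have intf : mu.-integrable `]0, +oo[ (EFin \o f).
  apply/integrableP; split.
    by apply/measurable_EFinP; exact: measurable_continuous_itv0y cf.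
  under eq_integral.
    move=> x; rewrite inE/= in_itv/= andbT => x0.
    rewrite ger0_norm ?f0//; over.
  by rewrite (ge0_improper_FTC cf dF F0 F1 f0) ltry.
have -> : (EFin \o (fun t => t `^ (s - 1) * (1 + t) `^ (- (s + 1)))) =
    (fun t => s^-1%:E * (EFin \o f) t)%E.
  by apply/funext => t /=; rewrite -EFinM /f mulKf// gt_eqF.
exact: integrableZl.
Unshelve. all: end_near. Qed.

(** Exponential decay beats any power, so the kernel above dominates
    the integrand of Gamma. *)
Lemma powR_expR_le s c : 0 < s -> 0 < c -> exists2 M, 0 <= M &
  forall t, 0 < t -> t `^ (s - 1) * expR (- (t * c)) <=
    M * (t `^ (s - 1) * (1 + t) `^ (- (s + 1))).
Proof.
move=> s0 c0; pose k := s + 1; have k0 : 0 < k by rewrite addr_gt0.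
pose m := Num.min 1 (c / k); have m0 : 0 < m by rewrite lt_min ltr01 divr_gt0.
(* (1 + t) * m <= 1 + t * c / k <= exp (t * c / k), raised to the power k *)
exists (m `^ (- k)); first exact: powR_ge0.
move=> t t0; rewrite mulrCA ler_wpM2l ?powR_ge0//.
have t1 : 0 < 1 + t by rewrite addr_gt0.
rewrite -/k -powRM; [|exact: ltW|exact: ltW].
rewrite expRN powRN lef_pV2 ?posrE ?expR_gt0 ?powR_gt0 ?mulr_gt0//.
have -> : t * c = (c / k * t) * k by field; rewrite gt_eqF.
rewrite expRM; apply: ge0_ler_powR.
- exact: ltW.
- by rewrite nnegrE ltW// mulr_gt0.
- by rewrite nnegrE expR_ge0.
apply: (le_trans _ (expR_ge1Dx _)); rewrite mulrDr mulr1 lerD//.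
  by rewrite ge_min lexx.
by rewrite ler_wpM2r ?(ltW t0)// ge_min lexx orbT.
Qed.

Lemma integrable_powR_expR s c : 0 < s -> 0 < c ->
  mu.-integrable `]0, +oo[ (EFin \o (fun t => t `^ (s - 1) * expR (- (t * c)))).
Proof.
move=> s0 c0; have [M M0 le_M] := powR_expR_le s0 c0.
have : mu.-integrable `]0, +oo[ (fun t => M%:E *
    (EFin \o (fun t => t `^ (s - 1) * (1 + t) `^ (- (s + 1)))%R) t)%E.
  by apply: integrableZl => //; exact: integrable_beta_kernel.
apply: le_integrable => //.
  apply/measurable_EFinP; apply: measurable_funM.
    by apply: measurable_funS (measurable_powR _) => //.
  by apply: measurableT_comp => //; apply: measurableT_comp => //; exact: measurable_funM.
move=> t /=; rewrite in_itv/= andbT => t0.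
by rewrite lee_fin !ger0_norm ?le_M ?mulr_ge0 ?powR_ge0 ?expR_ge0.
Qed.

End gamma_integrand.

Section gamma_rotation.
Variable R : realType.
Local Notation mu := (@lebesgue_measure R).
Implicit Types s c t th : R.

(** Real part of exp (i c) * z^(s - 1) * exp (- z) * dz/dt on the ray z = t * exp (- i th). *)
Definition rotated_gamma s c th t : R :=
  t `^ (s - 1) * expR (- (t * cos th)) * cos (t * sin th - s * th + c).

Let cos_ge (v th : R) : `|th| <= v -> v < pi / 2 -> cos v <= cos th.
Proof.
move=> thv v2; rewrite -(cos_norm th).
have vpi : v <= pi by rewrite ltW// (lt_le_trans v2)// ler_pdivrMr// ler_peMr ?pi_ge0// ler1n.
by rewrite leNgt ltr_cos ?in_itv/= ?normr_ge0 ?vpi ?(le_trans _ thv)// ?(le_trans thv)// -leNgt.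
Qed.

Let cos_pos th : `|th| < pi / 2 -> 0 < cos th.
Proof. by rewrite ltr_norml => h; exact: cos_gt0_pihalf. Qed.

Lemma continuous_rotated_gamma s c th t : 0 < t ->
  {for t, continuous (rotated_gamma s c th)}.
Proof.
move=> t0; apply: cvgM; first apply: cvgM; first exact: continuous_powR.
- apply: continuous_comp; last exact: continuous_expR.
  by apply: cvgN; apply: cvgM; [exact: cvg_id|exact: cvg_cst].
- apply: continuous_comp; last exact: continuous_cos.
  apply: cvgD; last exact: cvg_cst.
  by apply: cvgB; [apply: cvgM; [exact: cvg_id|exact: cvg_cst]|exact: cvg_cst].
Qed.

Lemma integrable_rotated_gamma s c th : 0 < s -> `|th| < pi / 2 ->
  mu.-integrable `]0, +oo[ (EFin \o rotated_gamma s c th).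
Proof.
move=> s0 th2; have := integrable_powR_expR s0 (cos_pos th2).
apply: le_integrable => //.
  apply/measurable_EFinP; apply: measurable_continuous_itv0y.
  by move=> t; exact: continuous_rotated_gamma.
move=> t /=; rewrite in_itv/= andbT => t0.
rewrite lee_fin /rotated_gamma normrM ger0_norm ?mulr_ge0 ?powR_ge0 ?expR_ge0//.
by rewrite -[leRHS]mulr1 ler_wpM2l ?cos_max ?mulr_ge0 ?powR_ge0 ?expR_ge0.
Qed.

Lemma integrable_Gamma s : 0 < s ->
  mu.-integrable `]0, +oo[ (EFin \o (fun t => t `^ (s - 1) * expR (- t))).
Proof.
move=> s0; have := integrable_powR_expR s0 ltr01.
by under [X in EFin \o X]eq_fun do rewrite mulr1.
Qed.

(** As the complex form is closed, this is at once the derivative in th of [rotated_gamma]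
    and the derivative in t of [rotated_primitive]. *)
Definition rotated_gamma_flux s c th t : R :=
  t `^ (s - 1) * expR (- (t * cos th)) *
  (t * sin th * cos (t * sin th - s * th + c)
   - (t * cos th - s) * sin (t * sin th - s * th + c)).

Lemma is_derive_rotated_gamma s c th t :
  is_derive th 1 (rotated_gamma s c ^~ t) (rotated_gamma_flux s c th t).
Proof.
have h1 : is_derive th 1 (fun th => - (t * cos th)) (t * sin th).
  by apply: is_derive_eq; rewrite /GRing.scale /=; ring.
have h2 : is_derive th 1 (fun th => t * sin th - s * th + c) (t * cos th - s).
  by apply: is_derive_eq; rewrite /GRing.scale /=; ring.
have h3 := @is_derive1_comp R expR _ _ _ _ (is_derive_expR _) h1.
have h4 := @is_derive1_comp R cos _ _ _ _ (is_derive_cos _) h2.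
have := is_deriveZ (t `^ (s - 1)) (is_deriveM h3 h4).
have -> : t `^ (s - 1) \*: ((expR \o (fun th0 => - (t * cos th0))) *
   (cos \o (fun th0 => t * sin th0 - s * th0 + c))) = rotated_gamma s c ^~ t.
  by apply/funext => x; rewrite /rotated_gamma /= /GRing.scale /= -mulrA.
move=> h; apply: (is_derive_eq h).
by rewrite /rotated_gamma_flux /GRing.scale /=; ring.
Qed.

Definition rotated_primitive s c th t : R :=
  t `^ s * (expR (- (t * cos th)) * sin (t * sin th - s * th + c)).

Lemma is_derive_rotated_primitive s c th t : 0 < t ->
  is_derive t 1 (rotated_primitive s c th) (rotated_gamma_flux s c th t).
Proof.
move=> t0.
have h1 : is_derive t 1 (fun t => - (t * cos th)) (- cos th).
  by apply: is_derive_eq; rewrite /GRing.scale /=; ring.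
have h2 : is_derive t 1 (fun t => t * sin th - s * th + c) (sin th).
  by apply: is_derive_eq; rewrite /GRing.scale /=; ring.
have h3 := @is_derive1_comp R expR _ _ _ _ (is_derive_expR _) h1.
have h4 := @is_derive1_comp R sin _ _ _ _ (is_derive_sin _) h2.
have h5 : is_derive t 1
    (fun t => expR (- (t * cos th)) * sin (t * sin th - s * th + c)) _ := is_deriveM h3 h4.
apply: (is_derive_eq (is_deriveM (is_derive1_powR s t0) h5)).
have E1 : t `^ s = t * t `^ (s - 1).
  by rewrite -powRS// subrK.
by rewrite /rotated_gamma_flux /GRing.scale /= E1; ring.
Qed.

Lemma rotated_primitive_cvg0 s c th : 0 < s -> `|th| < pi / 2 ->
  rotated_primitive s c th t @[t --> 0^'+] --> 0.
Proof.
move=> s0 th2; apply: norm_cvg0.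
apply: (@squeeze_cvgr _ _ _ _ (cst 0) (@powR R ^~ s)); last 2 first.
- exact: cvg_cst.
- exact: powR_cvg0.
near=> t; have t0 : 0 < t by near: t; exact: nbhs_right_gt.
rewrite normr_ge0/= normrM ger0_norm ?powR_ge0// -[leRHS]mulr1 ler_wpM2l ?powR_ge0//.
rewrite normrM ger0_norm ?expR_ge0// mulr_ile1 ?expR_ge0 ?sin_max//.
by rewrite expR_le1 oppr_le0 mulr_ge0// ltW// cos_pos.
Unshelve. all: end_near. Qed.

Lemma rotated_primitive_cvgy s c th : 0 < s -> `|th| < pi / 2 ->
  rotated_primitive s c th t @[t --> +oo] --> 0.
Proof.
move=> s0 th2; apply: norm_cvg0.
have s1 : 0 < s + 1 by rewrite addr_gt0.
have [M M0 le_M] := powR_expR_le s1 (cos_pos th2).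
apply: (@squeeze_cvgr _ _ _ _ (cst 0) (fun t => M * (1 + t)^-1)); last 2 first.
- exact: cvg_cst.
- rewrite -[X in _ --> X](mulr0 M); apply: cvgM; first exact: cvg_cst.
  apply/gtr0_cvgV0; first by near=> t; rewrite addr_gt0//; near: t; exact: nbhs_pinfty_gt.
  by apply: cvg_addrl.
near=> t; have t0 : 0 < t by near: t; exact: nbhs_pinfty_gt.
have t1 : 0 < 1 + t by rewrite addr_gt0.
rewrite normr_ge0/= normrM ger0_norm ?powR_ge0// normrM ger0_norm ?expR_ge0// mulrA.
apply: (@le_trans _ _ (t `^ s * expR (- (t * cos th)))).
  by rewrite -[leRHS]mulr1 ler_wpM2l ?sin_max// mulr_ge0 ?powR_ge0 ?expR_ge0.
have := le_M _ t0; rewrite addrK => /le_trans; apply.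
rewrite ler_wpM2l// -(powR_inv1 (ltW t1)).
have -> : -1 = s + (- (s + 1)) by ring.
rewrite powRD; last by rewrite (gt_eqF t1) implybT.
apply: ler_pM; rewrite ?powR_ge0//.
  by apply: ge0_ler_powR; rewrite ?nnegrE ?(ltW s0) ?(ltW t0) ?(ltW t1)// lerDr.
by rewrite ler_powR ?lerDl ?(ltW t0)// lerN2 lerDl.
Unshelve. all: end_near. Qed.

(** With k = cos v, an integrable majorant of the flux for all |th| <= v: it justifies
    the derivation under the integral sign. *)
Definition rotated_gamma_bound s k t : R :=
  2 * (t `^ s * expR (- (t * k))) + s * (t `^ (s - 1) * expR (- (t * k))).

Lemma integrable_rotated_gamma_bound s k : 0 < s -> 0 < k ->
  mu.-integrable `]0, +oo[ (EFin \o rotated_gamma_bound s k).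
Proof.
move=> s0 k0; rewrite /rotated_gamma_bound.
have s1 : 0 < s + 1 by rewrite addr_gt0.
have := integrable_powR_expR s1 k0; rewrite addrK => h1.
have h2 := integrable_powR_expR s0 k0.
have -> : (EFin \o (fun t => 2 * (t `^ s * expR (- (t * k))) + s * (t `^ (s - 1) * expR (- (t * k))))) =
  (fun t => (2%:E * (EFin \o (fun t => t `^ s * expR (- (t * k)))%R) t) +
    (s%:E * (EFin \o (fun t => t `^ (s - 1) * expR (- (t * k)))%R) t))%E by [].
by apply: integrableD => //; apply: integrableZl.
Qed.

Lemma rotated_gamma_flux_le s c v th t : 0 < s -> `|th| <= v -> v < pi / 2 -> 0 < t ->
  `|rotated_gamma_flux s c th t| <= rotated_gamma_bound s (cos v) t.
Proof.
move=> s0 thv v2 t0; rewrite /rotated_gamma_flux /rotated_gamma_bound.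
have E1 : t `^ s = t * t `^ (s - 1) by rewrite -powRS// subrK.
rewrite E1; set p := t `^ (s - 1); have p0 : 0 <= p by exact: powR_ge0.
rewrite normrM ger0_norm ?mulr_ge0 ?expR_ge0//.
have -> : 2 * (t * p * expR (- (t * cos v))) + s * (p * expR (- (t * cos v))) =
  (p * expR (- (t * cos v))) * (2 * t + s) by ring.
apply: ler_pM; rewrite ?normr_ge0 ?mulr_ge0 ?expR_ge0//.
  by rewrite ler_wpM2l// ler_expR lerN2 ler_wpM2l ?(ltW t0)// cos_ge.
apply: (le_trans (ler_normB _ _)); rewrite !normrM (gtr0_norm t0).
have -> : 2 * t + s = t * 1 * 1 + (t * 1 + s) * 1 by ring.
apply: lerD; apply: ler_pM; rewrite ?mulr_ge0 ?normr_ge0 ?(ltW t0) ?cos_max ?sin_max//.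
  by rewrite ler_pM2l// sin_max.
apply: (le_trans (ler_normB _ _)); rewrite normrM (gtr0_norm t0) (gtr0_norm s0).
by rewrite lerD2r ler_pM2l// cos_max.
Qed.

Lemma continuous_rotated_gamma_flux s c th t : 0 < t ->
  {for t, continuous (rotated_gamma_flux s c th)}.
Proof.
move=> t0.
have cphase : x * sin th - s * th + c @[x --> t] --> t * sin th - s * th + c.
  apply: cvgD; last exact: cvg_cst.
  by apply: cvgB; [apply: cvgM; [exact: cvg_id|exact: cvg_cst]|exact: cvg_cst].
apply: cvgM; first apply: cvgM; first exact: continuous_powR.
  apply: continuous_comp; last exact: continuous_expR.
  by apply: cvgN; apply: cvgM; [exact: cvg_id|exact: cvg_cst].
apply: cvgB; apply: cvgM.
- by apply: cvgM; [exact: cvg_id|exact: cvg_cst].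
- by apply: continuous_comp; [exact: cphase|exact: continuous_cos].
- by apply: cvgB; [apply: cvgM; [exact: cvg_id|exact: cvg_cst]|exact: cvg_cst].
- by apply: continuous_comp; [exact: cphase|exact: continuous_sin].
Qed.

Lemma Rintegral_rotated_gamma_flux s c th : 0 < s -> `|th| < pi / 2 ->
  \int[mu]_(t in `]0, +oo[) rotated_gamma_flux s c th t = 0.
Proof.
move=> s0 th2.
have cf t : 0 < t -> {for t, continuous (rotated_gamma_flux s c th)}.
  exact: continuous_rotated_gamma_flux.
rewrite (improper_FTC cf (@is_derive_rotated_primitive s c th)
  (rotated_primitive_cvg0 c s0 th2) (rotated_primitive_cvgy c s0 th2)) ?subrr//.
have := integrable_rotated_gamma_bound s0 (cos_pos th2); rewrite -cos_norm.
apply: le_integrable => //.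
  by apply/measurable_EFinP; apply: measurable_continuous_itv0y.
move=> t /=; rewrite in_itv/= andbT => t0.
have := rotated_gamma_flux_le c s0 (lexx `|th|) th2 t0.
rewrite lee_fin => /le_trans; apply; exact: ler_norm.
Qed.

(** Cauchy's theorem for z^(s - 1) * exp (- z) on a sector, in polar coordinates: the
    derivative in th of the integrand is an exact derivative in t, so the integral is
    constant in th, and at th = 0 it is cos c times the Gamma integral. *)
Lemma Rintegral_rotated_gamma s c th : 0 < s -> 0 <= th < pi / 2 ->
  \int[mu]_(t in `]0, +oo[) rotated_gamma s c th t = cos c * Gamma s.
Proof.
move=> s0 /andP[th0 th2].
pose F th : R := \int[mu]_(t in `]0, +oo[) rotated_gamma s c th t.
have dF (x : R) : `|x| < pi / 2 -> is_derive x 1 F 0.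
  move=> x2; pose v := (`|x| + pi / 2) / 2.
  have xv : `|x| < v by rewrite /v; move: x2; lra.
  have v2 : v < pi / 2 by rewrite /v; move: x2; lra.
  have v0 : 0 <= v by rewrite (le_trans _ (ltW xv)).
  have vI y : `]- v, v[%classic y -> `|y| <= v.
    by rewrite /= in_itv/= => /andP[h1 h2]; rewrite ler_norml !ltW.
  have Ix : `]- v, v[%classic x by rewrite /= in_itv/= -ltr_norml.
  have d1 y t : partial1of2 (rotated_gamma s c) y t = rotated_gamma_flux s c y t.
    rewrite partial1of2E; have [_ ->//] := is_derive_rotated_gamma s c y t.
  have intf y : `]- v, v[%classic y -> mu.-integrable `]0, +oo[ (EFin \o rotated_gamma s c y).
    by move=> /vI yv; apply: integrable_rotated_gamma => //; exact: le_lt_trans v2.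
  have der y t : `]- v, v[%classic y -> `]0, +oo[%classic t ->
      derivable (rotated_gamma s c ^~ t) y 1.
    by move=> _ _; have [] := is_derive_rotated_gamma s c y t.
  have cv : 0 < cos v by apply: cos_pos; rewrite ger0_norm.
  have G0 t : 0 <= rotated_gamma_bound s (cos v) t.
    by rewrite addr_ge0// mulr_ge0 ?(ltW s0)// mulr_ge0 ?powR_ge0 ?expR_ge0.
  have Gub y t : `]- v, v[%classic y -> `]0, +oo[%classic t ->
      `|partial1of2 (rotated_gamma s c) y t| <= rotated_gamma_bound s (cos v) t.
    move=> /vI yv; rewrite /= in_itv/= andbT => t0; rewrite d1.
    exact: rotated_gamma_flux_le.
  have intG := integrable_rotated_gamma_bound s0 cv.
  split.
    exact: (derivable_under_integral _ Ix intf der G0 intG Gub).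
  rewrite -derive1E (differentiation_under_integral _ Ix intf der G0 intG Gub)//.
  under eq_Rintegral do rewrite d1.
  exact: Rintegral_rotated_gamma_flux.
have dF' (x : R) : x \in `]0, th[ -> is_derive x 1 F 0.
  rewrite in_itv/= => /andP[x0 xth]; apply: dF.
  by rewrite gtr0_norm// (lt_trans xth).
have cF : {within `[0, th], continuous F}.
  apply: derivable_within_continuous => x; rewrite in_itv/= => /andP[x0 xth].
  have /dF[] // : `|x| < pi / 2 by rewrite ger0_norm// (le_lt_trans xth).
have [x _] := MVT_segment th0 dF' cF; rewrite mul0r => /eqP; rewrite subr_eq0 => /eqP.
rewrite -/(F th) => ->.
rewrite /F /Gamma -RintegralZl//; last exact: integrable_Gamma.
apply: eq_Rintegral => t _.
by rewrite /rotated_gamma cos0 sin0 !mulr1 !mulr0 subr0 add0r mulrC.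
Qed.

(** At th = 0 and phase c = pi / 2 the flux is s t^(s - 1) exp (- t) - t^s exp (- t):
    the vanishing of its integral is the integration by parts. *)
Lemma GammaS s : 0 < s -> Gamma (s + 1) = s * Gamma s.
Proof.
move=> s0; have p2 : `|0 : R| < pi / 2 by rewrite normr0 divr_gt0 ?pi_gt0.
have := Rintegral_rotated_gamma_flux (pi / 2) s0 p2.
have s1 : 0 < s + 1 by rewrite addr_gt0.
have i1 := integrable_Gamma s0; have i2 := integrable_Gamma s1.
rewrite (@eq_Rintegral _ _ _ mu _ (fun t => s * (t `^ (s - 1) * expR (- t)) -
  t `^ (s + 1 - 1) * expR (- t))); last first.
  move=> t; rewrite inE/= in_itv/= andbT => t0.
  rewrite /rotated_gamma_flux sin0 cos0 !mulr0 mulr1 mul0r subr0 !add0r sin_pihalf addrK.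
  have -> : t `^ s = t * t `^ (s - 1) by rewrite -powRS// subrK.
  ring.
rewrite RintegralB//; last first.
  rewrite (_ : _ \o _ = fun t => s%:E * (EFin \o (fun t => t `^ (s - 1) * expR (- t))%R) t)%E//.
  by apply: integrableZl.
by rewrite RintegralZl// -/(Gamma s) -/(Gamma (s + 1)) => /eqP; rewrite subr_eq0 => /eqP.
Qed.

(** For s <= 1 the integrand is at least exp (- 2 t), as t^(1 - s) <= 1 + t <= exp t. *)
Lemma Gamma_gt0 s : 0 < s <= 1 -> 0 < Gamma s.
Proof.
move=> /andP[s0 s1]; apply: (@lt_le_trans _ _ (0 - (- 2^-1))).
  by rewrite sub0r opprK invr_gt0.
have df t : is_derive t 1 (fun t => - (2^-1 * expR (- (t * 2)))) (expR (- (t * 2))).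
  have h1 : is_derive t 1 (fun t : R => - (t * 2)) (- 2).
    by apply: is_derive_eq; rewrite /GRing.scale /=; ring.
  have h2 := @is_derive1_comp R expR _ _ _ _ (is_derive_expR _) h1.
  have := is_deriveN (is_deriveZ 2^-1 h2) => h3.
  by apply: (is_derive_eq h3); rewrite /GRing.scale /=; field.
have cE t : {for t, continuous (fun t : R => expR (- (t * 2)))}.
  apply: continuous_comp; last exact: continuous_expR.
  by apply: cvgN; apply: cvgM; [exact: cvg_id|exact: cvg_cst].
have intE : mu.-integrable `]0, +oo[ (EFin \o (fun t : R => expR (- (t * 2)))).
  have := integrable_powR_expR ltr01 (ltr0Sn R 1).
  by under [X in EFin \o X]eq_fun do rewrite subrr powRr0 mul1r.
rewrite -(@improper_FTC R _ _ _ _ (fun t _ => cE t) (fun t _ => df t) _ _ intE).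
- rewrite /Gamma; apply: le_Rintegral => //; first exact: integrable_Gamma.
  move=> t /=; rewrite in_itv/= andbT => t0.
  have -> : - (t * 2) = - t + - t by ring.
  rewrite expRD ler_wpM2r ?expR_ge0// expRN.
  have t1 : 0 < 1 + t by rewrite addr_gt0.
  apply: (@le_trans _ _ (1 + t)^-1).
    by rewrite lef_pV2 ?posrE ?expR_gt0// expR_ge1Dx.
  have [t1'|t1'] := leP t 1.
    apply: (@le_trans _ _ 1); first by rewrite invf_le1// lerDl ltW.
    by rewrite -[leLHS](powRr0 t) ger_powR ?t0 ?t1' ?subr_le0.
  apply: (@le_trans _ _ t^-1); first by rewrite lef_pV2 ?posrE// lerDr.
  by rewrite -(powR_inv1 (ltW t0)); apply: ler_powR; rewrite ?(ltW t1')// lerBrDr addNr ltW.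
- apply: cvg_at_right_filter; apply: cvgN.
  rewrite -[X in _ --> X](mulr1 2^-1); apply: cvgM; first exact: cvg_cst.
  by have : expR (- (t * 2)) @[t --> (0 : R)] --> expR (- (0 * 2)) := cE 0; rewrite mul0r oppr0 expR0.
- rewrite -oppr0; apply: cvgN; rewrite -(mulr0 2^-1); apply: cvgM; first exact: cvg_cst.
  apply: (cvg_comp (fun t => t * 2) (fun t => expR (- t))); last exact: cvgr_expR.
  by apply: gt0_cvgMly.
Qed.

End gamma_rotation.

(** * An Abelian theorem for weighted sums *)

Lemma dominated_convergence_itv0y (R : realType) (f : nat -> R -> R) (F D : R -> R) :
  (@lebesgue_measure R).-integrable `]0, +oo[ (EFin \o D) ->
  (forall n, measurable_fun (`]0, +oo[%classic : set R) (f n)) ->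
  (forall s : R, 0 < s -> f n s @[n --> \oo] --> F s) ->
  (forall n (s : R), 0 < s -> `|f n s| <= D s) ->
  (@lebesgue_measure R).-integrable `]0, +oo[ (EFin \o F) /\
  \int[@lebesgue_measure R]_(s in `]0, +oo[) f n s @[n --> \oo] -->
    \int[@lebesgue_measure R]_(s in `]0, +oo[) F s.
Proof.
move=> intD mf fF fD.
have mEf n : measurable_fun (`]0, +oo[%classic : set R) (EFin \o f n).
  exact/measurable_EFinP.
have EfF s : `]0, +oo[%classic s -> (EFin \o f n) s @[n --> \oo] --> (F s)%:E.
  rewrite /= in_itv/= andbT => s0; apply: cvg_EFin; first exact: nearW.
  exact: fF.
have [] := @dominated_convergence _ _ _ (@lebesgue_measure R) `]0, +oo[ _
  (fun n => EFin \o f n) (EFin \o F) (EFin \o D).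
- by [].
- exact: mEf.
- exact: emeasurable_fun_cvg mEf EfF.
- exact: aeW.
- exact: intD.
- by apply: aeW => s n /=; rewrite in_itv/= andbT lee_fin; exact: fD.
move=> intF _ cvg_f; split => //.
by apply: fine_cvg; rewrite fineK; [exact: cvg_f|exact: integrable_fin_num].
Qed.

Section abelian_theorem.
Variable R : realType.
Local Notation mu := (@lebesgue_measure R).
Variables (a : nat -> R) (alpha A C : R).
Hypothesis a_ge0 : forall n, 0 <= a n.
Hypothesis alpha_lt1 : alpha < 1.

Definition partial_sum (a : nat -> R) (y : R) : R :=
  \sum_(1 <= n < (Num.truncn y).+1) a n.

Local Notation S := (partial_sum a).

Hypothesis S_le : forall y : R, 0 < y -> S y <= C * y `^ alpha.
Hypothesis S_cvg : S y / y `^ alpha @[y --> +oo] --> A.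

Lemma partial_sum_ge0 y : 0 <= S y.
Proof. by apply: sumr_ge0. Qed.

Lemma partial_sum_div_le (x s : R) : 0 < x -> 0 < s ->
  S (x / s) <= C * x `^ alpha * s `^ (- alpha).
Proof.
move=> x0 s0; apply: (le_trans (S_le _)); first exact: divr_gt0.
by rewrite powRM ?invr_ge0 ?(ltW x0) ?(ltW s0)// -(powR_inv1 (ltW s0)) -powRrM mulN1r mulrA.
Qed.

Variables (g H : R -> R) (k : R).
Hypothesis k_gt0 : 0 < k.
Hypothesis cg : continuous g.
Hypothesis dH : forall t : R, is_derive t 1 H (g t).
Hypothesis H0 : H 0 = 0.
Hypothesis g_le : forall t : R, 0 < t -> `|g t| <= expR (- (t * k)).

(** Increases to partial_sum a (x / s) with M: s <= x / n means n <= x / s. *)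
Let truncated_kernel (x : R) (M : nat) (s : R) : R :=
  \sum_(1 <= n < M) a n * (s <= x / n%:R)%R%:R.

Let truncated_kernelE (x : R) M (s : R) : 0 < x -> 0 < s -> (Num.truncn (x / s) < M)%N ->
  truncated_kernel x M s = S (x / s).
Proof.
move=> x0 s0 xsM; rewrite /truncated_kernel /partial_sum.
rewrite (big_cat_nat (n := (Num.truncn (x / s)).+1))//= [X in _ + X]big_nat_cond [X in _ + X]big1 ?addr0.
  apply: eq_big_nat => n /andP[n1 nle].
  suff -> : s <= x / n%:R by rewrite mulr1.
  have n0 : (0 : R) < n%:R by rewrite ltr0n.
  rewrite ler_pdivlMr// mulrC -ler_pdivlMr//.
  by rewrite -truncn_ge_nat// divr_ge0// ltW.
move=> n /andP[/andP[n1 nle] _].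
have n0 : (0 : R) < n%:R by rewrite ltr0n (leq_trans _ n1).
suff /negbTE -> : ~~ (s <= x / n%:R) by rewrite mulr0.
by rewrite ler_pdivlMr// mulrC -ler_pdivlMr// -truncn_ge_nat ?divr_ge0 ?(ltW x0) ?(ltW s0)// -ltnNge.
Qed.

Let truncated_kernel_le (x : R) M (s : R) : 0 < x -> 0 < s ->
  0 <= truncated_kernel x M s <= C * x `^ alpha * s `^ (- alpha).
Proof.
move=> x0 s0; apply/andP; split; first by apply: sumr_ge0 => n _; rewrite mulr_ge0.
apply: (@le_trans _ _ (truncated_kernel x (maxn M (Num.truncn (x / s)).+1) s)).
  rewrite /truncated_kernel; have [M1|M1] := leqP M 1.
    by rewrite big_geq//; apply: sumr_ge0 => n _; rewrite mulr_ge0.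
  rewrite [leRHS](big_cat_nat (n := M)) ?leq_maxl ?(ltnW M1)//= lerDl.
  by apply: sumr_ge0 => n _; rewrite mulr_ge0.
rewrite truncated_kernelE ?leq_max ?leqnn ?orbT//.
exact: partial_sum_div_le.
Qed.

Let measurable_truncated_kernel x M :
  measurable_fun (`]0, +oo[%classic : set R) (truncated_kernel x M).
Proof.
apply: measurable_sum => n; apply: measurable_funM; first exact: measurable_cst.
have -> : (fun s : R => (s <= x / n%:R)%R%:R : R) = \1_(`]-oo, x / n%:R]%classic).
  by apply/funext => s; rewrite indicE mem_setE in_itv.
exact: measurable_indic.
Qed.

Let measurable_g : measurable_fun (`]0, +oo[%classic : set R) g.
Proof. by apply: measurable_continuous_itv0y => t _; exact: cg. Qed.

Lemma integrable_powR_kernel :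
  mu.-integrable `]0, +oo[ (EFin \o (fun s => s `^ (- alpha) * expR (- (s * k)))).
Proof.
have := @integrable_powR_expR R (1 - alpha) k; rewrite subr_gt0 => /(_ alpha_lt1 k_gt0).
by rewrite (_ : 1 - alpha - 1 = - alpha)//; ring.
Qed.

Let integrable_g : mu.-integrable `]0, +oo[ (EFin \o g).
Proof.
have := @integrable_powR_expR R 1 k ltr01 k_gt0.
apply: le_integrable => //; first exact/measurable_EFinP.
move=> t /=; rewrite in_itv/= andbT => t0.
by rewrite subrr powRr0 mul1r lee_fin [leRHS]ger0_norm ?expR_ge0// g_le.
Qed.

Let H_integral (y : R) : 0 < y -> H y = \int[mu]_(s in `]0, y]) g s.
Proof.
move=> y0; rewrite Rintegral_itv_obnd_cbnd; last first.
  by apply: integrableS integrable_g => //; exact: subset_itvl.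
rewrite /Rintegral (@continuous_FTC2 _ g H) ?H0 ?sube0//.
- by apply: continuous_subspaceT.
- split.
  + by move=> t _; have [] := dH t.
  + apply: cvg_at_right_filter; apply/differentiable_continuous/derivable1_diffP.
    by have [] := dH 0.
  + apply: cvg_at_left_filter; apply/differentiable_continuous/derivable1_diffP.
    by have [] := dH y.
- by move=> t _; rewrite derive1E; have [_ ->] := dH t.
Qed.

Let H_integral0y (y : R) : 0 < y -> H y = \int[mu]_(s in `]0, +oo[) ((s <= y)%R%:R * g s).
Proof.
move=> y0; rewrite H_integral//.
have -> : `]0, y]%classic = `]0, +oo[%classic `&` (`]-oo, y]%classic : set R).
  apply/seteqP; split => s /=; rewrite !in_itv/= ?andbT; first by move=> /andP[].
  by move=> [-> ->].
rewrite Rintegral_mkcondr; apply: eq_Rintegral => s _.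
by rewrite /patch mem_setE in_itv/=; case: ifP => _; rewrite ?mul1r ?mul0r.
Qed.

Let sum_integral (x : R) M : 0 < x ->
  \sum_(1 <= n < M) a n * H (x / n%:R) =
  \int[mu]_(s in `]0, +oo[) (truncated_kernel x M s * g s).
Proof.
move=> x0.
pose f n (s : R) : R := a n * ((s <= x / n%:R)%R%:R * g s).
have intf0 y : mu.-integrable `]0, +oo[ (EFin \o (fun s : R => (s <= y)%R%:R * g s)).
  apply: le_integrable integrable_g => //.
    apply/measurable_EFinP; apply: measurable_funM => //.
    have -> : (fun s : R => (s <= y)%R%:R : R) = \1_(`]-oo, y]%classic).
      by apply/funext => s; rewrite indicE mem_setE in_itv.
    exact: measurable_indic.
  move=> s _ /=; rewrite lee_fin normrM ger0_norm//.
  by rewrite -[leRHS]mul1r ler_wpM2r// lern1 leq_b1.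
have intf n : mu.-integrable `]0, +oo[ (EFin \o f n).
  have -> : EFin \o f n = (fun s => (a n)%:E * (EFin \o (fun s : R => (s <= x / n%:R)%R%:R * g s)%R) s)%E by [].
  exact: integrableZl.
rewrite (@eq_Rintegral _ _ _ mu _ (fun s => \sum_(1 <= n < M) f n s)); last first.
  by move=> s _; rewrite /truncated_kernel mulr_suml; apply: eq_bigr => n _; rewrite /f mulrA.
rewrite /Rintegral.
under eq_integral do rewrite -sumEFin.
rewrite (@integral_sum _ _ _ mu _ _ _ (fun n => EFin \o f n))// -sum_fine; last first.
  by move=> n _; apply: integrable_fin_num.
apply: eq_big_nat => n /andP[n1 _].
rewrite H_integral0y; last by rewrite divr_gt0// ltr0n.
by rewrite -RintegralZl.
Qed.

(** Summation by parts: H (x / n) is the integral of g over s <= x / n, and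
    s <= x / n means n <= x / s. *)
Lemma weighted_sum_integral (x : R) : 0 < x ->
  mu.-integrable `]0, +oo[ (EFin \o (fun s => S (x / s) * g s)) /\
  \sum_(1 <= n < M) a n * H (x / n%:R) @[M --> \oo] -->
    (\int[mu]_(s in `]0, +oo[) (S (x / s) * g s)).
Proof.
move=> x0.
have -> : (fun M => \sum_(1 <= n < M) a n * H (x / n%:R)) =
    (fun M => \int[mu]_(s in `]0, +oo[) (truncated_kernel x M s * g s)).
  by apply/funext => M; exact: sum_integral.
apply: (@dominated_convergence_itv0y _ (fun M s => truncated_kernel x M s * g s) _
  (fun s => C * x `^ alpha * (s `^ (- alpha) * expR (- (s * k))))).
- have -> : (EFin \o (fun s : R => C * x `^ alpha * (s `^ (- alpha) * expR (- (s * k))))) =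
    (fun s => (C * x `^ alpha)%:E *
      (EFin \o (fun s => s `^ (- alpha) * expR (- (s * k)))%R) s)%E by [].
  by apply: integrableZl => //; exact: integrable_powR_kernel.
- by move=> M; exact: measurable_funM.
- move=> s s0; apply: cvg_near_cst; near=> M.
  rewrite truncated_kernelE//; near: M; exact: nbhs_infty_gt.
- move=> M s s0; have /andP[k0 k1] := truncated_kernel_le M x0 s0.
  by rewrite normrM (ger0_norm k0) mulrA ler_pM ?normr_ge0//; exact: g_le.
Unshelve. all: end_near. Qed.

Lemma norm_weighted_integral_le (x : R) : 0 < x ->
  `|\int[mu]_(s in `]0, +oo[) (S (x / s) * g s)| <=
  C * x `^ alpha * \int[mu]_(s in `]0, +oo[) (s `^ (- alpha) * expR (- (s * k))).
Proof.
move=> x0; have [intS _] := weighted_sum_integral x0.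
have intD := integrable_powR_kernel.
apply: (le_trans (le_normr_Rintegral _ intS)) => //.
rewrite -RintegralZl//; apply: le_Rintegral => //.
- by have := integrable_abse intS.
- have -> : (EFin \o (fun s : R => C * x `^ alpha * (s `^ (- alpha) * expR (- (s * k))))) =
    (fun s => (C * x `^ alpha)%:E *
      (EFin \o (fun s => s `^ (- alpha) * expR (- (s * k)))%R) s)%E by [].
  exact: integrableZl.
move=> s /=; rewrite in_itv/= andbT => s0.
rewrite normrM (ger0_norm (partial_sum_ge0 _)) mulrA.
apply: ler_pM; rewrite ?normr_ge0 ?partial_sum_ge0 ?g_le//.
exact: partial_sum_div_le.
Qed.

(** After division by x^alpha the counting function at x / s tends to A s^(- alpha), and it
    is at most C s^(- alpha), which is integrable against the decaying g. *)
Lemma weighted_integral_asymp :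
  (\int[mu]_(s in `]0, +oo[) (S (x / s) * g s)) / x `^ alpha @[x --> +oo]
  --> A * \int[mu]_(s in `]0, +oo[) (s `^ (- alpha) * g s).
Proof.
apply/cvg_pinftyP => u u_oo.
(* u is only eventually positive *)
pose v n : R := Num.max (u n) 1.
have v0 n : 0 < v n by rewrite lt_max ltr01 orbT.
have v_oo : v n @[n --> \oo] --> +oo.
  apply: (@ger_cvgy _ _ _ _ u) => //; first by apply: nearW => n; rewrite le_max lexx.
have vE : \forall n \near \oo, v n = u n.
  near=> n; rewrite /v; apply: max_l.
  by near: n; move/cvgryPge : u_oo; exact.
pose f n (s : R) := S (v n / s) / v n `^ alpha * g s.
have E n : (\int[mu]_(s in `]0, +oo[) (S (v n / s) * g s)) / v n `^ alpha =
    \int[mu]_(s in `]0, +oo[) f n s.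
  have [intS _] := weighted_sum_integral (v0 n).
  rewrite mulrC -RintegralZl//; apply: eq_Rintegral => s _; rewrite /f; ring.
have [|n|s s0|n s s0|int_lim] := @dominated_convergence_itv0y R f (fun s => A * (s `^ (- alpha) * g s))
    (fun s => C * (s `^ (- alpha) * expR (- (s * k)))).
- have -> : (EFin \o (fun s : R => C * (s `^ (- alpha) * expR (- (s * k))))) =
    (fun s => C%:E * (EFin \o (fun s => s `^ (- alpha) * expR (- (s * k)))%R) s)%E by [].
  by apply: integrableZl => //; exact: integrable_powR_kernel.
- have [intS _] := weighted_sum_integral (v0 n).
  have := measurable_int _ intS => /measurable_EFinP mS.
  have -> : f n = (fun s => (v n `^ alpha)^-1 * (S (v n / s) * g s)).
    by apply/funext => s; rewrite /f; ring.
  exact: measurable_funM.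
- rewrite /f; apply: (@cvg_trans _ ((S (v n / s) / (v n / s) `^ alpha) * (s `^ (- alpha) * g s) @[n --> \oo])).
    apply: near_eq_cvg; apply: nearW => n /=.
    rewrite powRM ?invr_ge0 ?(ltW s0) ?(ltW (v0 n))// -(powR_inv1 (ltW s0)) -powRrM mulN1r.
    by field; rewrite !gt_eqF ?powR_gt0.
  apply: cvgM; last exact: cvg_cst.
  apply: (cvg_comp (fun n => v n / s) (fun y => S y / y `^ alpha) _ S_cvg).
  apply: (cvg_comp v (fun y => y / s) v_oo).
  by apply: gt0_cvgMly; rewrite ?invr_gt0//; exact: cvg_id.
- rewrite /f normrM mulrA; apply: ler_pM; rewrite ?normr_ge0 ?g_le//.
  rewrite ger0_norm ?divr_ge0 ?partial_sum_ge0 ?powR_ge0//.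
  rewrite ler_pdivrMr ?powR_gt0//.
  by rewrite (le_trans (partial_sum_div_le (v0 n) s0))// mulrAC.
move=> cvgf.
have int_g : mu.-integrable `]0, +oo[ (EFin \o (fun s => s `^ (- alpha) * g s)).
  have := integrable_powR_kernel; apply: le_integrable => //.
    apply/measurable_EFinP; apply: measurable_funM => //.
    by apply: measurable_funS (measurable_powR _).
  move=> s /=; rewrite in_itv/= andbT => s0; rewrite lee_fin !normrM ler_wpM2l//.
  by rewrite (le_trans (g_le s0))// ler_norm.
rewrite -RintegralZl//.
move: cvgf; apply: cvg_trans; apply: near_eq_cvg; near=> n.
by rewrite -E (near vE n).
Unshelve. all: end_near. Qed.

End abelian_theorem.

(** * Sums of 1 - cos over a sequence of power growth *)

(** Exchange of two limits: f is uniformly close to functions whose limits are known and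
    close to l. *)
Lemma cvg_approx (R : realType) (T : Type) (F : set_system T) (FF : Filter F)
    (f : T -> R) (l : R) :
  (forall e : R, 0 < e -> exists (g : T -> R) (l' : R),
    [/\ \forall x \near F, `|f x - g x| <= e, g x @[x --> F] --> l' & `|l' - l| <= e]) ->
  f x @[x --> F] --> l.
Proof.
move=> H; apply/cvgrPdist_le => e e0.
have e3 : 0 < e / 3 by rewrite divr_gt0.
have [g [l' [fg gl' ll']]] := H _ e3.
move/cvgrPdist_le : gl' => /(_ _ e3) gl'.
near=> x.
have h1 : `|f x - g x| <= e / 3 by near: x.
have h2 : `|l' - g x| <= e / 3 by near: x.
have -> : l - f x = - (l' - l) + (l' - g x) - (f x - g x) by ring.
apply: (le_trans (ler_normB _ _)).
have h3 : `|- (l' - l) + (l' - g x)| <= e / 3 + e / 3.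
  by apply: (le_trans (ler_normD _ _)); rewrite normrN lerD.
have -> : e = e / 3 + e / 3 + e / 3 by field.
exact: lerD.
Unshelve. all: end_near. Qed.

Lemma nondecreasing_sum_nat1 (R : realType) (u : nat -> R) : (forall n, 0 <= u n) ->
  nondecreasing_seq (fun M => \sum_(1 <= n < M) u n).
Proof.
move=> u0 M M' MM'; have [M1|M1] := leqP M 1.
  by rewrite [leLHS]big_geq//; apply: sumr_ge0.
by rewrite [leRHS](big_cat_nat (n := M)) ?(ltnW M1)//= lerDl sumr_ge0.
Qed.

(** Comparison test, with the sum of the majorant bounding the limit. *)
Lemma dominated_series_cvg (R : realType) (u v : nat -> R) (L : R) :
  (forall n, (0 < n)%N -> `|u n| <= v n) ->
  (forall M, \sum_(1 <= n < M) v n <= L) ->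
  exists2 l : R, \sum_(1 <= n < M) u n @[M --> \oo] --> l & `|l| <= L.
Proof.
move=> uv vL.
have leu M : \sum_(1 <= n < M) `|u n| <= L.
  apply: le_trans (vL M).
  by rewrite big_nat_cond [leRHS]big_nat_cond; apply: ler_sum => n /andP[/andP[n1 _] _]; exact: uv.
have : cvgn (series (fun n => u n.+1)).
  apply: normed_cvg; apply: nondecreasing_is_cvgn.
    by apply: nondecreasing_series => n _ _; exact: normr_ge0.
  exists L => _ [M _ <-]; have := leu M.+1.
  by rewrite /series /= big_add1.
move=> /cvg_ex[l ul].
have {}ul : \sum_(1 <= n < M) u n @[M --> \oo] --> (l : R).
  rewrite -(cvg_shiftS (fun M => \sum_(1 <= n < M) u n)).
  move: ul; apply: cvg_trans; apply: near_eq_cvg; apply: nearW => M.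
  by rewrite /series /= big_add1.
exists l => //.
have nl : `|\sum_(1 <= n < M) u n| @[M --> \oo] --> `|l| by apply: cvg_norm.
rewrite -(cvg_lim _ nl)//; apply: limr_le; first by apply/cvg_ex; eexists; exact: nl.
by apply: nearW => M; apply: le_trans (ler_norm_sum _ _ _) (leu M).
Qed.

Section cosine_sum.
Variable R : realType.
Local Notation mu := (@lebesgue_measure R).
Variables (a : nat -> R) (alpha A C : R).
Hypothesis a_ge0 : forall n, 0 <= a n.
Hypothesis alpha_gt0 : 0 < alpha.
Hypothesis alpha_lt1 : alpha < 1.
Hypothesis C_ge0 : 0 <= C.
Hypothesis S_le : forall y : R, 0 < y -> partial_sum a y <= C * y `^ alpha.
Hypothesis S_cvg : partial_sum a y / y `^ alpha @[y --> +oo] --> A.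

(** Real part of 1 - exp (- t exp (- i th)). At th = pi / 2 it is 1 - cos t; for smaller th
    its derivative decays exponentially. *)
Definition damped_versin (th t : R) : R := 1 - expR (- (t * cos th)) * cos (t * sin th).
Definition damped_versin' (th t : R) : R := expR (- (t * cos th)) * cos (t * sin th - th).

Lemma is_derive_damped_versin th (t : R) :
  is_derive t 1 (damped_versin th) (damped_versin' th t).
Proof.
have h1 : is_derive t 1 (fun t : R => - (t * cos th)) (- cos th).
  by apply: is_derive_eq; rewrite /GRing.scale /=; ring.
have h2 : is_derive t 1 (fun t : R => t * sin th) (sin th).
  by apply: is_derive_eq; rewrite /GRing.scale /=; ring.
have h3 := @is_derive1_comp R expR _ _ _ _ (is_derive_expR _) h1.
have h4 := @is_derive1_comp R cos _ _ _ _ (is_derive_cos _) h2.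
have h5 : is_derive t 1 (fun t => expR (- (t * cos th)) * cos (t * sin th)) _ := is_deriveM h3 h4.
have h6 := is_deriveB (is_derive_cst (1 : R) t 1) h5.
apply: (is_derive_eq h6); rewrite /damped_versin' cosB /GRing.scale /=; ring.
Qed.

Lemma damped_versin0 th : damped_versin th 0 = 0.
Proof. by rewrite /damped_versin !mul0r oppr0 expR0 cos0 mulr1 subrr. Qed.

Lemma continuous_damped_versin' th : continuous (damped_versin' th).
Proof.
move=> t; apply: cvgM.
  apply: continuous_comp; last exact: continuous_expR.
  by apply: cvgN; apply: cvgM; [exact: cvg_id|exact: cvg_cst].
apply: continuous_comp; last exact: continuous_cos.
by apply: cvgB; [apply: cvgM; [exact: cvg_id|exact: cvg_cst]|exact: cvg_cst].
Qed.

Lemma damped_versin'_le th (t : R) : 0 < t -> `|damped_versin' th t| <= expR (- (t * cos th)).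
Proof.
move=> t0; rewrite normrM ger0_norm ?expR_ge0//.
by rewrite -[leRHS]mulr1 ler_wpM2l ?expR_ge0 ?cos_max.
Qed.

Definition onem_expN (t : R) : R := 1 - expR (- t).

Lemma damped_versin_0 : damped_versin 0 = onem_expN.
Proof. by apply/funext => t; rewrite /damped_versin cos0 sin0 mulr0 cos0 !mulr1. Qed.

Lemma onem_expN_ge0 (t : R) : 0 <= t -> 0 <= onem_expN t.
Proof. by move=> t0; rewrite subr_ge0 expR_le1 oppr_le0. Qed.

(** Turns 1 - exp (- t), for which the Abelian theorem holds, into a majorant of every
    function that is O (min (1, t)). *)
Lemma min_le_onem_expN (t : R) : 0 <= t -> Num.min 1 t <= 2 * onem_expN t.
Proof.
move=> t0; have t1 : 0 < 1 + t by rewrite ltr_wpDr.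
apply: (@le_trans _ _ (2 * (t / (1 + t)))).
  rewrite mulrA ler_pdivlMr//; have [t1'|t1'] := leP 1 t; first by lra.
  by rewrite mulrDr mulr1 mulrC mulr2n mulrDl !mul1r lerD2l ler_piMl// ltW.
rewrite ler_pM2l// /onem_expN expRN.
have -> : t / (1 + t) = 1 - (1 + t)^-1 by field; rewrite gt_eqF.
by rewrite lerD2l lerN2 lef_pV2 ?posrE ?expR_gt0// expR_ge1Dx.
Qed.

Definition dirichlet_sum (h : R -> R) (x : R) : R :=
  lim (\sum_(1 <= n < M) a n * h (x / n%:R) @[M --> \oo]).

Definition dirichlet_const : R :=
  C * \int[mu]_(s in `]0, +oo[) (s `^ (- alpha) * expR (- (s * 1))).
Local Notation C1 := dirichlet_const.

Lemma dirichlet_const_ge0 : 0 <= C1.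
Proof.
by rewrite mulr_ge0// Rintegral_ge0// => s _; rewrite mulr_ge0 ?powR_ge0 ?expR_ge0.
Qed.

(** The case th = 0 of the damped functions. *)
Lemma dirichlet_sum_onem_expN (x : R) : 0 < x ->
  cvgn (fun M => \sum_(1 <= n < M) a n * onem_expN (x / n%:R)) /\
  dirichlet_sum onem_expN x <= C1 * x `^ alpha.
Proof.
move=> x0; have cg := @continuous_damped_versin' 0.
have g_le := @damped_versin'_le 0.
rewrite cos0 in g_le.
have [_] := weighted_sum_integral a_ge0 alpha_lt1 S_le ltr01 cg
  (is_derive_damped_versin 0) (damped_versin0 0) g_le x0.
have := norm_weighted_integral_le a_ge0 alpha_lt1 S_le ltr01 cg
  (is_derive_damped_versin 0) (damped_versin0 0) g_le x0.
rewrite damped_versin_0 => le_I cvg_I; split; first by apply/cvg_ex; eexists; exact: cvg_I.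
rewrite /dirichlet_sum (cvg_lim _ cvg_I)// /dirichlet_const mulrAC.
exact: le_trans (ler_norm _) le_I.
Qed.

Lemma dirichlet_sum_cvg (h : R -> R) (K c : R) (x : R) : 0 < x -> 0 < c ->
  (forall t, 0 < t -> `|h t| <= K * onem_expN (t * c)) ->
  \sum_(1 <= n < M) a n * h (x / n%:R) @[M --> \oo] --> dirichlet_sum h x /\
  `|dirichlet_sum h x| <= K * C1 * (x * c) `^ alpha.
Proof.
move=> x0 c0 hK; have xc0 : 0 < x * c by rewrite mulr_gt0.
have K0 : 0 <= K.
  have := hK _ ltr01; rewrite mul1r => /(le_trans (normr_ge0 _)).
  by rewrite pmulr_lge0// subr_gt0 expR_lt1 oppr_lt0.
have [cvgE leE] := dirichlet_sum_onem_expN xc0.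
pose u n := a n * h (x / n%:R).
pose v n := K * (a n * onem_expN (x * c / n%:R)).
have uv n : (0 < n)%N -> `|u n| <= v n.
  move=> n0; rewrite /u /v normrM ger0_norm// mulrCA ler_wpM2l//.
  by rewrite mulrAC hK// divr_gt0// ltr0n.
have v0 n : 0 <= v n.
  by rewrite mulr_ge0// mulr_ge0// onem_expN_ge0// divr_ge0// ltW.
have cvgv : \sum_(1 <= n < M) v n @[M --> \oo] --> K * dirichlet_sum onem_expN (x * c).
  under eq_fun do rewrite -mulr_sumr.
  by apply: cvgM; [exact: cvg_cst|exact: cvgE].
have lev M : \sum_(1 <= n < M) v n <= K * C1 * (x * c) `^ alpha.
  apply: (@le_trans _ _ (K * dirichlet_sum onem_expN (x * c))).
    by rewrite -(cvg_lim _ cvgv)//; apply: nondecreasing_cvgn_le;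
      [exact: nondecreasing_sum_nat1|apply/cvg_ex; eexists; exact: cvgv].
  by rewrite -mulrA ler_wpM2l.
have [l ul lL] := dominated_series_cvg uv lev.
by rewrite /dirichlet_sum (cvg_lim _ ul).
Qed.

Lemma dirichlet_sumB (h1 h2 : R -> R) (K c : R) (x : R) : 0 < x -> 0 < c ->
  cvgn (fun M => \sum_(1 <= n < M) a n * h1 (x / n%:R)) ->
  cvgn (fun M => \sum_(1 <= n < M) a n * h2 (x / n%:R)) ->
  (forall t, 0 < t -> `|h1 t - h2 t| <= K * onem_expN (t * c)) ->
  `|dirichlet_sum h1 x - dirichlet_sum h2 x| <= K * C1 * (x * c) `^ alpha.
Proof.
move=> x0 c0 c1 c2 hK; have [_] := dirichlet_sum_cvg x0 c0 hK.
suff -> : dirichlet_sum (fun t => h1 t - h2 t) x = dirichlet_sum h1 x - dirichlet_sum h2 x by [].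
apply/cvg_lim => //.
have -> : (fun M => \sum_(1 <= n < M) a n * (h1 (x / n%:R) - h2 (x / n%:R))) =
    (fun M => \sum_(1 <= n < M) a n * h1 (x / n%:R) - \sum_(1 <= n < M) a n * h2 (x / n%:R)).
  by apply/funext => M; rewrite -sumrB; apply: eq_bigr => n _; rewrite mulrBr.
exact: cvgB c1 c2.
Qed.

Lemma damped_versin_asymp (th : R) : 0 <= th < pi / 2 ->
  (forall x : R, 0 < x -> cvgn (fun M => \sum_(1 <= n < M) a n * damped_versin th (x / n%:R))) /\
  dirichlet_sum (damped_versin th) x / x `^ alpha @[x --> +oo] -->
    A * (cos (alpha * th) * Gamma (1 - alpha)).
Proof.
move=> /andP[th0 th2].
have cth : 0 < cos th.
  by apply: cos_gt0_pihalf; rewrite th2 andbT (lt_le_trans _ th0)// oppr_lt0 divr_gt0 ?pi_gt0.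
have W (x : R) (x0 : 0 < x) := weighted_sum_integral a_ge0 alpha_lt1 S_le cth (@continuous_damped_versin' th)
  (is_derive_damped_versin th) (damped_versin0 th) (@damped_versin'_le th) x0.
split; first by move=> x x0; have [_ h] := W x x0; apply/cvg_ex; eexists; exact: h.
have := weighted_integral_asymp a_ge0 alpha_lt1 S_le S_cvg cth (@continuous_damped_versin' th)
  (is_derive_damped_versin th) (damped_versin0 th) (@damped_versin'_le th).
have -> : \int[mu]_(s in `]0, +oo[) (s `^ (- alpha) * damped_versin' th s) =
    cos (alpha * th) * Gamma (1 - alpha).
  rewrite -(cosN (alpha * th)) -(@Rintegral_rotated_gamma _ _ _ th) ?subr_gt0 ?th0//.
  apply: eq_Rintegral => s _; rewrite /damped_versin' /rotated_gamma -mulrA.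
  congr (_ * (_ * cos _)); last by ring.
  by congr (_ `^ _); ring.
apply: cvg_trans; apply: near_eq_cvg; near=> x.
have x0 : 0 < x by near: x; exact: nbhs_pinfty_gt.
by have [_ h] := W x x0; rewrite /dirichlet_sum (cvg_lim _ h).
Unshelve. all: end_near. Qed.

Definition versin (t : R) : R := 1 - cos t.

Lemma versin_ge0 t : 0 <= versin t.
Proof. by rewrite subr_ge0 cos_le1. Qed.

Lemma cos_lipschitz (u v : R) : `|cos u - cos v| <= `|u - v|.
Proof.
wlog uv : u v / u <= v.
  move=> H; have [uv|/ltW vu] := leP u v; first exact: H.
  by rewrite distrC [leRHS]distrC H.
have cc : {within `[u, v], continuous (@cos R)} by apply: continuous_subspaceT; exact: continuous_cos.
have [c _ E] := MVT_segment uv (fun x _ => is_derive_cos x) cc.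
rewrite distrC E [leRHS]distrC normrM normrN.
by rewrite -[leRHS]mul1r ler_wpM2r ?sin_max.
Qed.

(** The argument t cos th on the right is what matters: in the sum over n it becomes a
    factor (cos th)^alpha, which tends to 0 with pi / 2 - th. *)
Lemma versin_damped_versin_le (th t : R) : 0 <= th < pi / 2 -> 0 < t ->
  `|versin t - damped_versin th t| <= 4 * onem_expN (t * cos th).
Proof.
move=> /andP[th0 th2] t0.
have cth : 0 < cos th.
  by apply: cos_gt0_pihalf; rewrite th2 andbT (lt_le_trans _ th0)// oppr_lt0 divr_gt0 ?pi_gt0.
have sth : 0 <= sin th.
  by apply: sin_ge0_pi; rewrite th0/= (le_trans (ltW th2))// ler_pdivrMr// ler_peMr ?pi_ge0// ler1n.
have s1c : 1 - sin th <= cos th.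
  have := cos2Dsin2 th; have := cos_le1 th; have := sin_le1 th; nra.
have e1 : expR (- (t * cos th)) <= 1 by rewrite expR_le1 oppr_le0 mulr_ge0// ltW.
have e2 : 1 - t * cos th <= expR (- (t * cos th)) := expR_ge1Dx _.
have e0 := expR_ge0 (- (t * cos th)).
apply: (@le_trans _ _ (2 * Num.min 1 (t * cos th))); last first.
  have := min_le_onem_expN (mulr_ge0 (ltW t0) (ltW cth)); lra.
have -> : versin t - damped_versin th t = expR (- (t * cos th)) * cos (t * sin th) - cos t.
  by rewrite /versin /damped_versin; ring.
rewrite minr_pMr// le_min; apply/andP; split.
  apply: (le_trans (ler_normB _ _)); rewrite normrM ger0_norm//.
  have := cos_max t; have := cos_max (t * sin th); have := normr_ge0 (cos (t * sin th)); nra.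
have -> : expR (- (t * cos th)) * cos (t * sin th) - cos t =
  (cos (t * sin th) - cos t) - (1 - expR (- (t * cos th))) * cos (t * sin th) by ring.
apply: (le_trans (ler_normB _ _)).
have -> : 2 * (t * cos th) = t * cos th + t * cos th by ring.
apply: lerD.
  apply: (le_trans (cos_lipschitz _ _)); rewrite distrC.
  have -> : t - t * sin th = t * (1 - sin th) by ring.
  by rewrite ger0_norm ?ler_pM2l// mulr_ge0 ?(ltW t0)// subr_ge0 sin_le1.
rewrite normrM ger0_norm ?subr_ge0//.
have := cos_max (t * sin th); have := normr_ge0 (cos (t * sin th)); nra.
Qed.

Lemma versin_le (t : R) : 0 < t -> `|versin t| <= 4 * onem_expN (t * 1).
Proof.
move=> t0; have p2 : 0 <= (0 : R) < pi / 2 by rewrite lexx divr_gt0 ?pi_gt0.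
apply: (@le_trans _ _ (2 * Num.min 1 t)); last first.
  have := @min_le_onem_expN t (ltW t0); rewrite mulr1; lra.
rewrite ger0_norm ?versin_ge0// /versin minr_pMr// le_min; apply/andP; split.
  have := cos_geN1 t; lra.
have := cos_lipschitz 0 t; rewrite cos0 sub0r normrN (gtr0_norm t0).
rewrite ger0_norm ?versin_ge0//; lra.
Qed.

(** The damping is removed by letting th tend to pi / 2: both the error relative to x^alpha,
    a multiple of (cos th)^alpha, and the change of the constant tend to 0. *)
Lemma versin_sum_asymp :
  dirichlet_sum versin x / x `^ alpha @[x --> +oo] -->
    A * (cos (alpha * (pi / 2)) * Gamma (1 - alpha)).
Proof.
apply: cvg_approx => e e0.
have pi2 : 0 < pi / 2 :> R by rewrite divr_gt0 ?pi_gt0.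
have cvg_cos : cos (alpha * th) @[th --> (pi / 2 : R)^'-] --> cos (alpha * (pi / 2)).
  apply: cvg_at_left_filter; apply: continuous_comp; last exact: continuous_cos.
  by apply: cvgM; [exact: cvg_cst|exact: cvg_id].
have cvg_A : A * (cos (alpha * th) * Gamma (1 - alpha)) @[th --> (pi / 2 : R)^'-] -->
    A * (cos (alpha * (pi / 2)) * Gamma (1 - alpha)).
  by apply: cvgM; [exact: cvg_cst|apply: cvgM; [exact: cvg_cos|exact: cvg_cst]].
have cvg_err : 4 * C1 * cos th `^ alpha @[th --> (pi / 2 : R)^'-] --> (4 * C1 * 0 : R).
  apply: cvgM; first exact: cvg_cst.
  have c0 : cos th @[th --> (pi / 2 : R)^'-] --> 0^'+.
    have h : cos th @[th --> (pi / 2 : R)^'-] --> (0 : R).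
      by rewrite -(cos_pihalf R); apply: cvg_at_left_filter; exact: continuous_cos.
    move=> P [d /= d0 dP]; move/cvgr0Pnorm_lt : h => /(_ _ d0) h.
    suff : \forall th \near (pi / 2 : R)^'-, P (cos th) by [].
    near=> th.
    have th0 : 0 < th by near: th; exact: nbhs_left_gt.
    have th2 : th < pi / 2 by near: th; exact: nbhs_left_lt.
    apply: dP; first by rewrite /= sub0r normrN; near: th; exact: h.
    by apply: cos_gt0_pihalf; rewrite th2 andbT (lt_trans _ th0)// oppr_lt0.
  exact: (cvg_comp _ _ c0 (powR_cvg0 alpha_gt0)).
rewrite mulr0 in cvg_err.
have [th [th0 th2 hA herr]] : exists th : R, [/\ 0 <= th, th < pi / 2,
    `|A * (cos (alpha * th) * Gamma (1 - alpha)) -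
       A * (cos (alpha * (pi / 2)) * Gamma (1 - alpha))| <= e & 4 * C1 * cos th `^ alpha <= e].
  near (pi / 2 : R)^'- => th; exists th; split.
  - by apply: ltW; near: th; exact: nbhs_left_gt.
  - by near: th; exact: nbhs_left_lt.
  - by rewrite distrC; near: th; move/cvgrPdist_le : cvg_A; exact.
  - near: th; move/cvgr0Pnorm_le : cvg_err => /(_ _ e0); apply: filterS => th'.
    exact: le_trans (ler_norm _).
have th02 : 0 <= th < pi / 2 by rewrite th0.
have [cvgd asy] := damped_versin_asymp th02.
exists (fun x => dirichlet_sum (damped_versin th) x / x `^ alpha).
exists (A * (cos (alpha * th) * Gamma (1 - alpha))); split => //.
near=> x; have x0 : 0 < x by near: x; exact: nbhs_pinfty_gt.
have cth : 0 < cos th.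
  by apply: cos_gt0_pihalf; rewrite th2 andbT (lt_le_trans _ th0)// oppr_lt0.
rewrite -mulrBl normrM [X in _ * X]ger0_norm ?invr_ge0 ?powR_ge0// ler_pdivrMr ?powR_gt0//.
have [cv _] := dirichlet_sum_cvg x0 ltr01 versin_le.
have := @dirichlet_sumB versin (damped_versin th) 4 (cos th) x x0 cth.
move=> /(_ _ (cvgd _ x0) (fun t => versin_damped_versin_le th02)) h.
apply: (le_trans (h _)); first by apply/cvg_ex; eexists; exact: cv.
by rewrite powRM ?(ltW x0) ?(ltW cth)// mulrA mulrAC ler_wpM2r ?powR_ge0.
Unshelve. all: end_near. Qed.

End cosine_sum.

(** * Tannery's theorem and the Fourier series of t (1 - t) *)

Section tannery.
Variable R : realType.

(** Dominated convergence for series: cut at an M0 beyond which the tail of v, hence of every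
    f N and of u, is at most e. *)
Lemma tannery (f : nat -> nat -> R) (u v : nat -> R) (L l : R) (s : nat -> R) :
  (forall N k, (0 < k)%N -> `|f N k| <= v k) ->
  (forall M, \sum_(1 <= k < M) v k <= L) ->
  (forall k, (0 < k)%N -> f N k @[N --> \oo] --> u k) ->
  (forall N, \sum_(1 <= k < M) f N k @[M --> \oo] --> s N) ->
  \sum_(1 <= k < M) u k @[M --> \oo] --> l ->
  s N @[N --> \oo] --> l.
Proof.
move=> fv vL fu fs ul.
have v0 k : (0 < k)%N -> 0 <= v k by move=> k0; apply: le_trans (fv 0%N k k0).
have uv k : (0 < k)%N -> `|u k| <= v k.
  move=> k0; have nl : `|f N k| @[N --> \oo] --> `|u k| by apply: cvg_norm; exact: fu.
  rewrite -(cvg_lim _ nl)//; apply: limr_le; first by apply/cvg_ex; eexists; exact: nl.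
  by apply: nearW => N; exact: fv.
have vv k : (0 < k)%N -> `|v k| <= v k by move=> k0; rewrite ger0_norm ?v0.
have [lv cvgv _] := dominated_series_cvg vv vL.
apply: cvg_approx => e e0.
have : \forall M0 \near \oo, (0 < M0)%N /\ `|lv - \sum_(1 <= k < M0) v k| <= e.
  near=> M0; split; first by near: M0; exact: nbhs_infty_gt.
  by near: M0; move/cvgrPdist_le : cvgv; exact.
move=> [M0 _ /(_ _ (leqnn M0)) [M00 lvM0]].
have tail (g : nat -> R) (sg : R) : (forall k, (0 < k)%N -> `|g k| <= v k) ->
    \sum_(1 <= k < M) g k @[M --> \oo] --> sg -> `|sg - \sum_(1 <= k < M0) g k| <= e.
  move=> gv gs.
  have nl : `|\sum_(1 <= k < M) g k - \sum_(1 <= k < M0) g k| @[M --> \oo] -->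
      `|sg - \sum_(1 <= k < M0) g k|.
    by apply: cvg_norm; apply: cvgB; [exact: gs|exact: cvg_cst].
  rewrite -(cvg_lim _ nl)//; apply: limr_le; first by apply/cvg_ex; eexists; exact: nl.
  near=> M; have MM0 : (M0 <= M)%N by near: M; exact: nbhs_infty_ge.
  rewrite (big_cat_nat (n := M0))//= addrAC subrr add0r.
  apply: (@le_trans _ _ (\sum_(M0 <= k < M) v k)).
    apply: (le_trans (ler_norm_sum _ _ _)).
    rewrite big_nat_cond [leRHS]big_nat_cond; apply: ler_sum => k /andP[/andP[k1 _] _].
    by rewrite gv// (leq_trans M00).
  have ndv : {homo (fun M => \sum_(1 <= k < M) v k) : m n / (m <= n)%N >-> m <= n}.
    apply/nondecreasing_seqP => -[|m]; first by rewrite !big_geq.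
    by rewrite [leRHS]big_nat_recr//= lerDl v0.
  apply: le_trans lvM0; apply: le_trans (ler_norm _).
  rewrite lerBrDr.
  have -> : \sum_(M0 <= k < M) v k + \sum_(1 <= k < M0) v k = \sum_(1 <= k < M) v k.
    by rewrite addrC -big_cat_nat.
  by rewrite -(cvg_lim _ cvgv)//; apply: nondecreasing_cvgn_le => //; apply/cvg_ex; eexists; exact: cvgv.
exists (fun N => \sum_(1 <= k < M0) f N k), (\sum_(1 <= k < M0) u k); split.
- by apply: nearW => N; apply: tail; [exact: fv|exact: fs].
- elim: M0 {M00 lvM0 tail} => [|[|M0] IH].
  + under eq_fun do rewrite big_geq//; rewrite big_geq//; exact: cvg_cst.
  + under eq_fun do rewrite big_geq//; rewrite big_geq//; exact: cvg_cst.
  + under eq_fun do rewrite big_nat_recr//=; rewrite [X in nbhs X]big_nat_recr//=.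
    by apply: cvgD; [exact: IH|exact: fu].
- by rewrite distrC; apply: tail; [exact: uv|exact: ul].
Unshelve. all: end_near. Qed.

(** Integral comparison, with the mean value theorem for x^(1 - s) in place of the integral. *)
Lemma p_series_le (s : R) (M : nat) : 1 < s ->
  \sum_(1 <= k < M) k%:R `^ (- s) <= 1 + (s - 1)^-1.
Proof.
move=> s1; have s0 : 0 < s - 1 by rewrite subr_gt0.
suff H n : \sum_(1 <= k < n.+2) k%:R `^ (- s) <= 1 + (s - 1)^-1 * (1 - n.+1%:R `^ (1 - s)).
  have s2 : 0 <= 1 + (s - 1)^-1 by rewrite addr_ge0// invr_ge0 ltW.
  case: M => [|[|n]]; [by rewrite big_geq|by rewrite big_geq|].
  apply: (le_trans (H n)); rewrite lerD2l -[leRHS]mulr1 ler_wpM2l ?invr_ge0 ?(ltW s0)//.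
elim: n => [|n IHn]; first by rewrite big_nat1 !powR1 subrr mulr0 addr0.
rewrite big_nat_recr//=.
apply: (@le_trans _ _ (1 + (s - 1)^-1 * (1 - n.+1%:R `^ (1 - s)) + n.+2%:R `^ (- s))).
  by rewrite lerD2r.
rewrite -addrA lerD2l -lerBrDl -mulrBr ler_pdivlMl//.
have n12 : (n.+1%:R : R) <= n.+2%:R by rewrite ler_nat.
have dP (x : R) : 0 < x -> is_derive x 1 (@powR R ^~ (1 - s)) ((1 - s) * x `^ (1 - s - 1)).
  exact: is_derive1_powR.
have dP' (x : R) : x \in `]n.+1%:R, n.+2%:R[ -> is_derive x 1 (@powR R ^~ (1 - s)) ((1 - s) * x `^ (1 - s - 1)).
  by rewrite in_itv/= => /andP[x1 _]; apply: dP; rewrite (lt_trans _ x1).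
have cP : {within `[n.+1%:R, n.+2%:R], continuous (@powR R ^~ (1 - s))}.
  apply: derivable_within_continuous => x; rewrite in_itv/= => /andP[x1 _].
  by have [] := dP x (lt_le_trans (ltr0Sn R n) x1).
have [c] := MVT_segment n12 dP' cP.
rewrite in_itv/= => /andP[c1 c2].
have -> : n.+2%:R - n.+1%:R = 1 :> R by rewrite -[n.+2%:R]natr1; ring.
rewrite mulr1 (_ : 1 - s - 1 = - s); last by ring.
move=> E; have -> : 1 - n.+2%:R `^ (1 - s) - (1 - n.+1%:R `^ (1 - s)) = (s - 1) * c `^ (- s) by lra.
have c0 : 0 < c by rewrite (lt_le_trans _ c1).
rewrite ler_pM2l// !powRN lef_pV2 ?posrE ?powR_gt0//.
by apply: ge0_ler_powR; rewrite ?nnegrE ?(ltW c0)//; lra.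
Qed.

End tannery.

Section fourier.
Variable R : realType.
Implicit Types (x : R) (n m j k : nat).

(** Multiplication by 2 sin (pi m / n) makes the sum telescope. *)
Lemma sum_cos_root n m : (0 < m < n)%N ->
  \sum_(1 <= k < n) cos (2 * (pi * k%:R * m%:R / n%:R)) = -1 :> R.
Proof.
move=> /andP[m0 mn]; have n0 : (0 < n)%N by rewrite (ltn_trans m0).
have n0' : (0 : R) < n%:R by rewrite ltr0n.
pose a : R := pi * m%:R / n%:R.
have sa : 0 < sin a.
  apply: sin_gt0_pi; rewrite /a divr_gt0 ?mulr_gt0 ?pi_gt0 ?ltr0n//=.
  by rewrite ltr_pdivrMr// ltr_pM2l ?pi_gt0// ltr_nat.
apply: (@mulfI _ (2 * sin a)); first by rewrite mulf_neq0// gt_eqF.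
pose F k : R := sin ((2 * k%:R - 1) * a).
rewrite mulr_sumr (@eq_big_nat _ _ _ _ _ _ (fun k => F k.+1 - F k)); last first.
  move=> k _; rewrite /F -[k.+1%:R]natr1.
  have -> : (2 * (k%:R + 1) - 1) * a = 2 * k%:R * a + a by ring.
  have -> : (2 * k%:R - 1) * a = 2 * k%:R * a - a by ring.
  have -> : 2 * (pi * k%:R * m%:R / n%:R) = 2 * k%:R * a by rewrite /a; ring.
  by rewrite sinD sinB; ring.
rewrite telescope_sumr// /F.
have -> : (2 * n%:R - 1) * a = - a + (pi *+ 2) *+ m.
  by rewrite -(mulr_natr (pi *+ 2) m) -(mulr_natr pi 2) /a; field; rewrite gt_eqF.
rewrite (periodicn (@sinD2pi R)) sinN (_ : 2 * 1 - 1 = 1 :> R) ?mul1r; last by ring.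
by ring.
Qed.

(** The Fejer kernel: as functions of j, both sides have second difference -2, on the left
    by the sum of cosines above. *)
Lemma sum_sin2_ratio n j : (j <= n)%N -> (0 < n)%N ->
  \sum_(1 <= k < n) sin (j%:R * (pi * k%:R / n%:R)) ^+ 2 / sin (pi * k%:R / n%:R) ^+ 2
  = j%:R * (n%:R - j%:R) :> R.
Proof.
move=> jn n0; have n0' : (0 : R) < n%:R by rewrite ltr0n.
pose x k : R := pi * k%:R / n%:R.
have sx k : (1 <= k < n)%N -> 0 < sin (x k).
  move=> /andP[k1 kn]; apply: sin_gt0_pi; rewrite /x divr_gt0 ?mulr_gt0 ?pi_gt0 ?ltr0n//=.
  by rewrite ltr_pdivrMr// ltr_pM2l ?pi_gt0// ltr_nat.
pose S i : R := \sum_(1 <= k < n) sin (i%:R * x k) ^+ 2 / sin (x k) ^+ 2.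
have S0 : S 0%N = 0.
  by rewrite /S big1// => k _; rewrite mul0r sin0 expr0n mul0r.
have S1 : S 1%N = n%:R - 1.
  rewrite /S (@eq_big_nat _ _ _ _ _ _ (fun=> 1)); last first.
    by move=> k k1n; rewrite mul1r divff// sqrf_eq0 gt_eqF// sx.
  by rewrite sumr_const_nat natrB.
have SS i : (i.+2 <= n)%N -> S i.+2 = 2 * S i.+1 - S i - 2.
  move=> i2n; have i1 : (0 < i.+1 < n)%N by [].
  have := sum_cos_root i1 => E.
  have -> : - 2 = 2 * (-1) :> R by ring.
  rewrite -E /S !mulr_sumr -sumrB -big_split /=; apply: eq_big_nat => k k1n.
  have s0 : sin (x k) != 0 by rewrite gt_eqF// sx.
  set y := i.+1%:R * x k.
  have -> : i.+2%:R * x k = y + x k by rewrite /y -[i.+2%:R]natr1; ring.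
  have -> : i%:R * x k = y - x k by rewrite /y -[i.+1%:R]natr1; ring.
  have -> : 2 * (pi * k%:R * i.+1%:R / n%:R) = y + y by rewrite /y /x; ring.
  rewrite sinD sinB cosD.
  have c2 := cos2Dsin2 (x k); have c2y := cos2Dsin2 y.
  move: s0 c2 c2y; set s := sin (x k); set c := cos (x k); set sy := sin y; set cy := cos y.
  move=> s0 c2 c2y.
  have cE : c ^+ 2 = 1 - s ^+ 2 by rewrite -c2; ring.
  have -> : (sy * c + cy * s) ^+ 2 = sy ^+ 2 * c ^+ 2 + 2 * (sy * cy * c * s) + cy ^+ 2 * s ^+ 2 by ring.
  have -> : (sy * c - cy * s) ^+ 2 = sy ^+ 2 * c ^+ 2 - 2 * (sy * cy * c * s) + cy ^+ 2 * s ^+ 2 by ring.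
  by rewrite cE; field.
rewrite -/(S j); elim/ltn_ind: j jn => -[|[|i]] IH jn; first by rewrite S0 mul0r.
  by rewrite S1 mul1r.
rewrite SS// !IH ?(ltnW jn) ?(ltnW (ltnW jn))//.
by rewrite -[i.+2%:R]natr1 -[i.+1%:R]natr1; ring.
Qed.

(** A weak form of Jordan's inequality, by halving the angle. *)
Lemma sin_ge_half x : 0 <= x <= pi / 2 -> x / 2 <= sin x.
Proof.
move=> /andP[x0 x2].
have h0 : 0 <= x / 2 by rewrite divr_ge0.
have cc : {within `[0, x / 2], continuous (@sin R)} by apply: continuous_subspaceT; exact: continuous_sin.
have [c c_in E] := MVT_segment h0 (fun x _ => is_derive_sin x) cc.
move: c_in E; rewrite in_itv/= sin0 !subr0 => /andP[c0 cx] E.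
have pi0 := pi_gt0 R.
have cle : cos (x / 2) <= cos c.
  by rewrite leNgt ltr_cos ?in_itv/= -?leNgt//; lra.
have c20 : 0 <= cos (x / 2) by apply: cos_ge0_pihalf; lra.
have cx0 : 0 <= cos x by apply: cos_ge0_pihalf; lra.
have Ex : x = x / 2 + x / 2 by field.
have -> : sin x = 2 * (cos c * (x / 2)) * cos (x / 2) by rewrite {1}Ex sinD E; ring.
have : cos x = 2 * cos (x / 2) ^+ 2 - 1.
  by rewrite {1}Ex cosD -!expr2 sin2cos2; ring.
move=> Ec; have : 1 <= 2 * (cos (x / 2) * cos c).
  apply: (@le_trans _ _ (2 * (cos (x / 2) * cos (x / 2)))); first by rewrite -expr2; lra.
  by rewrite ler_pM2l// ler_wpM2l.
by move=> h; nra.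
Qed.

(** The finite identity [sum_sin2_ratio] for n = 2 q (N + 1) and j = n p / q, divided by n^2:
    as N grows, the term of index k tends to half of the k-th term of the series. The
    symmetry k -> n - k folds the finite sum onto k <= n / 2, where sin is bounded below
    linearly, so that Tannery's theorem applies. *)
Lemma versin_fourier (p q : nat) : (p <= q)%N -> (0 < q)%N ->
  \sum_(1 <= k < M) versin (2 * pi * (k%:R * (p%:R / q%:R))) / (pi * k%:R) ^+ 2
    @[M --> \oo] --> ((p%:R / q%:R) * (1 - p%:R / q%:R) : R).
Proof.
move=> pq q0; set t : R := p%:R / q%:R; have pi0 := pi_gt0 R.
have q0' : (0 : R) < q%:R by rewrite ltr0n.
pose L N := (q * N.+1)%N; pose M N := (2 * L N)%N.
have L0 N : (0 < L N)%N by rewrite muln_gt0 q0.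
have M0 N : (0 : R) < (M N)%:R by rewrite ltr0n muln_gt0 L0.
pose r N k : R := sin (pi * (k%:R * t)) ^+ 2 / sin (pi * k%:R / (M N)%:R) ^+ 2.
have total N : \sum_(1 <= k < M N) r N k = (M N)%:R ^+ 2 * (t * (1 - t)).
  have j_le : (2 * p * N.+1 <= M N)%N by rewrite /M /L mulnA leq_mul2r leq_mul2l pq orbT.
  have := sum_sin2_ratio j_le _; rewrite muln_gt0 L0 => /(_ isT) E.
  have jE : (2 * p * N.+1)%:R = (M N)%:R * t :> R.
    by rewrite /M /L /t !natrM; field; rewrite gt_eqF.
  rewrite jE in E; transitivity ((M N)%:R * t * ((M N)%:R - (M N)%:R * t)); last by ring.
  rewrite -E; apply: eq_bigr => k _; rewrite /r; congr (sin _ ^+ 2 / _).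
  by field; rewrite gt_eqF.
have rsym N k : (k <= M N)%N -> r N (M N - k)%N = r N k.
  move=> kM; rewrite /r; congr (_ / _).
    have -> : pi * ((M N - k)%:R * t) = - (pi * (k%:R * t)) + (pi *+ 2) *+ (p * N.+1).
      rewrite -(mulr_natr (pi *+ 2) (p * N.+1)) -(mulr_natr pi 2) natrB// /M /L /t !natrM.
      by field; rewrite gt_eqF.
    by rewrite (periodicn (@sinD2pi R)) sinN sqrrN.
  have -> : pi * (M N - k)%:R / (M N)%:R = - (pi * k%:R / (M N)%:R) + pi :> R.
    by rewrite natrB//; field; rewrite gt_eqF.
  by rewrite sinDpi sinN opprK.
(* weights of the folded sum: the middle index L N = n / 2 is its own mirror image *)
pose c N k : R := if (k < L N)%N then 2 else (k == L N)%:R.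
pose f N k : R := c N k * (r N k / (M N)%:R ^+ 2).
have fE N : \sum_(1 <= k < (L N).+1) f N k = t * (1 - t).
  have M20 : (M N)%:R ^+ 2 != 0 :> R by rewrite sqrf_eq0 gt_eqF.
  apply: (mulfI M20); rewrite -total mulr_sumr.
  have -> : \sum_(1 <= k < (L N).+1) (M N)%:R ^+ 2 * f N k = \sum_(1 <= k < (L N).+1) c N k * r N k.
    by apply: eq_bigr => k _; rewrite /f; field; rewrite gt_eqF.
  have LM : ((L N).+1 <= M N)%N by rewrite /M mul2n -addnn -addn1 leq_add2l L0.
  rewrite [RHS](big_cat_nat (n := (L N).+1))//= big_nat_recr//= [in RHS]big_nat_recr//=.
  rewrite {2}/c ltnn eqxx mul1r.
  have -> : \sum_((L N).+1 <= k < M N) r N k = \sum_(1 <= k < L N) r N k.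
    rewrite big_nat_rev /= -[(L N).+1]add1n big_addn.
    have -> : (M N - L N = L N)%N by rewrite /M mul2n -addnn addnK.
    apply: eq_big_nat => k /andP[k1 kL].
    have -> : (1 + L N + M N - (k + L N).+1 = M N - k)%N.
      by rewrite add1n addSn subSS addnC [(k + _)%N]addnC addnC subnDl.
    by apply: rsym; rewrite /M mul2n -addnn (leq_trans (ltnW kL))// leq_addr.
  have -> : \sum_(1 <= i < L N) c N i * r N i = \sum_(1 <= i < L N) r N i + \sum_(1 <= i < L N) r N i.
    by rewrite -big_split /=; apply: eq_big_nat => k /andP[_ kL]; rewrite /c kL; ring.
  by ring.
have pi20 : 0 < pi ^+ 2 :> R by rewrite exprn_gt0.
have fbig N k : (L N < k)%N -> f N k = 0.
  by move=> Lk; rewrite /f /c ltnNge (ltnW Lk)/= gtn_eqF// mul0r.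
have fv N k : (0 < k)%N -> `|f N k| <= 8 / pi ^+ 2 * k%:R `^ (- 2).
  move=> k0; have k0' : (0 : R) < k%:R by rewrite ltr0n.
  have [kL|Lk] := leqP k (L N); last first.
    by rewrite fbig// normr0 mulr_ge0 ?powR_ge0// divr_ge0 ?ltW.
  have c2 : 0 <= c N k <= 2.
    by rewrite /c; case: ifP => _; rewrite ?lexx ?ler0n//= ler_nat (leq_trans (leq_b1 _)).
  move: c2 => /andP[c0 c2].
  have x0 : 0 < (pi * k%:R / (M N)%:R : R) by rewrite divr_gt0 ?mulr_gt0.
  have x2 : 0 <= (pi * k%:R / (M N)%:R : R) <= pi / 2.
    rewrite (ltW x0)/= ler_pdivrMr// -mulrA ler_pM2l//.
    by rewrite mulrC ler_pdivlMr// -natrM ler_nat /M mulnC leq_mul2l.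
  have s_ge := sin_ge_half x2.
  have s0 : 0 < sin (pi * k%:R / (M N)%:R : R) by rewrite (lt_le_trans _ s_ge)// divr_gt0.
  rewrite ger0_norm; last first.
    by rewrite /f mulr_ge0// divr_ge0 ?sqr_ge0// /r divr_ge0 ?sqr_ge0.
  have -> : 8 / pi ^+ 2 * k%:R `^ (- 2) = 2 * (4 / (pi * k%:R) ^+ 2) :> R.
    have aux (P K : R) : 0 < P -> 0 < K -> 8 / P ^+ 2 / K ^+ 2 = 2 * (4 / (P * K) ^+ 2).
      by move=> P0 K0; field; rewrite !gt_eqF.
    by rewrite powRN powR_mulrn ?ler0n// aux.
  rewrite /f; apply: ler_pM => //; first by rewrite divr_ge0 ?sqr_ge0// /r divr_ge0 ?sqr_ge0.
  rewrite ler_pdivrMr ?exprn_gt0// /r ler_pdivrMr ?exprn_gt0//.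
  apply: (@le_trans _ _ 1).
    by have := cos2Dsin2 (pi * (k%:R * t)); have := sqr_ge0 (cos (pi * (k%:R * t))); lra.
  have h : (pi * k%:R / (M N)%:R / 2 : R) ^+ 2 <= sin (pi * k%:R / (M N)%:R) ^+ 2.
    by rewrite ler_sqr ?nnegrE// ltW// divr_gt0.
  have E1 : 1 = 4 / (pi * k%:R) ^+ 2 * (M N)%:R ^+ 2 * (pi * k%:R / (M N)%:R / 2) ^+ 2 :> R.
    have aux (P K Q : R) : 0 < P -> 0 < K -> 0 < Q ->
        1 = 4 / (P * K) ^+ 2 * Q ^+ 2 * (P * K / Q / 2) ^+ 2.
      by move=> P0 K0 Q0; field; rewrite !gt_eqF.
    exact: aux.
  by rewrite [leLHS]E1 ler_wpM2l// mulr_ge0 ?sqr_ge0// divr_ge0 ?sqr_ge0.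
have vL Q : \sum_(1 <= k < Q) 8 / pi ^+ 2 * k%:R `^ (- 2) <= 8 / pi ^+ 2 * (1 + (2 - 1)^-1) :> R.
  rewrite -mulr_sumr ler_wpM2l ?p_series_le//; last by rewrite ltr1n.
  by rewrite divr_ge0// ltW.
have M_oo : (M N)%:R @[N --> \oo] --> (+oo : set_system R).
  apply/cvgryPge => B; near=> N.
  apply: (@le_trans _ _ N%:R); first by near: N; exact: nbhs_infty_ger.
  by rewrite ler_nat /M /L mulnA (leq_trans (leqnSn _))// leq_pmull// muln_gt0.
have fu k : (0 < k)%N -> f N k @[N --> \oo] -->
    versin (2 * pi * (k%:R * t)) / (pi * k%:R) ^+ 2.
  move=> k0; have k0' : (0 : R) < k%:R by rewrite ltr0n.
  have pk0 : 0 < pi * k%:R :> R by rewrite mulr_gt0.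
  pose x N : R := pi * k%:R / (M N)%:R.
  have x0 N : 0 < x N by rewrite divr_gt0.
  have x_cvg : x N @[N --> \oo] --> (0 : R).
    rewrite -(mulr0 (pi * k%:R)); apply: cvgM; first exact: cvg_cst.
    by apply/gtr0_cvgV0; [exact: nearW|exact: M_oo].
  have sinc : sin (x N) / x N @[N --> \oo] --> (1 : R).
    have [/cvg_ex[/= l dl] _] := is_derive_sin (0 : R).
    have l1 : l = 1.
      have [_ dE] := is_derive_sin (0 : R); rewrite -(cos0 R) -dE.
      by apply/esym/cvg_lim.
    move: dl; rewrite l1 => /cvgr_dnbhsP /(_ x) h.
    have {}h := h _; have := h (conj (fun N => lt0r_neq0 (x0 N)) x_cvg).
    apply: cvg_trans; apply: near_eq_cvg; apply: nearW => n.
    by rewrite scaler1 /= addr0 sin0 subr0 /GRing.scale /= mulrC.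
  have lim2 : 2 * sin (pi * (k%:R * t)) ^+ 2 / (pi * k%:R) ^+ 2 * (sin (x N) / x N) ^- 2
      @[N --> \oo] --> 2 * sin (pi * (k%:R * t)) ^+ 2 / (pi * k%:R) ^+ 2 * 1 ^- 2.
    apply: cvgM; first exact: cvg_cst.
    apply: cvgV; first by rewrite expr1n oner_neq0.
    by rewrite !expr2; apply: cvgM; exact: sinc.
  have -> : versin (2 * pi * (k%:R * t)) / (pi * k%:R) ^+ 2 =
      2 * sin (pi * (k%:R * t)) ^+ 2 / (pi * k%:R) ^+ 2 * 1 ^- 2.
    rewrite expr1n invr1 mulr1; congr (_ / _).
    have -> : 2 * pi * (k%:R * t) = pi * (k%:R * t) + pi * (k%:R * t) by ring.
    by rewrite /versin cosD -!expr2 cos2sin2; ring.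
  move: lim2; apply: cvg_trans; apply: near_eq_cvg; near=> N.
  have kL : (k < L N)%N.
    by apply: (@leq_trans N.+1); [rewrite ltnS; near: N; exact: nbhs_infty_ge|rewrite /L leq_pmull].
  have s0 : 0 < sin (x N).
    apply: sin_gt0_pi; rewrite x0/= /x ltr_pdivrMr// ltr_pM2l// ltr_nat.
    by rewrite /M mul2n -addnn (leq_trans kL)// leq_addr.
  have aux (P K Q T U : R) : 0 < P -> 0 < K -> 0 < Q -> 0 < U ->
      2 * T / (P * K) ^+ 2 * (U / (P * K / Q)) ^- 2 = 2 * (T / U ^+ 2 / Q ^+ 2).
    by move=> P0 K0 Q0 U0; field; rewrite !gt_eqF.
  by rewrite /f /c kL /r -/(x N) aux.
have fs N : \sum_(1 <= k < Q) f N k @[Q --> \oo] --> t * (1 - t).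
  apply: cvg_near_cst; near=> Q; rewrite -(fE N).
  have LQ : ((L N).+1 <= Q)%N by near: Q; exact: nbhs_infty_ge.
  rewrite (big_cat_nat (n := (L N).+1))//= [X in _ + X]big_nat_cond [X in _ + X]big1 ?addr0//.
  by move=> k /andP[/andP[k1 _] _]; exact: fbig.
have uv k : (0 < k)%N -> `|versin (2 * pi * (k%:R * t)) / (pi * k%:R) ^+ 2| <= 8 / pi ^+ 2 * k%:R `^ (- 2).
  move=> k0; have nl : `|f N k| @[N --> \oo] --> `|versin (2 * pi * (k%:R * t)) / (pi * k%:R) ^+ 2|.
    by apply: cvg_norm; exact: fu.
  rewrite -(cvg_lim _ nl)//; apply: limr_le; first by apply/cvg_ex; eexists; exact: nl.
  by apply: nearW => N; exact: fv.
have [l ul _] := dominated_series_cvg uv vL.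
have := tannery fv vL fu fs ul.
by move=> /(cvg_unique _ (cvg_cst _)) -> //.
Unshelve. all: end_near. Qed.

End fourier.

(** * Means of periodic functions and congruent pairs *)

Section periodic_means.
Variable R : realType.
Implicit Types f g : nat -> R.

Definition nat_periodic (Q : nat) f := forall x, f (x + Q)%N = f x.

Lemma nat_periodic_mul Q f k x : nat_periodic Q f -> f (x + k * Q)%N = f x.
Proof.
by move=> pf; elim: k => [|k IH]; rewrite ?mul0n ?addn0// mulSnr addnA pf.
Qed.

Lemma nat_periodic_mod Q f x : nat_periodic Q f -> f (x %% Q)%N = f x.
Proof. by move=> pf; rewrite {2}(divn_eq x Q) addnC nat_periodic_mul. Qed.

(** j -> j Q + r permutes the residues modulo B. *)
Lemma sum_arith_progression (B Q r : nat) g : (0 < B)%N -> coprime Q B -> nat_periodic B g ->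
  \sum_(0 <= j < B) g (j * Q + r)%N = \sum_(0 <= x < B) g x.
Proof.
move=> B0 cQB pg; rewrite !big_mkord.
pose h (j : 'I_B) : 'I_B := Ordinal (ltn_pmod (j * Q + r) B0).
have h_inj : injective h.
  move=> i j /(congr1 val) /= /eqP; rewrite eqn_modDr => /eqP ij.
  have : (i * Q == j * Q %[mod B])%N by apply/eqP.
  wlog lij : i j {ij} / (i <= j)%N.
    move=> H; have [lij|/ltnW lij] := leqP i j; first exact: H.
    by rewrite eq_sym => /H ->.
  rewrite eq_sym eqn_mod_dvd ?leq_mul2r ?lij ?orbT// -mulnBl Gauss_dvdl; last by rewrite coprime_sym.
  move=> dv; apply: val_inj; apply/eqP; rewrite eqn_leq lij /= -subn_eq0.
  move: dv; rewrite /dvdn modn_small// (leq_ltn_trans (leq_subr _ _))//.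
rewrite [RHS](reindex_inj h_inj); apply: eq_bigr => j _ /=.
by rewrite nat_periodic_mod.
Qed.

Lemma sum_period_shift (B r : nat) g : (0 < B)%N -> nat_periodic B g ->
  \sum_(0 <= j < B) g (j + r)%N = \sum_(0 <= x < B) g x.
Proof.
move=> B0 pg; rewrite -(@sum_arith_progression B 1 r g B0 (coprime1n _) pg).
by apply: eq_bigr => j _; rewrite muln1.
Qed.

Lemma sum_blocks (B Q : nat) g :
  \sum_(0 <= x < B * Q) g x = \sum_(0 <= j < B) \sum_(0 <= r < Q) g (j * Q + r)%N.
Proof.
elim: B => [|B IH]; first by rewrite mul0n !big_geq.
rewrite big_nat_recr//= -IH mulSn addnC.
rewrite (big_cat_nat (n := (B * Q)%N)) ?leq_addr//=; congr (_ + _).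
rewrite -{1}[(B * Q)%N]add0n big_addn addKn.
by apply: eq_bigr => r _; rewrite addnC.
Qed.

(** Chinese remainder theorem: residues modulo Q and modulo B are independent. *)
Lemma sum_coprime_periods (Q B : nat) f g : (0 < B)%N -> coprime Q B ->
  nat_periodic Q f -> nat_periodic B g ->
  \sum_(0 <= x < B * Q) f x * g x = (\sum_(0 <= x < Q) f x) * (\sum_(0 <= x < B) g x).
Proof.
move=> B0 cQB pf pg; rewrite sum_blocks exchange_big /= mulr_suml; apply: eq_bigr => r _.
rewrite -(sum_arith_progression r B0 cQB pg) mulr_sumr; apply: eq_bigr => j _.
by rewrite addnC nat_periodic_mul.
Qed.

(** The discrepancy between the sum up to X and X times the mean is periodic in X, hence
    bounded. *)
Lemma cvg_periodic_mean (Q : nat) f : (0 < Q)%N -> nat_periodic Q f ->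
  1 / X%:R * \sum_(1 <= x < X.+1) f x @[X --> \oo] --> (\sum_(0 <= x < Q) f x) / Q%:R.
Proof.
move=> Q0 pf; set mean := _ / _; have Q0' : (0 : R) < Q%:R by rewrite ltr0n.
pose g X := \sum_(1 <= x < X.+1) f x - X%:R * mean.
have pg : nat_periodic Q g.
  move=> X; rewrite /g -addSn (big_cat_nat (n := X.+1)) ?leq_addr//=.
  have -> : \sum_(X.+1 <= i < X.+1 + Q) f i = Q%:R * mean.
    rewrite /mean -(sum_period_shift X.+1 Q0 pf) -{1}[X.+1]add0n big_addn addKn.
    by field; rewrite gt_eqF.
  by rewrite natrD; ring.
pose K := \sum_(0 <= r < Q) `|g r|.
have gK X : `|g X| <= K.
  rewrite -(nat_periodic_mod X pg) /K big_mkord.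
  rewrite (bigD1 (Ordinal (ltn_pmod X Q0)))//= lerDl.
  by apply: sumr_ge0.
have K0 : 0 <= K by apply: sumr_ge0.
have gX : g X / X%:R @[X --> \oo] --> (0 : R).
  apply: norm_cvg0; apply: (@squeeze_cvgr _ _ _ _ (cst 0) (fun X => K * X%:R^-1)); last 2 first.
  - exact: cvg_cst.
  - rewrite -(mulr0 K); apply: cvgM; first exact: cvg_cst.
    apply/gtr0_cvgV0; last exact: cvgr_idn.
    by near=> X; rewrite ltr0n; near: X; exact: nbhs_infty_gt.
  apply: nearW => X; rewrite normr_ge0/= normrM ler_pM// ger0_norm// invr_ge0.
rewrite -[mean]add0r.
have : g X / X%:R + mean @[X --> \oo] --> 0 + mean by apply: cvgD; [exact: gX|exact: cvg_cst].
apply: cvg_trans; apply: near_eq_cvg; near=> X.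
have X0 : (0 : R) < X%:R by rewrite ltr0n; near: X; exact: nbhs_infty_gt.
by rewrite /g; field; rewrite gt_eqF.
Unshelve. all: end_near. Qed.

End periodic_means.

Section congruent_pairs.
Variable R : realType.

Lemma count_congruent (N d : nat) :
  \sum_(0 <= u < N) ((u == N %[mod d]) : nat) = (N %/ d)%N.
Proof.
rewrite divn_count_dvd big_nat_rev /= add0n.
rewrite big_add1 /=; apply: eq_big_nat => u /andP[_ uN].
by rewrite eq_sym eqn_mod_dvd ?leq_subr// subKn.
Qed.

(** Each residue class modulo d meets [0, N) in floor (N / d) points or one more. The closed
    form is checked by induction on N. *)
Lemma sum_congruent_pairs (N d : nat) : (0 < d)%N ->
  \sum_(0 <= u < N) \sum_(0 <= v < N) (u == v %[mod d])%:R =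
  N%:R ^+ 2 / d%:R + d%:R * ((N %% d)%:R / d%:R * (1 - (N %% d)%:R / d%:R)) :> R.
Proof.
move=> d0; have d0' : (0 : R) < d%:R by rewrite ltr0n.
transitivity (d%:R * (N %/ d)%:R ^+ 2 + 2 * (N %/ d)%:R * (N %% d)%:R + (N %% d)%:R : R); last first.
  have E : N%:R = (N %/ d)%:R * d%:R + (N %% d)%:R :> R by rewrite -natrM -natrD -divn_eq.
  by rewrite [in N%:R ^+ 2]E; field; rewrite gt_eqF.
elim: N => [|N IH].
  by rewrite big_geq// div0n mod0n expr0n/= !mulr0 !addr0.
rewrite big_nat_recr//= [X in _ + X]big_nat_recr//= eqxx.
under eq_bigr do rewrite big_nat_recr//=.
rewrite big_split /= IH.
have cE : \sum_(0 <= u < N) (u == N %[mod d])%:R = (N %/ d)%:R :> R.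
  by rewrite -count_congruent natr_sum.
rewrite cE; under eq_bigr do rewrite eq_sym; rewrite cE.
have rd : (N %% d < d)%N by rewrite ltn_mod.
have [rd'|rd'] := eqVneq (N %% d).+1 d.
  have qE : (N.+1 %/ d = (N %/ d).+1)%N.
    by rewrite {1}(divn_eq N d) -addnS rd' -mulSnr mulnK.
  have rE : (N.+1 %% d = 0)%N.
    by rewrite {1}(divn_eq N d) -addnS rd' -mulSnr modnMl.
  have dE : d%:R = (N %% d)%:R + 1 :> R by rewrite -{1}rd' -natr1.
  by rewrite qE rE dE -[(N %/ d).+1%:R]natr1; ring.
have rd2 : ((N %% d).+1 < d)%N by rewrite ltn_neqAle rd' rd.
have qE : (N.+1 %/ d = N %/ d)%N.
  by rewrite {1}(divn_eq N d) -addnS divnMDl// (divn_small rd2) addn0.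
have rE : (N.+1 %% d = (N %% d).+1)%N.
  by rewrite {1}(divn_eq N d) -addnS modnMDl modn_small.
by rewrite qE rE -[(N %% d).+1%:R]natr1; ring.
Qed.

End congruent_pairs.

(** * The variance for finitely many moduli *)

Section euler_operator.
Variable R : realType.
Variable b : nat -> nat.
Hypothesis b_gt1 : forall i, (1 < b i)%N.
Hypothesis b_coprime : forall i j, i != j -> coprime (b i) (b j).
Hypothesis b_neq2 : forall i, b i != 2%N.
Implicit Types (f g : R -> R) (F : nat -> R) (m N : nat).

Lemma b_ge3 i : (2 < b i)%N.
Proof. by rewrite ltn_neqAle eq_sym b_neq2 b_gt1. Qed.

Lemma bR_gt0 i : (0 : R) < (b i)%:R.
Proof. by rewrite ltr0n (ltn_trans _ (b_gt1 i)). Qed.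

Lemma bR_gt2 i : (0 : R) < (b i)%:R - 2.
Proof. by rewrite subr_gt0 ltr_nat b_ge3. Qed.

(** The sum of f (x / d) / prod_(b | d) (1 - 2 / b) over the products d of distinct
    members of b_0, ..., b_(m-1), unfolded one b at a time. *)
Fixpoint euler_op (m : nat) f (x : R) : R :=
  if m is m'.+1 then
    euler_op m' f x + (b m')%:R / ((b m')%:R - 2) * euler_op m' f (x / (b m')%:R)
  else f x.

(** The sum of F (c d) / prod_(b | d) (b - 2) over the same d. It is the arithmetic form of
    [euler_op]: F d is a count of congruences modulo d. *)
Fixpoint euler_dvd (m : nat) F (c : nat) : R :=
  if m is m'.+1 then
    euler_dvd m' F c + 1 / ((b m')%:R - 2) * euler_dvd m' F (c * b m')%N
  else F c.

(** The density of the n with n and n + 1 both free of b_0, ..., b_(m-1). *)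
Definition trunc_pair_density m : R := \prod_(0 <= i < m) (1 - 2 / (b i)%:R).
Definition trunc_rho m : R := \prod_(0 <= i < m) (1 - 1 / (b i)%:R).
Definition trunc_mu m (n : nat) : R := \prod_(0 <= i < m) (~~ (b i %| n)%N)%:R.
Definition period m : nat := \prod_(0 <= i < m) b i.

Lemma b_gt0 i : (0 < b i)%N. Proof. exact: ltn_trans (b_gt1 i). Qed.

Lemma eq_euler_dvd m F1 F2 c : (0 < c)%N -> (forall d, (0 < d)%N -> F1 d = F2 d) ->
  euler_dvd m F1 c = euler_dvd m F2 c.
Proof.
move=> + EF; elim: m c => [|m IH] c c0 /=; first exact: EF.
by rewrite !IH// muln_gt0 c0 b_gt0.
Qed.

Lemma euler_dvd_lin m (k : R) F1 F2 c :
  euler_dvd m (fun d => k * F1 d + F2 d) c = k * euler_dvd m F1 c + euler_dvd m F2 c.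
Proof. by elim: m c => [|m IH] c //=; rewrite !IH; ring. Qed.

Lemma euler_dvd_sum m (I : Type) (r : seq I) (F : I -> nat -> R) c :
  euler_dvd m (fun d => \sum_(i <- r) F i d) c = \sum_(i <- r) euler_dvd m (F i) c.
Proof.
elim: m c => [|m IH] c //=.
by rewrite !IH mulr_sumr -big_split.
Qed.

Lemma euler_dvd_op m f (x : R) c : (0 < c)%N ->
  euler_dvd m (fun d => d%:R * f (x / d%:R)) c = c%:R * euler_op m f (x / c%:R).
Proof.
elim: m c => [|m IH] c c0 //=.
rewrite !IH ?muln_gt0 ?c0 ?b_gt0// natrM.
have -> : x / (c%:R * (b m)%:R) = x / c%:R / (b m)%:R.
  by field; rewrite !gt_eqF ?bR_gt0 ?ltr0n.
by field; rewrite gt_eqF ?bR_gt2.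
Qed.

Lemma cvg_euler_dvd m (F : nat -> nat -> R) (G : nat -> R) c : (0 < c)%N ->
  (forall d, (0 < d)%N -> F M d @[M --> \oo] --> G d) ->
  euler_dvd m (F M) c @[M --> \oo] --> euler_dvd m G c.
Proof.
move=> + FG; elim: m c => [|m IH] c c0 /=; first exact: FG.
apply: cvgD; first exact: IH.
by apply: cvgM; [exact: cvg_cst|apply: IH; rewrite muln_gt0 c0 b_gt0].
Qed.

(** Local identity: (1 - 2 / b) + 1 / b^2 = (1 - 1 / b)^2. *)
Lemma trunc_pair_density_inv m c : (0 < c)%N ->
  trunc_pair_density m * euler_dvd m (fun d => d%:R^-1) c = trunc_rho m ^+ 2 / c%:R.
Proof.
elim: m c => [|m IH] c c0; first by rewrite /trunc_pair_density /trunc_rho !big_geq//= mul1r expr1n mul1r.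
rewrite /trunc_pair_density /trunc_rho !big_nat_recr//= -/(trunc_pair_density m) -/(trunc_rho m).
have -> : trunc_pair_density m * (1 - 2 / (b m)%:R) * (euler_dvd m (fun d => d%:R^-1) c +
    1 / ((b m)%:R - 2) * euler_dvd m (fun d => d%:R^-1) (c * b m)) =
  (1 - 2 / (b m)%:R) * (trunc_pair_density m * euler_dvd m (fun d => d%:R^-1) c) +
  (1 - 2 / (b m)%:R) / ((b m)%:R - 2) * (trunc_pair_density m * euler_dvd m (fun d => d%:R^-1) (c * b m)) by ring.
rewrite !IH ?muln_gt0 ?c0 ?b_gt0// natrM.
by field; rewrite !gt_eqF ?bR_gt0 ?bR_gt2 ?ltr0n.
Qed.

(** Expansion of the product over i: by the Chinese remainder theorem, congruences modulo c
    and modulo b_i merge into one modulo c b_i. *)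
Lemma trunc_correlation m u v c : (forall i, (i < m)%N -> coprime c (b i)) ->
  (\prod_(0 <= i < m) ((1 - 2 / (b i)%:R) + (u == v %[mod b i])%:R / (b i)%:R)) *
    (u == v %[mod c])%:R =
  trunc_pair_density m * euler_dvd m (fun d => (u == v %[mod d])%:R) c.
Proof.
elim: m c => [|m IH] c cc; first by rewrite /trunc_pair_density !big_geq//= !mul1r.
have cm : coprime c (b m) by exact: cc.
have cc1 i : (i < m)%N -> coprime c (b i) by move=> im; rewrite cc// ltnW.
have cc2 i : (i < m)%N -> coprime (c * b m) (b i).
  by move=> im; rewrite coprimeMl cc1//= b_coprime// gtn_eqF.
rewrite /trunc_pair_density !big_nat_recr//= -/(trunc_pair_density m).
have -> : trunc_pair_density m * (1 - 2 / (b m)%:R) * (euler_dvd m (fun d => (u == v %[mod d])%:R) c +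
    1 / ((b m)%:R - 2) * euler_dvd m (fun d => (u == v %[mod d])%:R) (c * b m)) =
  (1 - 2 / (b m)%:R) * (trunc_pair_density m * euler_dvd m (fun d => (u == v %[mod d])%:R) c) +
  (1 - 2 / (b m)%:R) / ((b m)%:R - 2) *
    (trunc_pair_density m * euler_dvd m (fun d => (u == v %[mod d])%:R) (c * b m)) by ring.
rewrite -!IH// chinese_remainder//.
case: (u == v %[mod c]); case: (u == v %[mod b m]) => /=; field; by rewrite !gt_eqF ?bR_gt0 ?bR_gt2.
Qed.

(** Two residue classes of x are removed; they coincide when u = v modulo B. *)
Lemma local_correlation (B u v : nat) : (1 < B)%N ->
  \sum_(0 <= x < B) (~~ (B %| x + u)%N)%:R * (~~ (B %| x + v)%N)%:R =
  B%:R - 2 + (u == v %[mod B])%:R :> R.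
Proof.
move=> B1; have B0 : (0 < B)%N by exact: ltnW.
have per w : nat_periodic B (fun x => (B %| x + w)%N%:R : R).
  by move=> x; rewrite addnAC dvdn_addl.
have sum1 w : \sum_(0 <= x < B) (B %| x + w)%N%:R = 1 :> R.
  have p0 : nat_periodic B (fun x => (B %| x)%N%:R : R) by move=> x; rewrite dvdn_addl.
  rewrite (sum_period_shift w B0 p0) big_ltn// dvdn0 big_nat_cond big1 ?addr0//.
  by move=> x /andP[/andP[x0 xB] _]; rewrite gtnNdvd.
transitivity (\sum_(0 <= x < B) (1 - (B %| x + u)%N%:R - (B %| x + v)%N%:R +
    (u == v %[mod B])%:R * (B %| x + u)%N%:R) : R).
  apply: eq_bigr => x _; have [xu|nxu] := boolP (B %| x + u)%N; last first.
    by case: (B %| x + v)%N => /=; ring.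
  have -> : (B %| x + v)%N = (u == v %[mod B]).
    have xu0 : (x + u = 0 %[mod B])%N by apply/eqP; rewrite eqn_mod_dvd ?subn0.
    by rewrite /dvdn -[RHS](eqn_modDl x) xu0 mod0n eq_sym.
  by case: (u == v %[mod B]) => /=; ring.
rewrite big_split /= -mulr_sumr !sumrB !sum1 sumr_const_nat subn0; ring.
Qed.

Lemma period_gt0 m : (0 < period m)%N.
Proof. by apply: prodn_gt0 => i; exact: b_gt0. Qed.

Lemma dvd_period m i : (i < m)%N -> (b i %| period m)%N.
Proof.
by move=> im; rewrite /period big_mkord (bigD1 (Ordinal im))//= dvdn_mulr.
Qed.

Lemma trunc_mu_periodic m : nat_periodic (period m) (trunc_mu m).
Proof.
move=> x; rewrite /trunc_mu; apply: eq_big_nat => i /andP[_ im].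
by rewrite dvdn_addl ?dvd_period.
Qed.

Lemma trunc_mu01 m n : trunc_mu m n = 0 \/ trunc_mu m n = 1.
Proof.
elim: m => [|m IH]; first by right; rewrite /trunc_mu big_geq.
rewrite /trunc_mu big_nat_recr//= -/(trunc_mu m n).
by case: (b m %| n)%N => /=; [left; rewrite mulr0|rewrite mulr1].
Qed.

Lemma trunc_mu_correlation m u v :
  \sum_(0 <= x < period m) trunc_mu m (x + u) * trunc_mu m (x + v) =
  (period m)%:R * \prod_(0 <= i < m) ((1 - 2 / (b i)%:R) + (u == v %[mod b i])%:R / (b i)%:R).
Proof.
elim: m => [|m IH].
  by rewrite {1}/period big_geq// big_nat1 /trunc_mu /period !big_geq// !mulr1.
rewrite {1}/period big_nat_recr//= -/(period m) [X in \sum_(0 <= _ < X) _]mulnC.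
have pm w : nat_periodic (period m) (fun x => trunc_mu m (x + w)).
  by move=> x; rewrite addnAC trunc_mu_periodic.
have pb w : nat_periodic (b m) (fun x => (~~ (b m %| x + w)%N)%:R : R).
  by move=> x; rewrite addnAC dvdn_addl.
have cop : coprime (period m) (b m).
  rewrite /period big_nat_cond; elim/big_ind: _ => [|x y cx cy|i /andP[/andP[_ im] _]].
  - exact: coprime1n.
  - by rewrite coprimeMl cx.
  - by rewrite b_coprime// ltn_eqF.
transitivity (\sum_(0 <= x < b m * period m) (trunc_mu m (x + u) * trunc_mu m (x + v)) *
    ((~~ (b m %| x + u)%N)%:R * (~~ (b m %| x + v)%N)%:R)).
  apply: eq_bigr => x _; rewrite /trunc_mu !big_nat_recr//=; ring.
rewrite (sum_coprime_periods (b_gt0 m) cop); last 2 first.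
- by move=> x; rewrite pm pm.
- by move=> x; rewrite pb pb.
rewrite IH local_correlation// /period big_nat_recr//= [X in _ = _ * X]big_nat_recr//= natrM.
by field; rewrite gt_eqF ?bR_gt0.
Qed.

Lemma trunc_mu_mean m u :
  \sum_(0 <= x < period m) trunc_mu m (x + u) = (period m)%:R * trunc_rho m.
Proof.
transitivity (\sum_(0 <= x < period m) trunc_mu m (x + u) * trunc_mu m (x + u)).
  by apply: eq_bigr => x _; have [->|->] := trunc_mu01 m (x + u); rewrite ?mulr0 ?mulr1.
rewrite trunc_mu_correlation; congr (_ * _); apply: eq_bigr => i _.
by rewrite eqxx /=; field; rewrite gt_eqF ?bR_gt0.
Qed.

Lemma sum_window x N (F : nat -> R) :
  \sum_(x <= n < x + N) F n = \sum_(0 <= u < N) F (x + u)%N.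
Proof.
by rewrite -{1}[x]add0n big_addn addKn; apply: eq_bigr => u _; rewrite addnC.
Qed.

(** The variance for b_0, ..., b_(m-1), see [cvg_trunc_var]; the product is the correlation
    of the free integers at the shifts u and v. *)
Definition trunc_var m N : R :=
  \sum_(0 <= u < N) \sum_(0 <= v < N)
     \prod_(0 <= i < m) ((1 - 2 / (b i)%:R) + (u == v %[mod b i])%:R / (b i)%:R)
  - (trunc_rho m * N%:R) ^+ 2.

Lemma cvg_trunc_var m N :
  1 / X%:R * \sum_(1 <= x < X.+1)
    (\sum_(x <= n < x + N) trunc_mu m n - trunc_rho m * N%:R) ^+ 2 @[X --> \oo]
  --> trunc_var m N.
Proof.
pose f x := (\sum_(0 <= u < N) trunc_mu m (x + u) - trunc_rho m * N%:R) ^+ 2.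
have pf : nat_periodic (period m) f.
  move=> x; rewrite /f; congr ((_ - _) ^+ 2); apply: eq_bigr => u _.
  by rewrite addnAC trunc_mu_periodic.
have Q0 : (0 : R) < (period m)%:R by rewrite ltr0n period_gt0.
have := cvg_periodic_mean (period_gt0 m) pf.
have -> : (\sum_(0 <= x < period m) f x) / (period m)%:R = trunc_var m N.
  transitivity ((\sum_(0 <= u < N) \sum_(0 <= v < N)
      \sum_(0 <= x < period m) trunc_mu m (x + u) * trunc_mu m (x + v)
     - 2 * (trunc_rho m * N%:R) * (\sum_(0 <= u < N) \sum_(0 <= x < period m) trunc_mu m (x + u))
     + (period m)%:R * (trunc_rho m * N%:R) ^+ 2) / (period m)%:R).
    congr (_ / _); rewrite [X in _ - _ * X + _]exchange_big /=.
    under [X in _ = X - _ + _]eq_bigr do rewrite exchange_big /=.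
    rewrite [X in _ = X - _ + _]exchange_big /= mulr_sumr -sumrB.
    have -> : (period m)%:R * (trunc_rho m * N%:R) ^+ 2 =
        \sum_(0 <= x < period m) (trunc_rho m * N%:R) ^+ 2.
      by rewrite sumr_const_nat subn0 mulr_natl.
    rewrite -big_split /=; apply: eq_bigr => x _.
    have -> : \sum_(0 <= u < N) \sum_(0 <= v < N) trunc_mu m (x + u) * trunc_mu m (x + v) =
        (\sum_(0 <= u < N) trunc_mu m (x + u)) ^+ 2.
      by rewrite expr2 mulr_suml; apply: eq_bigr => u _; rewrite mulr_sumr.
    by rewrite /f; ring.
  under eq_bigr do under eq_bigr do rewrite trunc_mu_correlation.
  under eq_bigr do rewrite -mulr_sumr.
  rewrite -mulr_sumr; under [X in _ - _ * X]eq_bigr do rewrite trunc_mu_mean.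
  rewrite sumr_const_nat subn0 -[X in _ - _ * X]mulr_natr /trunc_var.
  by field; rewrite gt_eqF.
apply: cvg_trans; apply: near_eq_cvg; apply: nearW => X.
by congr (_ * _); apply: eq_bigr => x _; rewrite sum_window.
Qed.

Lemma cos_natr2pi (k : nat) (y : R) : cos (y + 2 * pi * k%:R) = cos y.
Proof.
by rewrite -(periodicn (@cosD2pi R) k y) -(mulr_natr (pi *+ 2)) -(mulr_natr pi 2); congr cos; ring.
Qed.

(** [sum_congruent_pairs] splits the variance: by [trunc_pair_density_inv] the main terms
    cancel against the squared mean, and [versin_fourier] expands the rest. *)
Lemma trunc_var_fourier m N :
  \sum_(1 <= k < M) euler_op m (@versin R) (2 * pi * (k%:R * N%:R)) / (pi * k%:R) ^+ 2 @[M --> \oo]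
    --> trunc_var m N / trunc_pair_density m.
Proof.
have P0 : 0 < trunc_pair_density m.
  by apply: prodr_gt0 => i _; rewrite subr_gt0 ltr_pdivrMr ?bR_gt0// mul1r ltr_nat b_ge3.
pose G d : R := d%:R * ((N %% d)%:R / d%:R * (1 - (N %% d)%:R / d%:R)).
have GE : euler_dvd m G 1 = trunc_var m N / trunc_pair_density m.
  have E u v : \prod_(0 <= i < m) ((1 - 2 / (b i)%:R) + (u == v %[mod b i])%:R / (b i)%:R) =
      trunc_pair_density m * euler_dvd m (fun d => (u == v %[mod d])%:R) 1.
    rewrite -trunc_correlation; last by move=> i _; exact: coprime1n.
    by rewrite !modn1 eqxx mulr1.
  rewrite /trunc_var; under eq_bigr do under eq_bigr do rewrite E.
  under eq_bigr do rewrite -mulr_sumr -euler_dvd_sum.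
  rewrite -mulr_sumr -euler_dvd_sum.
  rewrite [in RHS](@eq_euler_dvd _ _ (fun d => N%:R ^+ 2 * d%:R^-1 + G d))//; last first.
    by move=> d d0; rewrite sum_congruent_pairs.
  rewrite euler_dvd_lin mulrDr mulrCA trunc_pair_density_inv// divr1.
  by field; rewrite gt_eqF.
rewrite -GE.
pose F M d : R := \sum_(1 <= k < M) (pi * k%:R) ^- 2 * (d%:R * versin (2 * pi * (k%:R * N%:R) / d%:R)).
have FG d : (0 < d)%N -> F M d @[M --> \oo] --> G d.
  move=> d0; have d0' : (0 : R) < d%:R by rewrite ltr0n.
  have := @versin_fourier R (N %% d) d (ltnW (ltn_pmod N d0)) d0 => h.
  have : d%:R * (\sum_(1 <= k < M) versin (2 * pi * (k%:R * ((N %% d)%:R / d%:R))) / (pi * k%:R) ^+ 2)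
      @[M --> \oo] --> G d by apply: cvgM; [exact: cvg_cst|exact: h].
  apply: cvg_trans; apply: near_eq_cvg; apply: nearW => M.
  rewrite /F mulr_sumr; apply: eq_bigr => k _; rewrite mulrA mulrC /versin; congr (_ * (_ * (_ - _))).
  rewrite -(cos_natr2pi (k * (N %/ d)) (2 * pi * (k%:R * ((N %% d)%:R / d%:R)))); congr cos.
  have NE : N%:R = (N %/ d)%:R * d%:R + (N %% d)%:R :> R by rewrite -natrM -natrD -divn_eq.
  by rewrite natrM [N%:R in RHS]NE; move: (pi) => P; field; rewrite gt_eqF.
have := @cvg_euler_dvd m F G 1 isT FG.
apply: cvg_trans; apply: near_eq_cvg; apply: nearW => M.
rewrite /F euler_dvd_sum; apply: eq_bigr => k _.
have := @euler_dvd_lin m ((pi * k%:R) ^- 2) (fun d => d%:R * versin (2 * pi * (k%:R * N%:R) / d%:R)) (fun=> 0) 1.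
rewrite euler_dvd_op// mul1r divr1 => h.
rewrite [RHS]mulrC.
have z : euler_dvd m (fun=> 0) 1 = 0.
  by elim: (m) (1%N) => [|m' IH] c //=; rewrite !IH mulr0 addr0.
rewrite z addr0 in h; rewrite -h; apply: eq_euler_dvd => // d _; by rewrite addr0.
Qed.

(** * From finitely many moduli to the full family *)

Hypothesis b_summable : cvg (series (fun i => 1 / (b i)%:R : R) @ \oo).

Lemma trunc_rho_itv m : 0 <= trunc_rho m <= 1.
Proof.
apply/andP; split; first by apply: prodr_ge0 => i _; rewrite subr_ge0 ler_pdivrMr ?bR_gt0// mul1r ler1n b_gt0.
apply: prodr_ile1 => i _.
have h : 1 / (b i)%:R <= 1 :> R by rewrite ler_pdivrMr ?bR_gt0// mul1r ler1n b_gt0.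
by rewrite subr_ge0 h/= lerBlDr lerDl divr_ge0.
Qed.

Lemma cvg_trunc_rho : trunc_rho m @[m --> \oo] --> rho_B R b.
Proof.
suff : cvgn trunc_rho by [].
apply: nonincreasing_is_cvgn.
  apply/nonincreasing_seqP => m; rewrite /trunc_rho big_nat_recr//= -/(trunc_rho m).
  have /andP[r0 _] := trunc_rho_itv m.
  by rewrite -[leRHS]mulr1 ler_wpM2l// lerBlDr lerDl divr_ge0.
by exists 0 => _ [m _ <-]; have /andP[] := trunc_rho_itv m.
Qed.

Lemma rho_B_itv : 0 <= rho_B R b <= 1.
Proof.
have c := cvg_trunc_rho; apply/andP; split; rewrite -(cvg_lim _ c)//.
  by apply: limr_ge; [apply/cvg_ex; eexists; exact: c|apply: nearW => m; have /andP[] := trunc_rho_itv m].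
by apply: limr_le; [apply/cvg_ex; eexists; exact: c|apply: nearW => m; have /andP[] := trunc_rho_itv m].
Qed.

Definition tail m : R := lim (series (fun i => 1 / (b i)%:R : R) @ \oo) - series (fun i => 1 / (b i)%:R) m.

Lemma cvg_tail : tail m @[m --> \oo] --> (0 : R).
Proof.
rewrite -(subrr (lim (series (fun i => 1 / (b i)%:R : R) @ \oo))).
by apply: cvgB; [exact: cvg_cst|exact: b_summable].
Qed.

Lemma nd_series_b : nondecreasing_seq (series (fun i => 1 / (b i)%:R : R)).
Proof. by apply: nondecreasing_series => i _ _; rewrite divr_ge0. Qed.

Lemma tail_ge0 m : 0 <= tail m.
Proof. by rewrite subr_ge0; apply: nondecreasing_cvgn_le; [exact: nd_series_b|exact: b_summable]. Qed.

Lemma sum_le_tail m I : \sum_(m <= i < I) 1 / (b i)%:R <= tail m.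
Proof.
have [Im|mI] := leqP I m; first by rewrite big_geq// tail_ge0.
rewrite lerBrDr; have -> : \sum_(m <= i < I) 1 / (b i)%:R + series (fun i => 1 / (b i)%:R : R) m =
    series (fun i => 1 / (b i)%:R : R) I.
  by rewrite /series /= addrC -big_cat_nat//= ltnW.
by apply: nondecreasing_cvgn_le; [exact: nd_series_b|exact: b_summable].
Qed.

Lemma b_large (Y : nat) : exists I, forall i, (I <= i)%N -> (Y < b i)%N.
Proof.
have Y0 : (0 : R) < Y.+1%:R^-1 by rewrite invr_gt0.
have /cvgr0Pnorm_lt /(_ _ Y0) [I _ HI] := cvg_series_cvg_0 b_summable.
exists I => i /HI; rewrite ger0_norm ?divr_ge0// div1r.
by rewrite ltf_pV2 ?posrE ?bR_gt0// ltr_nat => /ltnW.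
Qed.

Lemma trunc_mu_free m n : (forall i, (i < m)%N -> ~~ (b i %| n)%N) -> trunc_mu m n = 1.
Proof.
by move=> H; rewrite /trunc_mu big_nat_cond big1// => i /andP[/andP[_ im] _]; rewrite H.
Qed.

Lemma trunc_mu_dvd m n i : (i < m)%N -> (b i %| n)%N -> trunc_mu m n = 0.
Proof. by move=> im bn; rewrite /trunc_mu big_mkord (bigD1 (Ordinal im))//= bn mul0r. Qed.

(** An n that passes the test up to m but is not B-free is divisible by some b_i with i >= m,
    and b_i <= n <= Y forces i < I. *)
Lemma trunc_mu_error m I Y n : (forall i, (I <= i)%N -> (Y < b i)%N) -> (0 < n <= Y)%N ->
  `|mu_B R b n - trunc_mu m n| <= \sum_(m <= i < I) (b i %| n)%N%:R.
Proof.
move=> HI /andP[n0 nY]; have s0 : 0 <= \sum_(m <= i < I) (b i %| n)%N%:R :> R by apply: sumr_ge0.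
rewrite /mu_B; case: asboolP => [fr|nfr].
  by rewrite trunc_mu_free ?subrr ?normr0// => i _; exact: fr.
have [i /negP] : exists i, ~ ~~ (b i %| n)%N by apply/existsNP.
rewrite negbK => bin.
have [im|mi] := ltnP i m; first by rewrite (trunc_mu_dvd im bin) subrr normr0.
have iI : (i < I)%N.
  rewrite ltnNge; apply/negP => /HI; rewrite ltnNge => /negP; apply.
  by rewrite (leq_trans (dvdn_leq n0 bin)).
apply: (@le_trans _ _ 1).
  by rewrite sub0r normrN; have [->|->] := trunc_mu01 m n; rewrite ?normr0 ?normr1.
rewrite (big_cat_nat (n := i)) ?(ltnW iI)//= (big_ltn iI) bin.
by rewrite addrCA lerDl addr_ge0// sumr_ge0.
Qed.

Lemma sum_trunc_mu_error m Y :
  \sum_(1 <= n < Y.+1) `|mu_B R b n - trunc_mu m n| <= Y%:R * tail m.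
Proof.
have [I HI] := b_large Y.
apply: (@le_trans _ _ (\sum_(1 <= n < Y.+1) \sum_(m <= i < I) (b i %| n)%N%:R)).
  rewrite big_nat_cond [leRHS]big_nat_cond; apply: ler_sum => n /andP[/andP[n0 nY] _].
  by apply: (@trunc_mu_error _ _ Y) => //; rewrite n0.
rewrite exchange_big /=.
apply: (@le_trans _ _ (\sum_(m <= i < I) Y%:R * (1 / (b i)%:R))); last first.
  by rewrite -mulr_sumr ler_wpM2l// sum_le_tail.
apply: ler_sum => i _; rewrite -natr_sum -divn_count_dvd mul1r ler_pdivlMr ?bR_gt0//.
by rewrite -natrM ler_nat leq_divM.
Qed.

(** The mean of the error over x <= X is at most err m for all X > 0, so the limits in X
    and in m can be exchanged. *)
Lemma Var_B_cvg N (s : R) : trunc_var m N @[m --> \oo] --> s -> Var_B R b N = s.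
Proof.
move=> vs; apply/cvg_lim => //.
have /andP[rho0 rho1] := rho_B_itv.
have mu01 n : 0 <= mu_B R b n <= 1 by rewrite /mu_B ler0n/= lern1 leq_b1.
have tmu01 m n : 0 <= trunc_mu m n <= 1 by have [->|->] := trunc_mu01 m n; rewrite ?ler01 ?lexx.
have dev_le (F : nat -> R) (r : R) x : (forall n, 0 <= F n <= 1) -> 0 <= r <= 1 ->
    `|\sum_(x <= n < x + N) F n - r * N%:R| <= N%:R.
  move=> F01 /andP[r0 r1].
  have h0 : 0 <= \sum_(x <= n < x + N) F n.
    by apply: sumr_ge0 => n _; have /andP[] := F01 n.
  have h1 : \sum_(x <= n < x + N) F n <= N%:R.
    have -> : N%:R = \sum_(x <= n < x + N) (1 : R) by rewrite sumr_const_nat addKn.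
    by apply: ler_sum => n _; have /andP[] := F01 n.
  have h2 : 0 <= r * N%:R <= N%:R by rewrite mulr_ge0//= ler_piMl.
  by rewrite ler_norml; move/andP: h2 => [h2 h3]; apply/andP; split; lra.
pose err m : R := 2 * N%:R * (N%:R * (1 + N%:R) * tail m + N%:R * `|rho_B R b - trunc_rho m|).
have err0 : err m @[m --> \oo] --> (0 : R).
  have -> : (0 : R) = 2 * N%:R * (N%:R * (1 + N%:R) * 0 + N%:R * `|rho_B R b - rho_B R b|).
    by rewrite subrr normr0; ring.
  apply: cvgM; first exact: cvg_cst.
  apply: cvgD; apply: cvgM; [exact: cvg_cst|exact: cvg_tail|exact: cvg_cst|].
  by apply: cvg_norm; apply: cvgB; [exact: cvg_cst|exact: cvg_trunc_rho].
apply: cvg_approx => e e0.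
near \oo => m.
exists (fun X => 1 / X%:R * \sum_(1 <= x < X.+1)
    (\sum_(x <= n < x + N) trunc_mu m n - trunc_rho m * N%:R) ^+ 2), (trunc_var m N).
split; last 2 first.
- exact: cvg_trunc_var.
- by rewrite distrC; near: m; move/cvgrPdist_le : vs; exact.
near=> X.
have X0 : (0 < X)%N by near: X; exact: nbhs_infty_gt.
have X0' : (0 : R) < X%:R by rewrite ltr0n.
apply: (@le_trans _ _ (err m)); last first.
  by near: m; move/cvgr0Pnorm_le : err0 => /(_ _ e0); apply: filterS => m; exact: le_trans (ler_norm _).
rewrite -mulrBr -sumrB normrM ger0_norm ?divr_ge0// div1r ler_pdivrMl//.
apply: (le_trans (ler_norm_sum _ _ _)).
pose D n := `|mu_B R b n - trunc_mu m n|.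
apply: (@le_trans _ _ (\sum_(1 <= x < X.+1)
    (2 * N%:R * (\sum_(0 <= u < N) D (x + u)%N + N%:R * `|rho_B R b - trunc_rho m|)))).
  apply: ler_sum => x _; rewrite subr_sqr normrM mulrC; apply: ler_pM => //.
    apply: (le_trans (ler_normD _ _)); rewrite mulrDl mul1r lerD// dev_le// ?rho0//.
    exact: trunc_rho_itv.
  have -> : \sum_(x <= n < x + N) mu_B R b n - rho_B R b * N%:R -
      (\sum_(x <= n < x + N) trunc_mu m n - trunc_rho m * N%:R) =
      \sum_(x <= n < x + N) (mu_B R b n - trunc_mu m n) - N%:R * (rho_B R b - trunc_rho m).
    by rewrite sumrB; ring.
  apply: (le_trans (ler_normB _ _)); rewrite [X in _ + X <= _]normrM normr_nat lerD2r.
  rewrite sum_window; exact: ler_norm_sum.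
rewrite -mulr_sumr big_split /= sumr_const_nat subSS subn0 -[_ *+ X]mulr_natr exchange_big /=.
rewrite /err mulrCA ler_wpM2l ?mulr_ge0//.
rewrite mulrDr [X in _ <= _ + X]mulrC lerD2r.
have -> : X%:R * (N%:R * (1 + N%:R) * tail m) = N%:R * (X%:R * (1 + N%:R) * tail m) by ring.
apply: (@le_trans _ _ (\sum_(0 <= u < N) X%:R * (1 + N%:R) * tail m)); last first.
  by rewrite sumr_const_nat subn0 -[leLHS]mulr_natl.
rewrite big_nat_cond [leRHS]big_nat_cond; apply: ler_sum => u /andP[/andP[_ uN] _].
apply: (@le_trans _ _ ((X + N)%:R * tail m)); last first.
  rewrite ler_wpM2r ?tail_ge0// natrD mulrDr mulr1 lerD2l ler_peMl// ler1n.
  exact: X0.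
apply: le_trans (sum_trunc_mu_error m (X + N)).
apply: (@le_trans _ _ (\sum_(1 + u <= n < X.+1 + u) D n)).
  by rewrite big_addn addnK.
rewrite [leRHS](big_cat_nat (n := (1 + u)%N))//=; last first.
  by rewrite add1n ltnS (leq_trans (ltnW uN))// leq_addl.
rewrite [X in _ <= _ + X](big_cat_nat (n := (X.+1 + u)%N))//=; last 2 first.
- by rewrite leq_add2r.
- by rewrite addSn ltnS leq_add2l ltnW.
by rewrite addrCA lerDl addr_ge0// sumr_ge0// => n _; exact: normr_ge0.
Unshelve. all: end_near. Qed.

End euler_operator.

(** * Infinite products *)

Section infinite_products.
Variable R : realType.

(** The rate depends on F only through the majorant v: this gives uniformity when F has
    a parameter. *)
Lemma cvg_summable_increments (F v : nat -> R) (L : R) :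
  (forall m, `|F m.+1 - F m| <= v m) ->
  (forall n, \sum_(0 <= i < n) v i <= L) ->
  cvgn (series v) /\
  exists2 l : R, F m @[m --> \oo] --> l &
    forall m, `|l - F m| <= lim (series v @ \oo) - series v m.
Proof.
move=> Fv vL; have v0 m : 0 <= v m := le_trans (normr_ge0 _) (Fv m).
have ndv : nondecreasing_seq (series v) by apply: nondecreasing_series => i _ _.
have cv : cvgn (series v).
  by apply: nondecreasing_is_cvgn => //; exists L => _ [n _ <-]; exact: vL.
split => //.
have FFm m n : (m <= n)%N -> `|F n - F m| <= series v n - series v m.
  move=> /subnK <-; elim: (n - m)%N => [|k IH]; first by rewrite add0n !subrr normr0.
  have -> : F (k.+1 + m)%N - F m = (F (k + m).+1 - F (k + m)%N) + (F (k + m)%N - F m) by rewrite addSn; ring.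
  apply: (le_trans (ler_normD _ _)).
  have -> : series v (k.+1 + m)%N - series v m = v (k + m)%N + (series v (k + m)%N - series v m).
    by rewrite addSn /series /= big_nat_recr//=; ring.
  exact: lerD.
have /cvg_ex[l Fl] : cvgn F.
  have h : cvgn (series (fun m => F m.+1 - F m)).
    by apply: normed_cvg; apply: (series_le_cvg _ v0 Fv cv) => n; exact: normr_ge0.
  move: h => /cvg_ex[l hl]; apply/cvg_ex; exists (l + F 0%N).
  have : series (fun m => F m.+1 - F m) n + F 0%N @[n --> \oo] --> l + F 0%N.
    by apply: cvgD; [exact: hl|exact: cvg_cst].
  apply: cvg_trans; apply: near_eq_cvg; apply: nearW => n.
  by rewrite /series /= telescope_sumr// subrK.
exists l => // m.
have nl : `|F n - F m| @[n --> \oo] --> `|l - F m|.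
  by apply: cvg_norm; apply: cvgB; [exact: Fl|exact: cvg_cst].
rewrite -(cvg_lim _ nl)//; apply: limr_le; first by apply/cvg_ex; eexists; exact: nl.
near=> n; have mn : (m <= n)%N by near: n; exact: nbhs_infty_ge.
by apply: (le_trans (FFm _ _ mn)); rewrite lerD2r; exact: nondecreasing_cvgn_le.
Unshelve. all: end_near. Qed.

Lemma prod1D_le (v : nat -> R) (L : R) n : (forall i, 0 <= v i) ->
  (forall n, \sum_(0 <= i < n) v i <= L) ->
  \prod_(0 <= i < n) (1 + v i) <= expR L.
Proof.
move=> v0 vL; apply: (@le_trans _ _ (expR (\sum_(0 <= i < n) v i))); last by rewrite ler_expR.
rewrite expR_sum; apply: ler_prod => i _.
by rewrite addr_ge0//= expR_ge1Dx.
Qed.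

Lemma cvg_prod1D (a v : nat -> R) (L : R) :
  (forall i, `|a i| <= v i) -> (forall n, \sum_(0 <= i < n) v i <= L) ->
  exists l : R, \prod_(0 <= i < n) (1 + a i) @[n --> \oo] --> l.
Proof.
move=> av vL; have v0 m : 0 <= v m := le_trans (normr_ge0 _) (av m).
have pL n : `|\prod_(0 <= i < n) (1 + a i)| <= expR L.
  rewrite normr_prod; apply: le_trans (prod1D_le n v0 vL); apply: ler_prod => i _.
  by rewrite normr_ge0/= (le_trans (ler_normD _ _))// normr1 lerD2l.
have h1 m : `|\prod_(0 <= i < m.+1) (1 + a i) - \prod_(0 <= i < m) (1 + a i)| <= expR L * v m.
  rewrite big_nat_recr//=.
  have -> : \prod_(0 <= i < m) (1 + a i) * (1 + a m) - \prod_(0 <= i < m) (1 + a i) =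
     \prod_(0 <= i < m) (1 + a i) * a m by ring.
  by rewrite normrM ler_pM.
have h2 n : \sum_(0 <= i < n) expR L * v i <= expR L * L.
  by rewrite -mulr_sumr ler_wpM2l ?expR_ge0.
have [_ [l hl _]] := cvg_summable_increments h1 h2.
by exists l.
Qed.

(** The inverses 1 - a / (1 + a) of the factors form a product of the same kind, so the
    limit is not 0. *)
Lemma cvg_prod1D_gt0 (a v : nat -> R) (L : R) :
  (forall i, `|a i| <= v i) -> (forall n, \sum_(0 <= i < n) v i <= L) ->
  (forall i, 0 < 1 + a i) ->
  exists2 l : R, 0 < l & \prod_(0 <= i < n) (1 + a i) @[n --> \oo] --> l.
Proof.
move=> av vL a1; have [l hl] := cvg_prod1D av vL; exists l => //.
have v0 m : 0 <= v m := le_trans (normr_ge0 _) (av m).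
pose c i := - (a i / (1 + a i)).
have cE i : 1 + c i = (1 + a i)^-1 by rewrite /c; field; rewrite gt_eqF.
have cv : cvgn (series v).
  apply: nondecreasing_is_cvgn; first by apply: nondecreasing_series => i _ _.
  by exists L => _ [n _ <-]; exact: vL.
have h2 : (0 : R) < 2^-1 by rewrite invr_gt0.
have /cvgr0Pnorm_lt /(_ _ h2) [I _ HI] := cvg_series_cvg_0 cv.
pose w i := if (i < I)%N then `|c i| else 2 * v i.
have cw i : `|c i| <= w i.
  rewrite /w; case: ltnP => // /HI; rewrite ger0_norm// => vi.
  have ai := av i; have := ler_norm (- a i); rewrite normrN => ai2.
  have p : 2^-1 <= 1 + a i by lra.
  rewrite /c normrN normrM [`|(_)^-1|]gtr0_norm ?invr_gt0// ler_pdivrMr//.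
  apply: (le_trans ai); have := v0 i; nra.
have w0 i : 0 <= w i := le_trans (normr_ge0 _) (cw i).
have wL n : \sum_(0 <= i < n) w i <= \sum_(0 <= i < I) `|c i| + 2 * L.
  apply: (@le_trans _ _ (\sum_(0 <= i < n) ((if (i < I)%N then `|c i| else 0) + 2 * v i))).
    by apply: ler_sum => i _; rewrite /w; case: ifP => _; rewrite ?add0r ?lerDl ?mulr_ge0.
  rewrite big_split /= -mulr_sumr; apply: lerD; last by rewrite ler_pM2l.
  rewrite -big_mkcond /=.
  have [nI|In] := leqP n I.
    rewrite (eq_big_nat _ _ (F2 := fun i => `|c i|)) ?[leRHS](big_cat_nat (n := n))//=.
    rewrite -[leLHS]addr0; apply: lerD; last exact: sumr_ge0.
    by rewrite [leRHS]big_mkcond [leLHS]big_mkcond; apply: ler_sum => i _; case: ifP.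
  rewrite (big_cat_nat (n := I)) ?(ltnW In)//= [X in _ + X]big1_seq ?addr0.
    by rewrite [leRHS]big_mkcond [leLHS]big_mkcond; apply: ler_sum => i _; case: ifP.
  by move=> i /andP[iI]; rewrite mem_index_iota leqNgt iI.
have [l' hl'] := cvg_prod1D cw wL.
have l1 : l * l' = 1.
  have : \prod_(0 <= i < n) (1 + a i) * \prod_(0 <= i < n) (1 + c i) @[n --> \oo] --> l * l'.
    by apply: cvgM; [exact: hl|exact: hl'].
  have -> : (fun n => \prod_(0 <= i < n) (1 + a i) * \prod_(0 <= i < n) (1 + c i)) = (fun=> 1).
    by apply/funext => n; rewrite -big_split /= big1// => i _; rewrite cE divff// gt_eqF.
  by move=> /cvg_lim <-//; rewrite lim_cst.
have l0 : 0 <= l.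
  rewrite -(cvg_lim _ hl)//; apply: limr_ge; first by apply/cvg_ex; eexists; exact: hl.
  by apply: nearW => n; apply: prodr_ge0 => i _; rewrite ltW.
rewrite lt_neqAle l0 andbT eq_sym; apply/eqP => l00.
by move/eqP: l1; rewrite l00 mul0r eq_sym oner_eq0.
Qed.

End infinite_products.

(** * The semigroup of B-integers *)

Section B_integers.
Variable b : nat -> nat.
Hypothesis b_gt1 : forall i, (1 < b i)%N.
Hypothesis b_coprime : forall i j, i != j -> coprime (b i) (b j).

Lemma B_integer_gt0 n : B_integer b n -> (0 < n)%N.
Proof.
elim=> [//|i|m k _ m0 _ k0]; first exact: ltnW.
by rewrite muln_gt0 m0.
Qed.

Lemma b_inj : injective b.
Proof.
move=> i j bij; apply/eqP/negPn/negP => /b_coprime.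
by rewrite bij /coprime gcdnn => /eqP b1; have := b_gt1 j; rewrite b1.
Qed.

(** Although b_i need not be prime, a product of members of the family either contains
    b_i as a factor or is coprime to it. *)
Lemma B_integer_coprime_or_div n i : B_integer b n ->
  coprime n (b i) \/ exists2 m, B_integer b m & n = (m * b i)%N.
Proof.
elim=> [|j|m k Bm [cm|[m' Bm' ->]] Bk [ck|[k' Bk' ->]]].
- by left; exact: coprime1n.
- have [<-|ij] := eqVneq j i; last by left; exact: b_coprime.
  by right; exists 1%N; [exact: B_integer_one|rewrite mul1n].
- by left; rewrite coprimeMl cm.
- by right; exists (m * k')%N; [exact: B_integer_mul|rewrite mulnA].
- by right; exists (m' * k)%N; [exact: B_integer_mul|rewrite mulnAC].
- right; exists (m' * b i * k')%N; last by rewrite mulnA.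
  by apply: B_integer_mul => //; apply: B_integer_mul => //; exact: B_integer_gen.
Qed.

Lemma B_integer_mulb n i : B_integer b (n * b i)%N <-> B_integer b n.
Proof.
split=> [Bn|Bn]; last by apply: B_integer_mul => //; exact: B_integer_gen.
have [c|[m Bm /eqP]] := B_integer_coprime_or_div i Bn.
  move: c; rewrite coprimeMl /coprime gcdnn => /andP[_ /eqP b1].
  by have := b_gt1 i; rewrite b1.
by rewrite eqn_pmul2r ?(ltnW (b_gt1 i))// => /eqP ->.
Qed.

Lemma B_integer_dvd n : B_integer b n -> n = 1%N \/ exists i, (b i %| n)%N.
Proof.
elim=> [|i|m k _ [->|[i bi]] _ [->|[j bj]]]; try by left.
- by right; exists i; exact: dvdnn.
- by right; exists j; rewrite mul1n.
- by right; exists i; rewrite muln1.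
- by right; exists i; rewrite dvdn_mulr.
Qed.

End B_integers.

(** * The Euler product of dilations and the sum over B-integers *)

Section euler_op_theory.
Variable R : realType.
Variable b : nat -> nat.
Hypothesis b_gt1 : forall i, (1 < b i)%N.
Hypothesis b_neq2 : forall i, b i != 2%N.
Implicit Types (f g : R -> R) (x c : R).

Let G_ge0 m : 0 <= (b m)%:R / ((b m)%:R - 2) :> R.
Proof. by rewrite divr_ge0// ltW// bR_gt2. Qed.

Lemma euler_opB m f g x :
  euler_op b m (fun x => f x - g x) x = euler_op b m f x - euler_op b m g x.
Proof. by elim: m x => [|m IH] x //=; rewrite !IH; ring. Qed.

Lemma euler_op_scale m f c x :
  euler_op b m (fun x => f (x / c)) x = euler_op b m f (x / c).
Proof. by elim: m x => [|m IH] x //=; rewrite !IH [x / c / _]mulrAC. Qed.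

Lemma eq_euler_op m f g x : 0 < x -> (forall y, 0 < y -> f y = g y) ->
  euler_op b m f x = euler_op b m g x.
Proof.
move=> + fg; elim: m x => [|m IH] x x0 /=; first exact: fg.
by rewrite !IH// divr_gt0// bR_gt0.
Qed.

Lemma euler_op_ge0 m f x : 0 < x -> (forall y, 0 < y -> 0 <= f y) -> 0 <= euler_op b m f x.
Proof.
move=> + f0; elim: m x => [|m IH] x x0 /=; first exact: f0.
apply: addr_ge0; first exact: IH.
by apply: mulr_ge0 => //; apply: IH; rewrite divr_gt0// bR_gt0.
Qed.

Lemma norm_euler_op_le m f g x : 0 < x -> (forall y, 0 < y -> `|f y| <= g y) ->
  `|euler_op b m f x| <= euler_op b m g x.
Proof.
move=> + fg; elim: m x => [|m IH] x x0 /=; first exact: fg.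
have xb : 0 < x / (b m)%:R by rewrite divr_gt0// bR_gt0.
apply: (le_trans (ler_normD _ _)); apply: lerD; first exact: IH.
by rewrite normrM ger0_norm// ler_wpM2l// IH.
Qed.

Lemma euler_op_id m c x :
  euler_op b m (fun x => c * x) x = c * x * \prod_(0 <= i < m) (1 + 1 / ((b i)%:R - 2)).
Proof.
elim: m x => [|m IH] x /=; first by rewrite big_geq// mulr1.
rewrite !IH big_nat_recr//=.
by field; rewrite !gt_eqF ?bR_gt0 ?bR_gt2.
Qed.

Lemma inv_b_sub2_le i : 1 / ((b i)%:R - 2) <= 3 * (1 / (b i)%:R) :> R.
Proof.
have b3 : (3 : R) <= (b i)%:R by rewrite ler_nat b_ge3.
rewrite ler_pdivrMr ?bR_gt2// !mulrA mulr1 mulrAC ler_pdivlMr ?bR_gt0//; lra.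
Qed.

End euler_op_theory.

Section B_sums.
Variable R : realType.
Variables (b : nat -> nat) (A alpha C : R).
Hypothesis b_gt1 : forall i, (1 < b i)%N.
Hypothesis b_coprime : forall i j, i != j -> coprime (b i) (b j).
Hypothesis b_neq2 : forall i, b i != 2%N.
Hypothesis b_summable : cvg (series (fun i => 1 / (b i)%:R : R) @ \oo).
Hypothesis alpha_gt0 : 0 < alpha.
Hypothesis alpha_lt1 : alpha < 1.

Definition B_indic (n : nat) : R := `[< B_integer b n >]%:R.

Hypothesis C_ge0 : 0 <= C.
Hypothesis S_le : forall y : R, 0 < y -> partial_sum B_indic y <= C * y `^ alpha.
Hypothesis S_cvg : partial_sum B_indic y / y `^ alpha @[y --> +oo] --> A.

Definition rough_indic (m n : nat) : R := B_indic n * trunc_mu R b m n.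

Lemma B_indic_ge0 n : 0 <= B_indic n. Proof. by []. Qed.

Lemma rough_indic_ge0 m n : 0 <= rough_indic m n.
Proof. by rewrite mulr_ge0//; have [->|->] := trunc_mu01 R b m n. Qed.

Lemma rough_indic_le m n : rough_indic m n <= B_indic n.
Proof. by rewrite -[leRHS]mulr1 ler_wpM2l//; have [->|->] := trunc_mu01 R b m n. Qed.

Lemma rough_partial_sum_le m (y : R) : 0 < y -> partial_sum (rough_indic m) y <= C * y `^ alpha.
Proof.
move=> y0; apply: le_trans (S_le y0); apply: ler_sum => n _; exact: rough_indic_le.
Qed.

Lemma rough_indic_0 : rough_indic 0 = B_indic.
Proof. by apply/funext => n; rewrite /rough_indic /trunc_mu big_geq// mulr1. Qed.

Lemma rough_indicS m n : rough_indic m.+1 n = rough_indic m n - (b m %| n)%N%:R * rough_indic m n.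
Proof.
rewrite /rough_indic /trunc_mu big_nat_recr//=.
by case: (b m %| n)%N => /=; ring.
Qed.

Lemma rough_indic_mulb m n : rough_indic m (n * b m) = rough_indic m n.
Proof.
rewrite /rough_indic /B_indic; congr (_%:R * _).
  by congr nat_of_bool; apply/asbool_equiv_eq; exact: B_integer_mulb.
rewrite /trunc_mu; apply: eq_big_nat => i /andP[_ im].
by rewrite Gauss_dvdl// b_coprime// ltn_eqF.
Qed.

Lemma B_indic0 : B_indic 0 = 0.
Proof.
rewrite /B_indic; case: asboolP => // h.
by have := B_integer_gt0 b_gt1 h.
Qed.

Lemma rough_indic0 m : rough_indic m 0 = 0. Proof. by rewrite /rough_indic B_indic0 mul0r. Qed.

Lemma sum_multiples (B M : nat) (F : nat -> R) : (0 < B)%N ->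
  \sum_(0 <= n < M * B) (B %| n)%N%:R * F n = \sum_(0 <= k < M) F (k * B)%N.
Proof.
move=> B0; rewrite sum_blocks; apply: eq_bigr => j _.
rewrite big_ltn// addn0 dvdn_mull// mul1r big_nat_cond big1 ?addr0// => r /andP[/andP[r0 rB] _].
by rewrite dvdn_addr ?dvdn_mull// gtnNdvd// mul0r.
Qed.

(** The sum over the B-integers not divisible by b_0, ..., b_(m-1), that is the result of
    applying prod_(i < m) (1 - T_i), T_i f x = f (x / b_i), to the sum over all of them. *)
Definition rough_sum m (x : R) : R := dirichlet_sum (rough_indic m) (@versin R) x.

Local Notation C1 := (dirichlet_const alpha C).

Lemma rough_sum_cvg m (x : R) : 0 < x ->
  \sum_(1 <= n < M) rough_indic m n * versin (x / n%:R) @[M --> \oo] --> rough_sum m x /\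
  `|rough_sum m x| <= 4 * C1 * x `^ alpha.
Proof.
move=> x0; have := dirichlet_sum_cvg (rough_indic_ge0 m) alpha_lt1 (@rough_partial_sum_le m) x0 ltr01 (@versin_le R).
by rewrite mulr1.
Qed.

(** The B-integers n that are multiples of b_m are the n = b_m k with k a B-integer, which
    contribute the same sum at x / b_m. *)
Lemma rough_sumS m (x : R) : 0 < x -> rough_sum m.+1 x = rough_sum m x - rough_sum m (x / (b m)%:R).
Proof.
move=> x0; have B0 : (0 < b m)%N := ltnW (b_gt1 m).
have xb0 : 0 < x / (b m)%:R by rewrite divr_gt0// ltr0n.
have [cS _] := rough_sum_cvg m.+1 x0; have [c _] := rough_sum_cvg m x0; have [cb _] := rough_sum_cvg m xb0.
pose k (M : nat) := (M.+1 * b m)%N.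
have k_oo : k M @[M --> \oo] --> \oo.
  apply/cvgnyPge => Y; near=> M; rewrite /k.
  apply: (@leq_trans M.+1); last by rewrite leq_pmulr.
  by apply: leqW; near: M; exact: nbhs_infty_ge.
have cS' := cvg_comp _ _ k_oo cS; have c' := cvg_comp _ _ k_oo c.
have cb' : \sum_(1 <= n < M.+1) rough_indic m n * versin (x / (b m)%:R / n%:R) @[M --> \oo] --> rough_sum m (x / (b m)%:R).
  by rewrite (cvg_shiftS (fun M => \sum_(1 <= n < M) rough_indic m n * versin (x / (b m)%:R / n%:R))).
have sum0 (F : nat -> R) (n : nat) : F 0%N = 0 -> (0 < n)%N -> \sum_(1 <= i < n) F i = \sum_(0 <= i < n) F i.
  by move=> F0 n0; rewrite [RHS]big_ltn// F0 add0r.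
have E M : \sum_(1 <= n < k M) rough_indic m.+1 n * versin (x / n%:R) =
    \sum_(1 <= n < k M) rough_indic m n * versin (x / n%:R) -
    \sum_(1 <= n < M.+1) rough_indic m n * versin (x / (b m)%:R / n%:R).
  have k0 : (0 < k M)%N by rewrite muln_gt0.
  rewrite !sum0// ?rough_indic0 ?mul0r//.
  under [LHS]eq_bigr do rewrite rough_indicS mulrBl.
  rewrite sumrB; congr (_ - _).
  under [LHS]eq_bigr do rewrite -mulrA.
  rewrite sum_multiples//; apply: eq_bigr => n _; rewrite rough_indic_mulb; congr (_ * versin _).
  have [->|n0] := posnP n; first by rewrite mul0n !invr0 !mulr0.
  by rewrite natrM; field; rewrite !pnatr_eq0 -!lt0n n0.
have c2 : \sum_(1 <= n < k M) rough_indic m.+1 n * versin (x / n%:R) @[M --> \oo] --> rough_sum m x - rough_sum m (x / (b m)%:R).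
  by under eq_fun do rewrite E; apply: cvgB; [exact: c'|exact: cb'].
exact: (cvg_unique _ cS' c2).
Unshelve. all: end_near. Qed.

Lemma versin_le_id (t : R) : 0 <= t -> `|versin t| <= t.
Proof.
move=> t0; have := cos_lipschitz 0 t; rewrite cos0 sub0r normrN (ger0_norm t0).
by [].
Qed.

(** A consequence of the Abelian bound at x = 1, as 1 / n <= 2 (1 - exp (- 1 / n)). *)
Lemma B_integers_harmonic : exists2 L : R, 0 <= L & forall M, \sum_(1 <= n < M) B_indic n / n%:R <= L.
Proof.
have [cE _] := dirichlet_sum_onem_expN B_indic_ge0 alpha_lt1 S_le ltr01.
exists (2 * lim (\sum_(1 <= n < M) B_indic n * onem_expN (1 / n%:R : R) @[M --> \oo])).
  rewrite mulr_ge0//; apply: limr_ge => //; apply: nearW => M; apply: sumr_ge0 => n _.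
  by rewrite mulr_ge0// onem_expN_ge0// divr_ge0.
move=> M; apply: (@le_trans _ _ (2 * \sum_(1 <= n < M) B_indic n * onem_expN (1 / n%:R))).
  rewrite mulr_sumr big_nat_cond [leRHS]big_nat_cond; apply: ler_sum => n /andP[/andP[n1 _] _].
  rewrite mulrCA ler_wpM2l//.
  have n0 : (0 : R) < n%:R by rewrite ltr0n.
  have h : 0 <= 1 / n%:R :> R by rewrite divr_ge0.
  apply: le_trans (min_le_onem_expN h).
  by rewrite le_min div1r lexx andbT invf_le1// ler1n n1.
rewrite ler_pM2l//; apply: nondecreasing_cvgn_le => //.
apply: nondecreasing_sum_nat1 => n.
by rewrite mulr_ge0// onem_expN_ge0// divr_ge0.
Qed.

(** For large m the B-integers that remain, other than 1, exceed any Y, so the rest is at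
    most x times a tail of the sum of the 1 / n. *)
Lemma rough_sum_versin (e : R) : 0 < e -> \forall m \near \oo, forall x : R, 0 < x ->
  `|rough_sum m x - versin x| <= e * x.
Proof.
move=> e0; have [L L0 HL] := B_integers_harmonic.
pose v (n : nat) : R := B_indic n / n%:R.
have v0 n : 0 <= v n by rewrite divr_ge0.
have vv n : (0 < n)%N -> `|v n| <= v n by move=> _; rewrite ger0_norm.
have [lv cv _] := dominated_series_cvg vv HL.
have [Y HY] : exists Y, `|lv - \sum_(1 <= n < Y.+1) v n| <= e.
  move/cvgrPdist_le : cv => /(_ _ e0) [Y _ HY]; exists Y; apply: HY => /=; exact: leqnSn.
have [I HI] := b_large b_gt1 b_summable Y.
exists I => // m /= Im x x0.
have zt1 : rough_indic m 1 = 1.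
  rewrite /rough_indic /B_indic asboolT; last exact: B_integer_one.
  rewrite mul1r trunc_mu_free// => i _; rewrite dvdn1; apply/eqP => b1.
  by have := b_gt1 i; rewrite b1.
have ztY n : (1 < n <= Y)%N -> rough_indic m n = 0.
  move=> /andP[n1 nY]; rewrite /rough_indic /B_indic; case: asboolP => [Bn|_]; last by rewrite mul0r.
  have [n1'|[i bin]] := B_integer_dvd Bn; first by rewrite n1' in n1.
  rewrite (@trunc_mu_dvd R b m n i) ?mulr0//; rewrite ltnNge; apply/negP => mi.
  have := HI _ (leq_trans Im mi); rewrite ltnNge => /negP; apply.
  by apply: leq_trans nY; apply: dvdn_leq => //; exact: ltnW.
have [c _] := rough_sum_cvg m x0.
have nl : `|\sum_(1 <= n < M) rough_indic m n * versin (x / n%:R) - versin x| @[M --> \oo] --> `|rough_sum m x - versin x|.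
  by apply: cvg_norm; apply: cvgB; [exact: c|exact: cvg_cst].
rewrite -(cvg_lim _ nl)//; apply: limr_le; first by apply/cvg_ex; eexists; exact: nl.
near=> M.
have M2 : (1 < M)%N by near: M; exact: nbhs_infty_gt.
have MY : (Y.+1 <= M)%N by near: M; exact: nbhs_infty_ge.
rewrite big_ltn// zt1 mul1r divr1 addrC addKr.
apply: (@le_trans _ _ (x * \sum_(Y.+1 <= n < M) v n)).
  apply: (le_trans (ler_norm_sum _ _ _)); rewrite mulr_sumr.
  apply: (@le_trans _ _ (\sum_(2 <= n < M) (if (Y < n)%N then x * v n else 0))).
    rewrite big_nat_cond [leRHS]big_nat_cond; apply: ler_sum => n /andP[/andP[n1 _] _].
    have n0 : (0 : R) < n%:R by rewrite ltr0n ltnW.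
    have [nY|Yn] := leqP n Y; first by rewrite ztY ?n1// mul0r normr0.
    rewrite normrM ger0_norm ?rough_indic_ge0// /v mulrCA; apply: ler_pM; rewrite ?rough_indic_ge0 ?rough_indic_le//.
    by apply: versin_le_id; rewrite divr_ge0// ltW.
  rewrite -big_mkcond /=.
  apply: (@le_trans _ _ (\sum_(1 <= n < M | (Y < n)%N) x * v n)).
    rewrite [leRHS]big_ltn_cond//; case: ifP => // _; rewrite lerDr.
    by rewrite mulr_ge0// ltW.
  rewrite (big_cat_nat (n := Y.+1))//= big_nat_cond big1 ?add0r.
    by rewrite big_mkcond; apply: ler_sum => n _; case: ifP => // _; rewrite mulr_ge0// ltW.
  by move=> n /andP[/andP[_ nY]]; rewrite ltnNge -ltnS nY.
rewrite mulrC ler_pM2r//.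
apply: le_trans HY; apply: le_trans (ler_norm _).
rewrite lerBrDr.
have -> : \sum_(Y.+1 <= n < M) v n + \sum_(1 <= n < Y.+1) v n = \sum_(1 <= n < M) v n.
  by rewrite addrC -big_cat_nat.
rewrite -(cvg_lim _ cv)//; apply: nondecreasing_cvgn_le; first exact: nondecreasing_sum_nat1.
by apply/cvg_ex; eexists; exact: cv.
Unshelve. all: end_near. Qed.

(** [euler_op] is positive and multiplies x by prod (1 + 1 / (b - 2)), which is bounded;
    so it preserves the estimate e * x uniformly in m. *)
Lemma euler_op_rough_sum_versin (x : R) : 0 < x ->
  euler_op b m (rough_sum m) x - euler_op b m (@versin R) x @[m --> \oo] --> (0 : R).
Proof.
move=> x0; pose L := 3 * lim (series (fun i => 1 / (b i)%:R : R) @ \oo).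
have L_le n : \sum_(0 <= i < n) 1 / ((b i)%:R - 2) <= L.
  apply: (@le_trans _ _ (\sum_(0 <= i < n) 3 * (1 / (b i)%:R))).
    by apply: ler_sum => i _; exact: inv_b_sub2_le.
  rewrite -mulr_sumr ler_pM2l//.
  by apply: nondecreasing_cvgn_le; [exact: nd_series_b|exact: b_summable].
have p0 i : 0 <= 1 / ((b i)%:R - 2) :> R by rewrite divr_ge0// ltW// bR_gt2.
have L0 : 0 < x * expR L by rewrite mulr_gt0 ?expR_gt0.
apply/cvgr0Pnorm_le => e e0.
have e' : 0 < e / (x * expR L) by rewrite divr_gt0.
have := rough_sum_versin e'; apply: filterS => m Hm.
rewrite -euler_opB; apply: (le_trans (norm_euler_op_le b_gt1 b_neq2 m x0 Hm)).
rewrite euler_op_id//.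
apply: (@le_trans _ _ (e / (x * expR L) * x * expR L)).
  by rewrite ler_wpM2l ?prod1D_le// mulr_ge0 ?ltW.
by rewrite -mulrA divfK// gt_eqF.
Qed.

(** Majorant of [euler_coef]: its two terms bound the effect of one step
    (1 + b / (b - 2) * T) (1 - T) on functions that are O (x^alpha). *)
Definition euler_incr (i : nat) : R :=
  2 / ((b i)%:R - 2) * (b i)%:R `^ (- alpha)
  + (b i)%:R / ((b i)%:R - 2) * ((b i)%:R `^ (- alpha)) ^+ 2.

(** (1 + b / (b - 2) * T) (1 - T) multiplies x^alpha by 1 + euler_coef. *)
Definition euler_coef (i : nat) : R :=
  2 / ((b i)%:R - 2) * (b i)%:R `^ (- alpha)
  - (b i)%:R / ((b i)%:R - 2) * ((b i)%:R `^ (- alpha)) ^+ 2.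

Lemma sum_B_indic (n : nat) :
  \sum_(1 <= k < n) B_indic k = (size [seq k <- index_iota 1 n | `[< B_integer b k >]])%:R.
Proof.
rewrite /B_indic -natr_sum size_filter -sum1_count; congr (_%:R).
by rewrite [RHS]big_mkcond; apply: eq_bigr => k _; case: `[< _ >].
Qed.

(** The b_i of rank r by size has r members of the family, all of them B-integers, up to
    itself; so r <= C b_i^alpha, and the sum is at most C^2 times that of the r^(-2). *)
Lemma sum_b_powR (m : nat) :
  \sum_(0 <= i < m) ((b i)%:R `^ (- alpha)) ^+ 2 <= C ^+ 2 * 2.
Proof.
pose r (i : 'I_m) := #|[set j : 'I_m | (b j <= b i)%N]%SET|.
have r0 i : (0 < r i)%N by rewrite /r card_gt0; apply/set0Pn; exists i; rewrite inE.
have rm i : (r i <= m)%N by rewrite -[X in (_ <= X)%N]card_ord max_card.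
have r_le i : (r i)%:R <= C * (b i)%:R `^ alpha.
  apply: le_trans (S_le (bR_gt0 R b_gt1 i)).
  rewrite /partial_sum natrK sum_B_indic ler_nat.
  rewrite /r cardE -(size_map (fun j : 'I_m => b j)).
  apply: uniq_leq_size.
    rewrite map_inj_uniq ?enum_uniq// => j k /(b_inj b_gt1 b_coprime) jk; exact: val_inj.
  move=> n /mapP[j]; rewrite mem_enum inE => bji ->.
  rewrite mem_filter mem_index_iota ltnS bji b_gt0// !andbT.
  by apply/asboolP; exact: B_integer_gen.
have r_lt (i j : 'I_m) : (b i < b j)%N -> (r i < r j)%N.
  move=> bij; apply: proper_card; apply/properP; split.
    by apply/fintype.subsetP => k; rewrite !inE => /leq_trans; apply; exact: ltnW.
  by exists j; rewrite !inE ?leqnn// -ltnNge.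
have r_inj (i j : 'I_m) : r i = r j -> i = j.
  move=> rij; have [/r_lt|/r_lt|bij] := ltngtP (b i) (b j); rewrite ?rij ?ltnn//.
  by apply: val_inj; exact: (b_inj b_gt1 b_coprime).
have rm' i : ((r i).-1 < m)%N by rewrite prednK.
pose h i : 'I_m := Ordinal (rm' i).
have h_inj : injective h.
  move=> i j /(congr1 val) /= rij; apply: r_inj.
  by rewrite -(prednK (r0 i)) -(prednK (r0 j)) rij.
apply: (@le_trans _ _ (\sum_(i < m) C ^+ 2 * (i.+1%:R `^ (- 2)))).
  rewrite big_mkord [leRHS](reindex_inj h_inj) /=; apply: ler_sum => i _.
  rewrite prednK// powRN [_ `^ (- 2)]powRN powR_mulrn// exprVn.
  have ri : (0 : R) < (r i)%:R ^+ 2 by rewrite exprn_gt0// ltr0n.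
  have bi : (0 : R) < ((b i)%:R `^ alpha) ^+ 2 by rewrite exprn_gt0// powR_gt0// bR_gt0.
  rewrite ler_pdivlMr// mulrC ler_pdivrMr// -exprMn.
  by rewrite ler_sqr ?nnegrE// mulr_ge0 ?powR_ge0.
rewrite -mulr_sumr ler_wpM2l ?sqr_ge0//.
have := @p_series_le R 2 m.+1; rewrite ltr1n => /(_ isT).
have -> : 2 - 1 = 1 :> R by ring.
rewrite invr1.
by rewrite big_add1 /= big_mkord => /le_trans; apply.
Qed.

Let b_powR_le1 i : 0 < ((b i)%:R `^ (- alpha) : R) <= 1.
Proof.
rewrite powR_gt0 ?bR_gt0//= powRN invf_le1 ?powR_gt0 ?bR_gt0//.
rewrite -[leLHS](powRr0 (b i)%:R); apply: ler_powR; last exact: ltW.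
by rewrite ler1n b_gt0.
Qed.

Let G_le3 i : 0 <= ((b i)%:R / ((b i)%:R - 2) : R) <= 3.
Proof.
have b3 : (3 : R) <= (b i)%:R by rewrite ler_nat b_ge3.
rewrite divr_ge0 ?(ltW (bR_gt2 R b_gt1 b_neq2 i))//= ler_pdivrMr ?bR_gt2//; lra.
Qed.

Let H_ge0 i : 0 <= 2 / ((b i)%:R - 2) :> R.
Proof. by rewrite divr_ge0// ltW// bR_gt2. Qed.

Lemma euler_incr_ge0 i : 0 <= euler_incr i.
Proof.
have /andP[G0 _] := G_le3 i; have /andP[p0 _] := b_powR_le1 i.
apply: addr_ge0; first exact: (mulr_ge0 (H_ge0 i) (ltW p0)).
exact: (mulr_ge0 G0 (sqr_ge0 _)).
Qed.

Lemma euler_coef_le i : `|euler_coef i| <= euler_incr i.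
Proof.
have /andP[G0 _] := G_le3 i; have /andP[p0 _] := b_powR_le1 i.
apply: (le_trans (ler_normB _ _)).
rewrite (ger0_norm (mulr_ge0 (H_ge0 i) (ltW p0))).
by rewrite (ger0_norm (mulr_ge0 G0 (sqr_ge0 _))).
Qed.

Definition euler_bound : R :=
  6 * lim (series (fun i => 1 / (b i)%:R : R) @ \oo) + 3 * (C ^+ 2 * 2).

Lemma sum_euler_incr n : \sum_(0 <= i < n) euler_incr i <= euler_bound.
Proof.
rewrite /euler_incr big_split /=; apply: lerD.
  apply: (@le_trans _ _ (\sum_(0 <= i < n) 6 * (1 / (b i)%:R))).
    apply: ler_sum => i _; have /andP[p0 p1] := b_powR_le1 i.
    have h := inv_b_sub2_le R b_gt1 b_neq2 i.
    have h0 : 0 <= 1 / ((b i)%:R - 2) :> R by rewrite divr_ge0// ltW// bR_gt2.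
    move: p0 p1 h h0; rewrite !div1r.
    by set p := _ `^ _; set q := (_ - 2)^-1; set w := _^-1; nra.
  rewrite -mulr_sumr ler_pM2l//.
  by apply: nondecreasing_cvgn_le; [exact: nd_series_b|exact: b_summable].
apply: (@le_trans _ _ (\sum_(0 <= i < n) 3 * ((b i)%:R `^ (- alpha)) ^+ 2)).
  by apply: ler_sum => i _; have /andP[_ G3] := G_le3 i; rewrite ler_wpM2r ?sqr_ge0.
by rewrite -mulr_sumr ler_pM2l// sum_b_powR.
Qed.

(** The two products of dilations applied to the sum over B-integers: it has the same limit
    in m as euler_op b m versin, and its steps are summable. *)
Let f m x := euler_op b m (rough_sum m) x.

Let fS m (x : R) : 0 < x -> f m.+1 x = f m x +
  2 / ((b m)%:R - 2) * f m (x / (b m)%:R) -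
  (b m)%:R / ((b m)%:R - 2) * f m (x / (b m)%:R / (b m)%:R).
Proof.
move=> x0; have b0 := bR_gt0 R b_gt1 m; have xb0 : 0 < x / (b m)%:R by rewrite divr_gt0.
have E y : 0 < y -> euler_op b m (rough_sum m.+1) y = f m y - f m (y / (b m)%:R).
  move=> y0; rewrite (@eq_euler_op R b b_gt1 m _ (fun x => rough_sum m x - rough_sum m (x / (b m)%:R)))//.
    by rewrite euler_opB euler_op_scale.
  by move=> w w0; exact: rough_sumS.
rewrite {1}/f /= !E//.
by field; rewrite gt_eqF ?bR_gt2.
Qed.

Let powR_div (x : R) i : 0 < x -> (x / (b i)%:R) `^ alpha = x `^ alpha * (b i)%:R `^ (- alpha).
Proof.
move=> x0; have b0 := bR_gt0 R b_gt1 i.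
by rewrite powRM ?invr_ge0 ?(ltW x0) ?(ltW b0)// -(powR_inv1 (ltW b0)) -powRrM mulN1r.
Qed.

Let D := 4 * C1 * expR euler_bound.

Let f_incr (K : R) m (x : R) : 0 < x -> (forall y : R, 0 < y -> `|f m y| <= K * y `^ alpha) ->
  `|f m.+1 x - f m x| <= K * x `^ alpha * euler_incr m.
Proof.
move=> x0 HK; have b0 := bR_gt0 R b_gt1 m; have xb0 : 0 < x / (b m)%:R by rewrite divr_gt0.
have xbb0 : 0 < x / (b m)%:R / (b m)%:R by rewrite divr_gt0.
have h1 := HK _ xb0; have h2 := HK _ xbb0; rewrite !powR_div// in h1 h2.
rewrite fS//; have -> : forall u v w : R, u + v - w - u = v - w by move=> *; ring.
apply: (le_trans (ler_normB _ _)); rewrite !normrM.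
have /andP[G0 _] := G_le3 m.
have G1 : 0 <= 2 / ((b m)%:R - 2) :> R by rewrite divr_ge0// ltW// bR_gt2.
rewrite -[X in X * _ + _]normrM -[X in _ + X * _]normrM (ger0_norm G0) (ger0_norm G1).
rewrite /euler_incr mulrDr; apply: lerD.
  by rewrite mulrCA ler_wpM2l// -mulrA.
by rewrite [leRHS]mulrCA ler_wpM2l// expr2 (le_trans h2)// !mulrA.
Qed.

Let f_le m (x : R) : 0 < x -> `|f m x| <= D * x `^ alpha.
Proof.
suff H y : 0 < y -> `|f m y| <= 4 * C1 * \prod_(0 <= i < m) (1 + euler_incr i) * y `^ alpha.
  move=> x0; apply: (le_trans (H x x0)); rewrite ler_wpM2r ?powR_ge0// ler_wpM2l//.
    by rewrite mulr_ge0// dirichlet_const_ge0.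
  exact: prod1D_le euler_incr_ge0 sum_euler_incr.
elim: m y => [|m IH] y y0.
  by rewrite big_geq// mulr1; have [_] := rough_sum_cvg 0 y0.
rewrite big_nat_recr//=.
have := f_incr y0 IH; set K := 4 * C1 * _ => h.
have -> : f m.+1 y = f m y + (f m.+1 y - f m y) by ring.
apply: (le_trans (ler_normD _ _)); apply: (le_trans (lerD (IH _ y0) h)).
by rewrite le_eqVlt; apply/orP; left; apply/eqP; rewrite /K; ring.
Qed.

Let f_asymp m : f m x / x `^ alpha @[x --> +oo] -->
  A * (cos (alpha * (pi / 2)) * Gamma (1 - alpha)) * \prod_(0 <= i < m) (1 + euler_coef i).
Proof.
elim: m => [|m IH].
  rewrite big_geq// mulr1.
  have := versin_sum_asymp B_indic_ge0 alpha_gt0 alpha_lt1 S_le S_cvg.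
  apply: cvg_trans; apply: near_eq_cvg; apply: nearW => x.
  by rewrite /f /= /rough_sum rough_indic_0.
rewrite big_nat_recr//=; set K := _ * \prod_(0 <= i < m) _ in IH.
have b0 := bR_gt0 R b_gt1 m; pose p := (b m)%:R `^ (- alpha).
have div_oo (c : R) : 0 < c -> x / c @[x --> +oo] --> +oo.
  by move=> c0; apply: gt0_cvgMly; [rewrite invr_gt0|exact: cvg_id].
have h1 := cvg_comp _ _ (div_oo _ b0) IH.
have h2 := cvg_comp _ _ (div_oo _ b0) h1.
have h : f m x / x `^ alpha + 2 / ((b m)%:R - 2) * (p * (f m (x / (b m)%:R) / (x / (b m)%:R) `^ alpha))
   - (b m)%:R / ((b m)%:R - 2) * (p ^+ 2 *
     (f m (x / (b m)%:R / (b m)%:R) / (x / (b m)%:R / (b m)%:R) `^ alpha)) @[x --> +oo] -->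
   K + 2 / ((b m)%:R - 2) * (p * K) - (b m)%:R / ((b m)%:R - 2) * (p ^+ 2 * K).
  apply: cvgB; [apply: cvgD; first exact: IH|];
    (apply: cvgM; [exact: cvg_cst|apply: cvgM; [exact: cvg_cst|]]); [exact: h1|exact: h2].
have -> : A * (cos (alpha * (pi / 2)) * Gamma (1 - alpha)) *
   (\prod_(0 <= i < m) (1 + euler_coef i) * (1 + euler_coef m)) =
   K + 2 / ((b m)%:R - 2) * (p * K) - (b m)%:R / ((b m)%:R - 2) * (p ^+ 2 * K).
  by rewrite mulrA -/K /euler_coef -/p; ring.
move: h; apply: cvg_trans; apply: near_eq_cvg; near=> x.
have x0 : 0 < x by near: x; exact: nbhs_pinfty_gt.
have xb0 : 0 < x / (b m)%:R by rewrite divr_gt0.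
rewrite fS// !powR_div// -/p.
have p0 : 0 < p by rewrite powR_gt0.
have xa : 0 < x `^ alpha by rewrite powR_gt0.
by field; rewrite !gt_eqF ?bR_gt2.
Unshelve. all: end_near. Qed.

(** At each finite m the asymptotics in x is that of the sum over all B-integers, times a
    finite product. The steps in m are summable uniformly in x after division by x^alpha,
    so the limits in m and x can be exchanged. *)
Theorem euler_op_versin_asymp : exists V : R -> R, exists D : R, exists Q : R,
  [/\ forall x, 0 < x -> euler_op b m (@versin R) x @[m --> \oo] --> V x,
      0 <= D /\ forall m x, 0 < x -> `|euler_op b m (@versin R) x| <= D * x `^ alpha,
      \prod_(0 <= i < m) (1 + euler_coef i) @[m --> \oo] --> Q &
      V x / x `^ alpha @[x --> +oo] -->
        A * (cos (alpha * (pi / 2)) * Gamma (1 - alpha)) * Q].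
Proof.
have D0 : 0 <= D.
  by apply: mulr_ge0; [apply: mulr_ge0 => //; exact: dirichlet_const_ge0|exact: expR_ge0].
have incr x m : 0 < x -> `|f m.+1 x - f m x| <= D * x `^ alpha * euler_incr m.
  by move=> x0; apply: f_incr => // y; exact: f_le.
have incr_sum x n : 0 < x ->
    \sum_(0 <= i < n) D * x `^ alpha * euler_incr i <= D * x `^ alpha * euler_bound.
  by move=> x0; rewrite -mulr_sumr ler_wpM2l ?sum_euler_incr// mulr_ge0 ?powR_ge0.
pose V x := lim (f m x @[m --> \oo]).
have fV x : 0 < x -> f m x @[m --> \oo] --> V x.
  move=> x0; have [_ [l fl _]] := cvg_summable_increments (fun m => incr x m x0) (fun n => incr_sum x n x0).
  by apply/cvg_ex; exists l.
have eV x : 0 < x -> euler_op b m (@versin R) x @[m --> \oo] --> V x.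
  move=> x0; 
  have : f m x - (euler_op b m (rough_sum m) x - euler_op b m (@versin R) x) @[m --> \oo] --> V x - 0.
    by apply: cvgB; [exact: fV|exact: euler_op_rough_sum_versin].
  rewrite subr0.
  by apply: cvg_trans; apply: near_eq_cvg; apply: nearW => m; rewrite /= /f; ring.
have V_le x : 0 < x -> `|V x| <= D * x `^ alpha.
  move=> x0; have nl : `|f m x| @[m --> \oo] --> `|V x| by apply: cvg_norm; exact: fV.
  rewrite -(cvg_lim _ nl)//; apply: limr_le; first by apply/cvg_ex; eexists; exact: nl.
  by apply: nearW => m; exact: f_le.
have nd x : 0 < x -> nondecreasing_seq (fun m => euler_op b m (@versin R) x).
  move=> x0; apply/nondecreasing_seqP => m /=; rewrite lerDl mulr_ge0//.
    by have /andP[] := G_le3 m.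
  apply: euler_op_ge0 => //; first by rewrite divr_gt0// bR_gt0.
  by move=> y _; exact: versin_ge0.
have [Q hQ] := cvg_prod1D euler_coef_le sum_euler_incr.
exists V, D, Q; split => //.
  split=> // m x x0; rewrite ger0_norm; last first.
    by apply: euler_op_ge0 => // y _; exact: versin_ge0.
  apply: le_trans (V_le x x0); apply: le_trans (ler_norm _).
  rewrite -(cvg_lim _ (eV x x0))//; apply: nondecreasing_cvgn_le; first exact: nd.
  by apply/cvg_ex; eexists; exact: eV.
pose v i := D * euler_incr i.
have vL n : \sum_(0 <= i < n) v i <= D * euler_bound.
  by rewrite -mulr_sumr ler_wpM2l ?sum_euler_incr.
have Fv x m : 0 < x -> `|f m.+1 x / x `^ alpha - f m x / x `^ alpha| <= v m.
  move=> x0; rewrite -mulrBl normrM [X in _ * X]ger0_norm ?invr_ge0 ?powR_ge0//.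
  by rewrite ler_pdivrMr ?powR_gt0// (le_trans (incr x m x0))// /v mulrAC.
have cv : cvgn (series v) by have [] := cvg_summable_increments (fun m => Fv 1 m ltr01) vL.
have V_f x m : 0 < x -> `|V x / x `^ alpha - f m x / x `^ alpha| <= lim (series v @ \oo) - series v m.
  move=> x0; have [_ [l hl tl]] := cvg_summable_increments (fun m => Fv x m x0) vL.
  have <- : l = V x / x `^ alpha; last exact: tl.
  have hV : f m x / x `^ alpha @[m --> \oo] --> V x / x `^ alpha.
    by apply: cvgM; [exact: fV|exact: cvg_cst].
  exact: (cvg_unique _ hl hV).
pose K := A * (cos (alpha * (pi / 2)) * Gamma (1 - alpha)).
have KQ : K * \prod_(0 <= i < m) (1 + euler_coef i) @[m --> \oo] --> K * Q.
  by apply: cvgM; [exact: cvg_cst|exact: hQ].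
apply: cvg_approx => e e0.
near \oo => m.
exists (fun x => f m x / x `^ alpha), (K * \prod_(0 <= i < m) (1 + euler_coef i)); split.
- near=> x; have x0 : 0 < x by near: x; exact: nbhs_pinfty_gt.
  apply: (le_trans (V_f x m x0)); apply: le_trans (ler_norm _) _.
  by near: m; move/cvgrPdist_le : cv; exact.
- exact: f_asymp.
- by rewrite distrC; near: m; move/cvgrPdist_le : KQ; exact.
Unshelve. all: end_near. Qed.

End B_sums.

(** * The counting function of the B-integers *)

Section counting.
Variable R : realType.

Lemma cvg_powRN (d : R) : 0 < d -> y `^ (- d) @[y --> +oo] --> (0 : R).
Proof.
move=> d0; apply/cvgr0Pnorm_le => e e0.
near=> y; rewrite ger0_norm ?powR_ge0// powRN.
have y0 : 0 < y by near: y; exact: nbhs_pinfty_gt.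
rewrite -[leRHS]invrK lef_pV2 ?posrE ?invr_gt0 ?powR_gt0//.
have -> : e^-1 = (e^-1 `^ d^-1) `^ d by rewrite -powRrM mulVf ?gt_eqF// powRr1// invr_ge0 ltW.
by apply: ge0_ler_powR; rewrite ?nnegrE ?powR_ge0 ?(ltW d0) ?(ltW y0).
Unshelve. all: end_near. Qed.

Lemma cvg_trunc_div : (Num.truncn y)%:R / y @[y --> +oo] --> (1 : R).
Proof.
apply/cvgrPdist_le => e e0; near=> y.
have y0 : 0 < y by near: y; exact: nbhs_pinfty_gt.
have := @truncn_itv R y (ltW y0); rewrite -natr1 => /andP[ty yt].
have -> : 1 - (Num.truncn y)%:R / y = (y - (Num.truncn y)%:R) / y by field; rewrite gt_eqF.
rewrite ger0_norm ?divr_ge0 ?subr_ge0 ?(ltW y0)// ler_pdivrMr//.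
apply: (@le_trans _ _ 1); first by rewrite lerBlDr addrC ltW.
rewrite -ler_pdivrMl// mulr1; near: y; exact: nbhs_pinfty_ge.
Unshelve. all: end_near. Qed.

Lemma trunc_cvg_oo : Num.truncn y @[y --> (+oo : set_system R)] --> \oo.
Proof.
apply/cvgnyPge => Y; apply: filterS (nbhs_pinfty_ge (num_real (Y%:R : R))) => y Yy.
by rewrite truncn_ge_nat// (le_trans _ Yy).
Qed.

Variables (b : nat -> nat) (A alpha beta : R).
Hypothesis beta_ge0 : 0 <= beta.
Hypothesis beta_lt_alpha : beta < alpha.
Hypothesis count_asymp :
     (fun N : nat => (B_integer_count b N)%:R - A * N%:R `^ alpha : R^o)
       =O_\oo (fun N : nat => N%:R `^ beta : R^o).

Let alpha_gt0 : 0 < alpha. Proof. exact: le_lt_trans beta_lt_alpha. Qed.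

Lemma B_integer_count_partial_sum (y : R) :
  partial_sum (B_indic R b) y = (B_integer_count b (Num.truncn y))%:R.
Proof.
rewrite /partial_sum /B_integer_count natr_sum [RHS]big_mkcond /B_indic.
by apply: eq_bigr => n _; case: `[< _ >].
Qed.

Lemma B_integer_count_cvg : (B_integer_count b N)%:R / N%:R `^ alpha @[N --> \oo] --> A.
Proof.
move/eqO_exP : count_asymp => [k k0 H].
have d0 : 0 < alpha - beta by rewrite subr_gt0.
have h : k * N%:R `^ (- (alpha - beta)) @[N --> \oo] --> k * 0.
  apply: cvgM; first exact: cvg_cst.
  exact: cvg_comp (@cvgr_idn R) (cvg_powRN d0).
apply/cvgrPdist_le => e e0; near=> N.
have N0 : (0 : R) < N%:R by rewrite ltr0n; near: N; exact: nbhs_infty_gt.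
have Na : 0 < N%:R `^ alpha by rewrite powR_gt0.
have -> : A - (B_integer_count b N)%:R / N%:R `^ alpha =
  - (((B_integer_count b N)%:R - A * N%:R `^ alpha) / N%:R `^ alpha) by field; rewrite gt_eqF.
rewrite normrN normrM [X in _ * X]gtr0_norm ?invr_gt0//.
apply: (@le_trans _ _ (k * N%:R `^ (- (alpha - beta)))).
  rewrite ler_pdivrMr// -mulrA -powRD ?(gt_eqF N0) ?implybT//.
  have -> : - (alpha - beta) + alpha = beta by ring.
  rewrite -[X in _ <= _ * X](@ger0_norm _ (_ `^ _)) ?powR_ge0//.
  by near: N.
rewrite -[leLHS]subr0 -(mulr0 k); apply: le_trans (ler_norm _) _.
rewrite distrC; near: N; move/cvgrPdist_le : h; exact.
Unshelve. all: end_near. Qed.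

(** The counting hypothesis at integers, extended to real y: floor y / y tends to 1. *)
Lemma B_integer_partial_sum_cvg : partial_sum (B_indic R b) y / y `^ alpha @[y --> +oo] --> A.
Proof.
have h1 := cvg_comp _ _ trunc_cvg_oo B_integer_count_cvg.
have h2 : ((Num.truncn y)%:R / y) `^ alpha @[y --> +oo] --> (1 : R).
  have -> : nbhs (1 : R) = nbhs (1 `^ alpha : R) by rewrite powR1.
  exact: (cvg_comp _ _ cvg_trunc_div (continuous_powR ltr01)).
have : (B_integer_count b (Num.truncn y))%:R / (Num.truncn y)%:R `^ alpha *
    ((Num.truncn y)%:R / y) `^ alpha @[y --> +oo] --> A * 1.
  by apply: cvgM; [exact: h1|exact: h2].
rewrite mulr1; apply: cvg_trans; apply: near_eq_cvg; near=> y.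
have y0 : 0 < y by near: y; exact: nbhs_pinfty_gt.
have t0 : (0 : R) < (Num.truncn y)%:R.
  by rewrite ltr0n truncn_gt0; near: y; exact: nbhs_pinfty_ge.
rewrite /= B_integer_count_partial_sum powRM ?invr_ge0 ?(ltW y0) ?(ltW t0)//.
rewrite -(powR_inv1 (ltW y0)) -powRrM mulN1r powRN.
by field; rewrite !gt_eqF ?powR_gt0.
Unshelve. all: end_near. Qed.

Lemma B_integer_partial_sum_le : exists2 C : R, 0 <= C &
  forall y : R, 0 < y -> partial_sum (B_indic R b) y <= C * y `^ alpha.
Proof.
have /cvg_seq_bounded [M [_ HM]] : cvgn (fun N => (B_integer_count b N)%:R / N%:R `^ alpha : R^o).
  by apply/cvg_ex; eexists; exact: B_integer_count_cvg.
have {}HM N : (B_integer_count b N)%:R / N%:R `^ alpha <= `|M| + 1.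
  apply: (le_trans (ler_norm _)); apply: HM => //.
  by rewrite (le_lt_trans (ler_norm M))// ltrDl.
exists (`|M| + 1); first by rewrite addr_ge0.
move=> y y0; rewrite B_integer_count_partial_sum.
have [t0|t0] := posnP (Num.truncn y).
  by rewrite t0 /B_integer_count big_geq// mulr_ge0 ?addr_ge0 ?powR_ge0.
have t1 : (0 : R) < (Num.truncn y)%:R by rewrite ltr0n.
have := HM (Num.truncn y); rewrite ler_pdivrMr ?powR_gt0// => /le_trans; apply.
rewrite ler_wpM2l ?addr_ge0//; apply: ge0_ler_powR; rewrite ?nnegrE ?(ltW alpha_gt0) ?(ltW y0)//.
by have /andP[] := @truncn_itv R y (ltW y0).
Qed.

End counting.

(** * The variance for the full family *)

Lemma zeta_cvg (R : realType) (s : R) : 1 < s ->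
  \sum_(1 <= k < M) k%:R `^ (- s) @[M --> \oo] --> zeta s.
Proof.
move=> s1.
have E M : \sum_(1 <= k < M.+1) k%:R `^ (- s) = series (riemannR s) M :> R.
  by rewrite /series /= big_add1; apply: eq_bigr => k _; rewrite powRN.
have c : cvgn (fun M => \sum_(1 <= k < M) k%:R `^ (- s) : R).
  apply: nondecreasing_is_cvgn; first by apply: nondecreasing_sum_nat1 => n; exact: powR_ge0.
  by exists (1 + (s - 1)^-1) => _ [n _ <-]; exact: p_series_le.
move: c => /cvg_ex[l hl]; rewrite [X in _ --> X](_ : _ = l)//.
apply/cvg_lim => //; rewrite -(cvg_shiftS (fun M => \sum_(1 <= k < M) k%:R `^ (- s) : R)) /= in hl.
by move: hl; apply: cvg_trans; apply: near_eq_cvg; apply: nearW => M /=; rewrite E.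
Qed.

Lemma zeta_gt0 (R : realType) (s : R) : 1 < s -> 0 < zeta s.
Proof.
move=> s1; apply: (@lt_le_trans _ _ 1) => //.
rewrite -(cvg_lim _ (zeta_cvg s1))//; apply: limr_ge.
  by apply/cvg_ex; eexists; exact: zeta_cvg.
near=> M; have M2 : (1 < M)%N by near: M; exact: nbhs_infty_gt.
by rewrite big_ltn// powR1 lerDl sumr_ge0// => k _; exact: powR_ge0.
Unshelve. all: end_near. Qed.

Section variance_asymptotics.
Variable R : realType.
Variables (b : nat -> nat) (alpha C : R).
Hypothesis b_gt1 : forall i, (1 < b i)%N.
Hypothesis b_coprime : forall i j, i != j -> coprime (b i) (b j).
Hypothesis b_neq2 : forall i, b i != 2%N.
Hypothesis b_summable : cvg (series (fun i => 1 / (b i)%:R : R) @ \oo).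
Hypothesis alpha_gt0 : 0 < alpha.
Hypothesis alpha_lt1 : alpha < 1.
Hypothesis C_ge0 : 0 <= C.
Hypothesis S_le : forall y : R, 0 < y -> partial_sum (B_indic R b) y <= C * y `^ alpha.

Definition local_factor (i : nat) : R := 1 - 2 / (b i)%:R
   + 2 / (b i)%:R `^ (alpha + 1) - 1 / (b i)%:R `^ (2 * alpha).

Let b0 i := bR_gt0 R b_gt1 i.

Lemma local_factor_powRN i : local_factor i = 1 + (- 2 / (b i)%:R
  + 2 / (b i)%:R * (b i)%:R `^ (- alpha) - ((b i)%:R `^ (- alpha)) ^+ 2).
Proof.
rewrite /local_factor [2 * alpha]mulrC powRrM powR_mulrn ?powR_ge0// powRN.
rewrite powRD ?(gt_eqF (b0 i)) ?implybT// powRr1 ?(ltW (b0 i))//.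
by field; rewrite !gt_eqF ?powR_gt0.
Qed.

Lemma local_factor_euler i : local_factor i = (1 - 2 / (b i)%:R) * (1 + euler_coef b alpha i).
Proof.
rewrite local_factor_powRN /euler_coef.
by field; rewrite !gt_eqF ?bR_gt2.
Qed.

(** Each factor is (1 - 2 / b + b^(- alpha)) (1 - b^(- alpha)), which is positive as b > 2. *)
Lemma prod_local_factor_cvg : exists2 l : R, 0 < l &
  \prod_(0 <= i < m) local_factor i @[m --> \oo] --> l.
Proof.
pose L : R := lim (series (fun i => 1 / (b i)%:R : R) @ \oo).
pose v i := 4 * (1 / (b i)%:R) + ((b i)%:R `^ (- alpha)) ^+ 2.
have p01 i : 0 < ((b i)%:R `^ (- alpha) : R) < 1.
  rewrite powR_gt0 ?b0//= powRN invf_lt1 ?powR_gt0 ?b0//.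
  have one : (1 : R) = 1 `^ alpha by rewrite powR1.
  by rewrite [ltLHS]one gt0_ltr_powR ?nnegrE// ltr1n.
have w0 i : 0 < 1 / (b i)%:R :> R by rewrite divr_gt0.
have w2 i : 2 * (1 / (b i)%:R) < 1 :> R.
  by have := bR_gt2 R b_gt1 b_neq2 i; rewrite subr_gt0 mulrA mulr1 ltr_pdivrMr ?mul1r.
pose a i := - 2 / (b i)%:R + 2 / (b i)%:R * (b i)%:R `^ (- alpha) - ((b i)%:R `^ (- alpha)) ^+ 2.
have aE i : 1 + a i = (1 - 2 * (1 / (b i)%:R) + (b i)%:R `^ (- alpha)) * (1 - (b i)%:R `^ (- alpha)).
  by rewrite /a; ring.
have av i : `|a i| <= v i.
  rewrite ler_norml /a /v; have /andP[p0 p1] := p01 i.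
  move: p0 p1 (w0 i); rewrite div1r; set p := _ `^ _; set w := _^-1 => p0 p1 w0'.
  by apply/andP; split; nra.
have vL n : \sum_(0 <= i < n) v i <= 4 * L + C ^+ 2 * 2.
  rewrite big_split /= -mulr_sumr; apply: lerD.
    rewrite ler_pM2l//.
    by apply: nondecreasing_cvgn_le; [exact: nd_series_b|exact: b_summable].
  by apply: sum_b_powR.
have a1 i : 0 < 1 + a i.
  rewrite aE; have /andP[p0 p1] := p01 i; have := w2 i => w2i.
  by apply: mulr_gt0; lra.
have [l l0 hl] := cvg_prod1D_gt0 av vL a1.
exists l => //; apply: cvg_trans hl; apply: near_eq_cvg; apply: nearW => m /=.
by apply: eq_bigr => i _; rewrite local_factor_powRN.
Qed.

Lemma trunc_pair_density_cvg : exists P : R, trunc_pair_density R b m @[m --> \oo] --> P.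
Proof.
pose L : R := lim (series (fun i => 1 / (b i)%:R : R) @ \oo).
apply: (@cvg_prod1D R _ (fun i => 2 * (1 / (b i)%:R)) (2 * L)) => [i|n].
  by rewrite normrN ger0_norm ?divr_ge0// mulrA mulr1.
rewrite -mulr_sumr ler_pM2l//.
by apply: nondecreasing_cvgn_le; [exact: nd_series_b|exact: b_summable].
Qed.

Lemma powR_div_sqr (c : R) k : 0 <= c -> (0 < k)%N ->
  (c * k%:R) `^ alpha / (pi * k%:R) ^+ 2 = c `^ alpha / pi ^+ 2 * k%:R `^ (- (2 - alpha)).
Proof.
move=> c0 k0; have k0' : (0 : R) < k%:R by rewrite ltr0n.
rewrite powRM ?(ltW k0')// opprB powRD ?(gt_eqF k0') ?implybT//.
rewrite powRN powR_mulrn ?(ltW k0')// exprMn invfM.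
by set p := pi ^+ 2; ring.
Qed.

Section series_V.
Variables (V : R -> R) (D : R).
Hypothesis V_cvg : forall x, 0 < x -> euler_op b m (@versin R) x @[m --> \oo] --> V x.
Hypothesis D_ge0 : 0 <= D.
Hypothesis V_le : forall m x, 0 < x -> `|euler_op b m (@versin R) x| <= D * x `^ alpha.

Let V_bound x : 0 < x -> `|V x| <= D * x `^ alpha.
Proof.
move=> x0; have nl : `|euler_op b m (@versin R) x| @[m --> \oo] --> `|V x|.
  by apply: cvg_norm; exact: V_cvg.
rewrite -(cvg_lim _ nl)//; apply: limr_le; first by apply/cvg_ex; eexists; exact: nl.
by apply: nearW => m; exact: V_le.
Qed.

Let v (c : R) (k : nat) : R := D * (c `^ alpha / pi ^+ 2) * k%:R `^ (- (2 - alpha)).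

Let v_sum (c : R) M : \sum_(1 <= k < M) v c k <=
   D * (c `^ alpha / pi ^+ 2) * (1 + (2 - alpha - 1)^-1).
Proof.
rewrite -mulr_sumr ler_wpM2l//.
  by rewrite mulr_ge0// divr_ge0 ?powR_ge0 ?sqr_ge0.
by apply: p_series_le; move: alpha_lt1; lra.
Qed.

Let term_le (g : R -> R) (N k : nat) : (0 < N)%N -> (0 < k)%N ->
  (forall x, 0 < x -> `|g x| <= D * x `^ alpha) ->
  `|g (2 * pi * (k%:R * N%:R)) / (pi * k%:R) ^+ 2| <= v (2 * pi * N%:R) k.
Proof.
move=> N0 k0 hg; have pi0 := pi_gt0 R.
have NR : (0 : R) < N%:R by rewrite ltr0n.
have kR : (0 : R) < k%:R by rewrite ltr0n.
have c0 : 0 < 2 * pi * N%:R :> R by rewrite !mulr_gt0.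
rewrite normrM [X in _ * X]ger0_norm ?invr_ge0 ?sqr_ge0//.
rewrite /v -[D * _ * _]mulrA -powR_div_sqr ?(ltW c0)// [leRHS]mulrA.
rewrite ler_wpM2r ?invr_ge0 ?sqr_ge0//.
have -> : 2 * pi * (k%:R * N%:R) = 2 * pi * N%:R * k%:R :> R by ring.
by apply: hg; rewrite mulr_gt0.
Qed.

(** Tannery's theorem in k, as m tends to infinity. *)
Lemma Var_B_series (P : R) (N : nat) : (0 < N)%N -> trunc_pair_density R b m @[m --> \oo] --> P ->
  exists2 s : R, \sum_(1 <= k < M) V (2 * pi * (k%:R * N%:R)) / (pi * k%:R) ^+ 2 @[M --> \oo] --> s &
    Var_B R b N = P * s.
Proof.
move=> N0 hP; have pi0 := pi_gt0 R.
have x0 k : (0 < k)%N -> 0 < 2 * pi * (k%:R * N%:R) :> R.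
  by move=> k0; rewrite !mulr_gt0 ?ltr0n.
have [s hs _] := dominated_series_cvg (fun k k0 => term_le N0 k0 V_bound) (v_sum (2 * pi * N%:R)).
exists s => //; apply: Var_B_cvg => //.
have h : trunc_var R b m N / trunc_pair_density R b m @[m --> \oo] --> s.
  apply: (tannery (fun m k k0 => term_le N0 k0 (V_le m)) (v_sum (2 * pi * N%:R)) _ _ hs).
    by move=> k k0; apply: cvgM; [apply: V_cvg; exact: x0|exact: cvg_cst].
  by move=> m; exact: trunc_var_fourier.
have : trunc_pair_density R b m * (trunc_var R b m N / trunc_pair_density R b m) @[m --> \oo] --> P * s.
  by apply: cvgM.
apply: cvg_trans; apply: near_eq_cvg; apply: nearW => m /=.
rewrite mulrC divfK// gt_eqF//; apply: prodr_gt0 => i _.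
by rewrite subr_gt0 ltr_pdivrMr ?b0// mul1r ltr_nat b_ge3.
Qed.

(** Tannery's theorem in k, as N tends to infinity: the k-th term tends to l (2 pi k)^alpha /
    (pi k)^2, and the sum over k is a value of zeta. *)
Lemma Var_B_asymp (P l : R) : trunc_pair_density R b m @[m --> \oo] --> P ->
  V x / x `^ alpha @[x --> +oo] --> l ->
  Var_B R b N / N%:R `^ alpha @[N --> \oo] -->
    P * (l * ((2 * pi) `^ alpha / pi ^+ 2) * zeta (2 - alpha)).
Proof.
move=> hP hV; have pi0 := pi_gt0 R.
have c0 : 0 < 2 * pi :> R by rewrite mulr_gt0.
rewrite -(cvg_shiftS (fun N => Var_B R b N / N%:R `^ alpha)) /=.
have NR N : (0 : R) < N.+1%:R by [].
have Na N : 0 < N.+1%:R `^ alpha :> R by rewrite powR_gt0.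
pose s N := Var_B R b N.+1 / P / N.+1%:R `^ alpha.
pose f (N k : nat) := V (2 * pi * (k%:R * N.+1%:R)) / (pi * k%:R) ^+ 2 / N.+1%:R `^ alpha.
pose u (k : nat) := l * ((2 * pi) `^ alpha / pi ^+ 2) * k%:R `^ (- (2 - alpha)).
have Ser N : exists S : R,
   \sum_(1 <= k < M) V (2 * pi * (k%:R * N.+1%:R)) / (pi * k%:R) ^+ 2 @[M --> \oo] --> S /\
   Var_B R b N.+1 = P * S.
  by have [S h1 h2] := Var_B_series (ltn0Sn N) hP; exists S.
have [S hS] := choice Ser.
have f_le N k : (0 < k)%N -> `|f N k| <= v (2 * pi) k.
  move=> k0; rewrite /f normrM [X in _ * X]gtr0_norm ?invr_gt0// ler_pdivrMr//.
  apply: (le_trans (term_le (ltn0Sn N) k0 V_bound)).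
  rewrite /v powRM ?(ltW c0)//.
  by rewrite le_eqVlt; apply/orP; left; apply/eqP; set p := pi ^+ 2; ring.
have f_cvg k : (0 < k)%N -> f N k @[N --> \oo] --> u k.
  move=> k0; have kR : (0 : R) < k%:R by rewrite ltr0n.
  have x_oo : 2 * pi * (k%:R * N.+1%:R) @[N --> \oo] --> (+oo : set_system R).
    have n_oo : N.+1%:R @[N --> \oo] --> (+oo : set_system R).
      by rewrite (cvg_shiftS (fun N => N%:R : R)); exact: cvgr_idn.
    have k_oo : y * (2 * pi * k%:R) @[y --> (+oo : set_system R)] --> (+oo : set_system R).
      by apply: gt0_cvgMly; [rewrite mulr_gt0|exact: cvg_id].
    apply: cvg_trans (cvg_comp _ _ n_oo k_oo); apply: near_eq_cvg; apply: nearW => N /=.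
    by rewrite mulrC mulrA.
  have := cvg_comp _ _ x_oo hV => h.
  have : (2 * pi * k%:R) `^ alpha / (pi * k%:R) ^+ 2 *
      (V (2 * pi * (k%:R * N.+1%:R)) / (2 * pi * (k%:R * N.+1%:R)) `^ alpha) @[N --> \oo] -->
      (2 * pi * k%:R) `^ alpha / (pi * k%:R) ^+ 2 * l.
    by apply: cvgM; [exact: cvg_cst|exact: h].
  rewrite powR_div_sqr ?(ltW c0)//.
  have -> : (2 * pi) `^ alpha / pi ^+ 2 * k%:R `^ (- (2 - alpha)) * l = u k by rewrite /u; set p := pi ^+ 2; ring.
  apply: cvg_trans; apply: near_eq_cvg; apply: nearW => N /=.
  have xE : 2 * pi * (k%:R * N.+1%:R) = 2 * pi * k%:R * N.+1%:R :> R by ring.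
  rewrite -powR_div_sqr ?(ltW c0)// /f xE.
  have ck0 : 0 < 2 * pi * k%:R :> R by rewrite mulr_gt0.
  have kp : 0 < (2 * pi * k%:R) `^ alpha :> R by rewrite powR_gt0.
  have q0 : 0 < (pi * k%:R) ^+ 2 :> R by rewrite exprn_gt0// mulr_gt0.
  rewrite [(2 * pi * k%:R * _) `^ alpha]powRM ?(ltW ck0)//.
  have := Na N; move: kp q0; set p := (2 * pi * k%:R) `^ alpha; set q := _ ^+ 2.
  set n := _ `^ alpha; set w := V _ => kp q0 n0.
  by field; rewrite !gt_eqF.
have f_sum N : \sum_(1 <= k < M) f N k @[M --> \oo] --> S N / N.+1%:R `^ alpha.
  have [h _] := hS N.
  under eq_fun do rewrite -mulr_suml.
  by apply: cvgM; [exact: h|exact: cvg_cst].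
have u_sum : \sum_(1 <= k < M) u k @[M --> \oo] --> l * ((2 * pi) `^ alpha / pi ^+ 2) * zeta (2 - alpha).
  have s1 : 1 < 2 - alpha by move: alpha_lt1; lra.
  under eq_fun do rewrite -mulr_sumr.
  by apply: cvgM; [exact: cvg_cst|exact: zeta_cvg].
have := tannery f_le (v_sum (2 * pi)) f_cvg f_sum u_sum => h.
have : P * (S N / N.+1%:R `^ alpha) @[N --> \oo] --> P * (l * ((2 * pi) `^ alpha / pi ^+ 2) * zeta (2 - alpha)).
  by apply: cvgM; [exact: cvg_cst|exact: h].
apply: cvg_trans; apply: near_eq_cvg; apply: nearW => N /=.
by have [_ ->] := hS N; rewrite mulrA.
Qed.

End series_V.

End variance_asymptotics.

Theorem theorem1 (R : realType) (b : nat -> nat) (A alpha beta : R)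
  (b_gt1 : forall i, (1 < b i)%N)
  (b_coprime : forall i j, i != j -> coprime (b i) (b j))
  (b_summable : cvg (series (fun i => 1 / (b i)%:R : R) @ \oo))
  (b_neq2 : forall i, b i != 2%N)
  (A_gt0 : 0 < A)
  (beta_ge0 : 0 <= beta) (beta_lt_alpha : beta < alpha) (alpha_lt1 : alpha < 1)
  (count_asymp :
     (fun N : nat => (B_integer_count b N)%:R - A * N%:R `^ alpha : R^o)
       =O_\oo (fun N : nat => N%:R `^ beta : R^o)) :
  let C : R :=
    2 `^ alpha * pi `^ (alpha - 2) * A / (alpha - 1)
    * infinite_prod (fun i => 1 - 2 / (b i)%:R
                              + 2 / (b i)%:R `^ (alpha + 1)
                              - 1 / (b i)%:R `^ (2 * alpha))
    * sin (pi * (alpha - 1) / 2) * Gamma (2 - alpha) * zeta (2 - alpha) in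
  (Var_B R b N / (C * N%:R `^ alpha)) @[N --> \oo] --> (1 : R).
Proof.
move=> C0.
have alpha_gt0 : 0 < alpha by exact: le_lt_trans beta_lt_alpha.
have [C C_ge0 S_le] := B_integer_partial_sum_le beta_ge0 beta_lt_alpha count_asymp.
have S_cvg := B_integer_partial_sum_cvg beta_lt_alpha count_asymp.
have [V [D [Q [eV [D0 V_le] hQ hV]]]] := euler_op_versin_asymp b_gt1 b_coprime b_neq2 b_summable
  alpha_gt0 alpha_lt1 C_ge0 S_le S_cvg.
have [P hP] := trunc_pair_density_cvg b_summable.
have [l l0 hl] := prod_local_factor_cvg b_gt1 b_coprime b_neq2 b_summable alpha_gt0 C_ge0 S_le.
have PQ : P * Q = l.
  have : trunc_pair_density R b m * \prod_(0 <= i < m) (1 + euler_coef b alpha i) @[m --> \oo] --> P * Q.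
    by apply: cvgM; [exact: hP|exact: hQ].
  have -> : (fun m => trunc_pair_density R b m * \prod_(0 <= i < m) (1 + euler_coef b alpha i)) =
            (fun m => \prod_(0 <= i < m) local_factor b alpha i).
    apply/funext => m; rewrite /trunc_pair_density -big_split /=; apply: eq_bigr => i _.
    by rewrite local_factor_euler.
  by move=> h; exact: (cvg_unique _ h hl).
have prodE : infinite_prod (fun i => 1 - 2 / (b i)%:R
   + 2 / (b i)%:R `^ (alpha + 1) - 1 / (b i)%:R `^ (2 * alpha)) = l.
  by apply/cvg_lim => //; exact: hl.
have asymp := Var_B_asymp b_gt1 b_coprime b_neq2 b_summable alpha_lt1 eV D0 V_le hP hV.
have pi0 := pi_gt0 R.
have a1 : 0 < 1 - alpha by rewrite subr_gt0.
have cos0 : 0 < cos (alpha * (pi / 2)) :> R.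
  apply: cos_gt0_pihalf; apply/andP; split.
    by rewrite (@lt_trans _ _ 0)// ?oppr_lt0 ?mulr_gt0 ?divr_gt0.
  by rewrite gtr_pMl ?divr_gt0.
have G0 : 0 < Gamma (1 - alpha) by rewrite Gamma_gt0// a1 lerBlDr lerDl ltW.
have z0 : 0 < zeta (2 - alpha).
  by apply: zeta_gt0; move: alpha_lt1; lra.
have sinE : sin (pi * (alpha - 1) / 2) = - cos (alpha * (pi / 2)) :> R.
  have -> : pi * (alpha - 1) / 2 = alpha * (pi / 2) - pi / 2 :> R by ring.
  by rewrite sinB cos_pihalf sin_pihalf mulr0 mulr1 add0r.
have GE : Gamma (2 - alpha) = (1 - alpha) * Gamma (1 - alpha).
  have -> : 2 - alpha = 1 - alpha + 1 by ring.
  exact: GammaS.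
have piE : 2 `^ alpha * pi `^ (alpha - 2) = (2 * pi) `^ alpha / pi ^+ 2 :> R.
  rewrite powRM ?(ltW pi0)// powRD ?(gt_eqF pi0) ?implybT//.
  by rewrite powRN powR_mulrn ?(ltW pi0)// mulrA.
have CE : C0 = P * (A * (cos (alpha * (pi / 2)) * Gamma (1 - alpha)) * Q
    * ((2 * pi) `^ alpha / pi ^+ 2) * zeta (2 - alpha)).
  rewrite /C0 prodE piE sinE GE -PQ.
  set q := (2 * pi) `^ alpha / _; set c := cos _; set g := Gamma _; set w := zeta _.
  by field; rewrite lt_eqF// subr_lt0.
have C0_gt0 : 0 < C0.
  have -> : C0 = A * (cos (alpha * (pi / 2)) * Gamma (1 - alpha)) * l
    * ((2 * pi) `^ alpha / pi ^+ 2) * zeta (2 - alpha) by rewrite CE -PQ; set q := (2 * pi) `^ alpha / _; set c := cos _; ring.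
  have q0 : 0 < (2 * pi) `^ alpha / pi ^+ 2 :> R.
    by rewrite divr_gt0 ?powR_gt0 ?exprn_gt0// mulr_gt0.
  apply: mulr_gt0 => //; apply: mulr_gt0 => //; apply: mulr_gt0 => //.
  by apply: mulr_gt0 => //; exact: mulr_gt0.
have : Var_B R b N / N%:R `^ alpha / C0 @[N --> \oo] --> C0 / C0.
  by apply: cvgM; [rewrite {1}CE; exact: asymp|exact: cvg_cst].
have C0_neq0 : C0 != 0 by rewrite gt_eqF.
rewrite divff// => h; apply: cvg_trans h; apply: near_eq_cvg; apply: nearW => N /=.
by rewrite -mulrA -invfM [C0 * _]mulrC.
Qed.
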